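(* For every $2<p<\infty$ there exists a constant $c(p)>0$, depending only on $p$, with the following property: for every $n\ge 1$, every $n$-dimensional subspace $X$ of $L_p$ and every $\varepsilon\in(0,1)$ there exists an integer $k\ge c(p)\min\{\varepsilon^2 n,(\varepsilon n)^{2/p}\}$ such that $\ell_2^k$ can be $(1+\varepsilon)$-embedded into $X$.
   Context: $L_p=L_p(\Omega,\mathcal E,\nu)$ denotes the real $L_p$ space over a measure space, with norm $\|f\|_{L_p(\nu)}=(\int_\Omega|f|^p\,d\nu)^{1/p}$. $\ell_2^k$ is $\mathbb R^k$ with the Euclidean norm $\|\cdot\|_2$. One says that $\ell_2^k$ can be $(1+\varepsilon)$-embedded into a normed space $X$ if there is a linear map $T:\ell_2^k\to X$ with $\|x\|_2\le\|Tx\|_X\le(1+\varepsilon)\|x\|_2$ for all $x\in\ell_2^k$. *)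

(* Defs.v *)
From HB Require Import structures.
From mathcomp Require Import all_boot all_order all_algebra.
From mathcomp Require Import all_classical all_reals all_analysis.
From mathcomp Require Import measurable_realfun ess_sup_inf.
Set Implicit Arguments.
Unset Strict Implicit.
Unset Printing Implicit Defensive.
Import Order.TTheory GRing.Theory Num.Theory.
Import numFieldNormedType.Exports.

Local Open Scope classical_set_scope.
Local Open Scope ring_scope.

(* The library defines the type [LspaceType mu p1] of classes of p-integrable
   functions modulo a.e. equality, but puts no algebraic structure on it; this
   section makes it a normed R-module, the operations being those induced by
   the pointwise operations on representatives.  The library's classes have
   codomain [measurableTypeR R], whose sigma-algebra is that of [R]. *)
Section Lspace_normed.
Context d (T : measurableType d) (R : realType).
Variables (mu : {measure set T -> \bar R}) (p : \bar R) (p1 : (1 <= p)%E).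
Local Notation L := (LspaceType mu p1).
Local Notation F := (LfunType mu p1).

Lemma Lspace_Lfun (f : L) : (f : T -> R) \in Lfun mu p.
Proof.
apply/andP; split; rewrite inE.
  suff : measurable_fun setT (f : T -> measurableTypeR R) by [].
  exact: measurable_funPT.
exact: Lebesgue_finite.
Qed.

Definition Lspace_repr (f : L) : F := Lfun_Sub p1 (Lspace_Lfun f).

Lemma Lfun_measurableTypeR (f : F) :
  measurable_fun setT (f : T -> measurableTypeR R).
Proof.
have mf : measurable_fun setT (f : T -> R) by exact: measurable_funPT.
exact: mf.
Qed.

Definition Lfun_mfun (f : F) : {mfun T >-> measurableTypeR R} :=
  MeasurableFun.Pack (MeasurableFun.Class
    (isMeasurableFun.Build _ _ _ _ _ (Lfun_measurableTypeR f))).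

Definition Lfun_aeEq (f : F) : {mfun_ mu, T >-> measurableTypeR R} :=
  \pi%qT (Lfun_mfun f).

Lemma Lfun_aeEqE (f : F) :
  (Lfun_aeEq f : T -> R) = (f : T -> R) %[ae mu].
Proof. by have /eqmodP/asboolP := reprK (Lfun_aeEq f). Qed.

Lemma ae_eq_Lnorm (f g : T -> R) :
  measurable_fun setT f -> measurable_fun setT g -> f = g %[ae mu] ->
  Lnorm mu p (EFin \o f) = Lnorm mu p (EFin \o g).
Proof.
move=> mf mg fg; rewrite unlock; case: p => [r| |] /=.
- congr (_ `^ _)%E; apply: ge0_ae_eq_integral => //.
  + apply/measurable_EFinP/(measurableT_comp (measurable_powR _)).
    exact: measurableT_comp.
  + apply/measurable_EFinP/(measurableT_comp (measurable_powR _)).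
    exact: measurableT_comp.
  + by apply: filterS fg => x /= /(_ I) ->.
- case: ifP => // _; apply: eq_ess_sup.
  by apply: filterS fg => x /= /(_ I) ->.
- case: ifP => // _; apply: eq_ess_inf.
  by apply: filterS fg => x /= /(_ I) ->.
Qed.

Lemma Lfun_aeEq_finite (f : F) : finite_norm mu p (Lfun_aeEq f : T -> R).
Proof.
rewrite /finite_norm (ae_eq_Lnorm _ _ (Lfun_aeEqE f)).
- exact: Lfunction_finite.
- suff : measurable_fun setT (Lfun_aeEq f : T -> measurableTypeR R) by [].
  exact: measurable_funPT.
- exact: measurable_funPT.
Qed.

Definition Lclass (f : F) : L :=
  LebesgueSpace.Pack (LebesgueSpace.Class
    (isFinLebesgue.Build _ _ _ _ _ p1 _ (Lfun_aeEq_finite f))).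

Lemma Lspace_sort_inj (f g : L) :
  LebesgueSpace.sort f = LebesgueSpace.sort g -> f = g.
Proof.
case: f g => [f [[cf]]] [g [[cg]]] /= fg; move: cf cg; rewrite fg => cf cg.
by rewrite (Prop_irrelevance cf cg).
Qed.

Lemma Lclass_eqP (f g : F) :
  Lclass f = Lclass g <-> (f : T -> R) = (g : T -> R) %[ae mu].
Proof.
split=> [[/eqmodP/asboolP//]|fg].
by apply: Lspace_sort_inj; apply/eqmodP/asboolP.
Qed.

Lemma Lspace_reprK : cancel Lspace_repr Lclass.
Proof.
move=> f; apply: Lspace_sort_inj => /=; rewrite /Lfun_aeEq -[RHS]reprK.
by apply/eqmodP/asboolP; exact: ae_eq_refl.
Qed.

Lemma LclassK (f : F) :
  (Lspace_repr (Lclass f) : T -> R) = (f : T -> R) %[ae mu].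
Proof. exact: Lfun_aeEqE. Qed.

HB.instance Definition _ := gen_eqMixin L.
HB.instance Definition _ := gen_choiceMixin L.

Definition Lspace_zero : L := Lclass 0.
Definition Lspace_opp (f : L) : L := Lclass (- Lspace_repr f).
Definition Lspace_add (f g : L) : L := Lclass (Lspace_repr f + Lspace_repr g).
Definition Lspace_scale (a : R) (f : L) : L := Lclass (a *: Lspace_repr f).

Let LclassN f : Lspace_opp (Lclass f) = Lclass (- f).
Proof.
apply/Lclass_eqP; apply: filterS (LclassK f) => x /= hf xT.
by congr (- _); exact: hf.
Qed.

Let LclassD f g : Lspace_add (Lclass f) (Lclass g) = Lclass (f + g).
Proof.
apply/Lclass_eqP; apply: filterS2 (LclassK f) (LclassK g) => x /= hf hg xT.
by congr (_ + _); [exact: hf|exact: hg].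
Qed.

Let LclassZ a f : Lspace_scale a (Lclass f) = Lclass (a *: f).
Proof.
apply/Lclass_eqP; apply: filterS (LclassK f) => x /= hf xT.
by congr (_ * _); exact: hf.
Qed.

Let Lspace_addA : associative Lspace_add.
Proof.
move=> f g h; rewrite -(Lspace_reprK f) -(Lspace_reprK g) -(Lspace_reprK h).
by rewrite !LclassD addrA.
Qed.

Let Lspace_addC : commutative Lspace_add.
Proof. by move=> f g; rewrite /Lspace_add addrC. Qed.

Let Lspace_add0 : left_id Lspace_zero Lspace_add.
Proof. by move=> f; rewrite -(Lspace_reprK f) LclassD add0r. Qed.

Let Lspace_addN : left_inverse Lspace_zero Lspace_opp Lspace_add.
Proof. by move=> f; rewrite -(Lspace_reprK f) LclassN LclassD addNr. Qed.

HB.instance Definition _ := GRing.isZmodule.Build L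
  Lspace_addA Lspace_addC Lspace_add0 Lspace_addN.

Let Lspace_scaleA a b f :
  Lspace_scale a (Lspace_scale b f) = Lspace_scale (a * b) f.
Proof. by rewrite -(Lspace_reprK f) !LclassZ scalerA. Qed.

Let Lspace_scale1 : left_id 1 Lspace_scale.
Proof. by move=> f; rewrite -(Lspace_reprK f) LclassZ scale1r. Qed.

Let Lspace_scaleDr : right_distributive Lspace_scale +%R.
Proof.
move=> a f g; rewrite -(Lspace_reprK f) -(Lspace_reprK g).
by rewrite [_ (Lclass _) _]LclassD !LclassZ [RHS]LclassD scalerDr.
Qed.

Let Lspace_scaleDl f : {morph Lspace_scale^~ f : a b / a + b}.
Proof.
move=> a b; rewrite -(Lspace_reprK f).
by rewrite !LclassZ [RHS]LclassD scalerDl.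
Qed.

HB.instance Definition _ := GRing.Zmodule_isLmodule.Build R L
  Lspace_scaleA Lspace_scale1 Lspace_scaleDr Lspace_scaleDl.

(* A real number, since the norm is finite on [L] *)
Definition Lspace_norm (f : L) : R := fine (Lnorm mu p (EFin \o (f : T -> R))).

Lemma Lspace_norm_class (f : F) :
  Lspace_norm (Lclass f) = fine (Lnorm mu p (EFin \o (f : T -> R))).
Proof.
congr fine; apply: ae_eq_Lnorm (Lfun_aeEqE f).
- suff : measurable_fun setT (Lfun_aeEq f : T -> measurableTypeR R) by [].
  exact: measurable_funPT.
- exact: measurable_funPT.
Qed.

Lemma Lclass0 : Lclass 0 = 0.
Proof. by []. Qed.

Lemma LclassDE (f g : F) : Lclass (f + g) = Lclass f + Lclass g.
Proof. by rewrite [RHS]LclassD. Qed.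

Lemma LclassNE (f : F) : Lclass (- f) = - Lclass f.
Proof. by rewrite [RHS]LclassN. Qed.

Lemma LclassZE a (f : F) : Lclass (a *: f) = a *: Lclass f.
Proof. by rewrite [RHS]LclassZ. Qed.

Let Lspace_normD f g : Lspace_norm (f + g) <= Lspace_norm f + Lspace_norm g.
Proof.
rewrite -(Lspace_reprK f) -(Lspace_reprK g) -LclassDE !Lspace_norm_class.
exact: ler_LnormD.
Qed.

Let Lspace_normZ a f : Lspace_norm (a *: f) = `|a| * Lspace_norm f.
Proof.
rewrite -(Lspace_reprK f) -LclassZE !Lspace_norm_class.
apply: EFin_inj; rewrite EFinM !finite_norm_fine.
exact: LnormZ.
Qed.

Let Lspace_norm0_eq0 f : Lspace_norm f = 0 -> f = 0.
Proof.
rewrite -(Lspace_reprK f) Lspace_norm_class => /fine_Lnormr_eq0 f0.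
by apply/Lclass_eqP.
Qed.

HB.instance Definition _ := @Lmodule_isNormed.Build R L
  Lspace_norm Lspace_normD Lspace_normZ Lspace_norm0_eq0.

Lemma Lspace_normE (f : L) :
  `|f| = fine (Lnorm mu p (EFin \o (f : T -> R))).
Proof. by []. Qed.

End Lspace_normed.

(* The norm the library puts on 'rV[R]_k is the sup norm *)
Definition l2norm (R : realType) (k : nat) (x : 'rV[R]_k) : R :=
  Num.sqrt (\sum_(i < k) x 0 i ^+ 2).

Definition lin_indep (R : realType) (V : lmodType R) (n : nat)
    (b : 'I_n -> V) : Prop :=
  forall a : 'I_n -> R, \sum_(i < n) a i *: b i = 0 -> forall i, a i = 0.

Definition lin_span (R : realType) (V : lmodType R) (n : nat)
    (b : 'I_n -> V) : set V :=
  [set v | exists a : 'I_n -> R, v = \sum_(i < n) a i *: b i].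

Definition subspace_of_dim (R : realType) (V : lmodType R) (n : nat)
    (X : set V) : Prop :=
  exists b : 'I_n -> V, lin_indep b /\ X = lin_span b.

(* [l2_embeds k eps X]: l_2^k can be (1 + eps)-embedded into X, where X is a
   linear subspace of V with the norm of V *)
Definition l2_embeds (R : realType) (V : normedModType R) (k : nat) (eps : R)
    (X : set V) : Prop :=
  exists f : {linear 'rV[R]_k -> V},
    forall x, [/\ X (f x), l2norm x <= `|f x|
                & `|f x| <= (1 + eps) * l2norm x].

Lemma ge1_of_gt2 (R : realType) (p : R) : 2 < p -> (1 <= p%:E)%E.
Proof.
by move=> p2; rewrite lee_fin (le_trans _ (ltW p2))// ler1n.
Qed.

(* Main.v *)
From HB Require Import structures.
Require Import Defs.
From mathcomp Require Import all_boot all_order all_algebra perm.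
From mathcomp Require Import all_classical all_reals all_analysis.
From mathcomp Require Import measurable_realfun.
From mathcomp Require Import ring lra.
Set Implicit Arguments.
Unset Strict Implicit.
Unset Printing Implicit Defensive.
Import Order.TTheory GRing.Theory Num.Theory.
Import numFieldNormedType.Exports.

Local Open Scope classical_set_scope.
Local Open Scope ring_scope.

(** Perturbing a basis to simple functions turns the norm of an n-dimensional
subspace of L_p into (sum_l w_l |<a, v_l>|^p)^(1/p).  A linear change of
variables that nearly maximises a determinant, a weak form of Lewis' theorem,
rewrites the p-th power of this norm as a multiple of sum_i c_i |<u_i, a>|^p,
where |u_i| = 1, sum_i c_i = m := n/(3p) and sum_i c_i <u_i, y>^2 <= |y|^2.

The embedding is x |-> xG for a Gaussian matrix G.  The random power sum
Y_r(x) := sum_i c_i |<u_i, xG>|^r has mean a multiple of m |x|^r.  Rotating the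
pair of G and an independent copy G' through a right angle by 2^i equal steps,
i tending to infinity, bounds E sup |Y_r - Y'_r| by the expected supremum of
the gradient of Y_r at G in the direction G'.  Given G this is a Gaussian
process linear in G', whose increments are controlled by a power of sup Y_q,
and it is estimated by chaining.  For q = r = 2p - 2 the resulting bound on
sup Y_r improves itself; inserting it for r = p, q = 2p - 2 gives fluctuations
of order sqrt (k m) + k^(p/2), at most eps m when k is of order
min(eps^2 n, (eps n)^(2/p)). *)

(** The gradient of [Y_p] has no useful deterministic Lipschitz constant: its increments depend on
    the sample. By Hölder's inequality, in the additive form [young3] with
    [(r - 1) / q + 1 / s = 1], they are of order [(sup Y_q)^((r - 1) / q) |x - y|]; the power
    [s >= 2] is where [sum_i c_i <u_i, y>^2 <= |y|^2] enters. For [r = p] the choice [s = 2] forces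
    [q = 2p - 2] and leaves only a square root of [sup Y_q], hence the term [sqrt (k m)]. The price
    is an a priori bound on [sup Y_(2p - 2)]. It comes from the same estimate with [r = q], where
    the exponent [(r - 1) / r < 1] lets the supremum be absorbed.

    Rotations are made in finitely many steps with a second-order Taylor bound, so that invariance
    of the measure suffices and nothing is differentiated under an integral. All random suprema run
    over finite nets; the chaining bound is uniform in the finest level, which can thus be chosen
    from [p] and [eps] alone.

    A near-maximiser of the determinant, compared with a single competitor, replaces Lewis's exact
    extremal position at the cost of the factor [3p] in [m]. *)

Section powR_inequalities.
Context {R : realType}.
Implicit Types (r x y c s a b g : R).

(** Up to the factor [r], the derivative of [|x|^r]; locked, so that it is opened only through
    [phiE]. *)
Definition phi : R -> R -> R := locked (fun r x => x * `|x| `^ (r - 2)).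

Lemma phiE r x : phi r x = x * `|x| `^ (r - 2).
Proof. by rewrite /phi -lock. Qed.

Lemma phiN r x : phi r (- x) = - phi r x.
Proof. by rewrite !phiE normrN mulNr. Qed.

Lemma phi_ge0E r x : 1 < r -> 0 <= x -> phi r x = x `^ (r - 1).
Proof.
move=> r1 x0; rewrite phiE ger0_norm//.
have -> : r - 2 = (r - 1) - 1 by ring.
by rewrite mulr_powRB1 ?subr_gt0.
Qed.

Lemma normr_phi r x : 1 < r -> `|phi r x| = `|x| `^ (r - 1).
Proof.
move=> r1; rewrite -phi_ge0E// !phiE normrM normr_id.
by congr (_ * _); rewrite ger0_norm// powR_ge0.
Qed.

Lemma mulr_phi r x : 1 < r -> phi r x * x = `|x| `^ r.
Proof.
move=> r1; rewrite phiE mulrAC -expr2 -real_normK ?num_real// expr2 -mulrA.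
have -> : r - 2 = (r - 1) - 1 by ring.
by rewrite mulr_powRB1 ?subr_gt0// mulr_powRB1// (lt_trans _ r1).
Qed.

(** Convexity of the power without derivatives: Young's inequality for [y] and [x^(r - 1)] with the
    conjugate exponents [r] and [r / (r - 1)]. *)
Lemma powR_tangent r x y : 1 < r -> 0 <= x -> 0 <= y ->
  x `^ r + r * x `^ (r - 1) * (y - x) <= y `^ r.
Proof.
move=> r1 x0 y0; have r0 : 0 < r by rewrite (lt_trans _ r1).
have r10 : 0 < r - 1 by rewrite subr_gt0.
have := @conjugate_powR _ y (x `^ (r - 1)) r (r / (r - 1)) y0 (powR_ge0 _ _) r0.
rewrite divr_gt0// => /(_ isT); rewrite -powRrM.
have -> : (r - 1) * (r / (r - 1)) = r by field; lra.
have -> : r^-1 + (r / (r - 1))^-1 = 1.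
  by field; apply/andP; split; apply: lt0r_neq0.
move=> /(_ erefl); rewrite -subr_ge0 => h.
have xx : x * x `^ (r - 1) = x `^ r by rewrite mulr_powRB1.
rewrite -subr_ge0.
set A := x `^ r in xx h *; set B := x `^ _ in xx h *; set D := y `^ r in h *.
have -> : D - (A + r * B * (y - x)) =
   r * (D / r + A / (r / (r - 1)) - y * B) + r * (x * B - A).
  by field; apply/andP; split; apply: lt0r_neq0.
by rewrite xx subrr mulr0 addr0 mulr_ge0// ltW.
Qed.

Lemma normr_powR_tangent r x y : 1 < r ->
  `|x| `^ r + r * phi r x * (y - x) <= `|y| `^ r.
Proof.
move=> r1; have r0 : 0 < r by rewrite (lt_trans _ r1).
apply: le_trans (powR_tangent r1 (normr_ge0 x) (normr_ge0 y)).
rewrite lerD2l -!mulrA ler_pM2l// !mulrBr mulr_phi//.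
rewrite [`|x| `^ _ * `|x|]mulrC mulr_powRB1//.
by rewrite lerD2r -normr_phi// -normrM ler_norm.
Qed.

Let phi_lip_pos r x y : 2 < r -> 0 <= x -> x <= y ->
  y `^ (r - 1) - x `^ (r - 1) <= r * (y - x) * (x + y) `^ (r - 2).
Proof.
move=> r2 x0 xy; have y0 : 0 <= y by exact: le_trans xy.
have r1 : 1 < r - 1 by lra.
have := powR_tangent r1 y0 x0.
have -> : r - 1 - 1 = r - 2 by ring.
rewrite addrC -lerBrDr => h; rewrite -lerN2 opprB (le_trans _ h)//.
rewrite -subr_ge0; rewrite -subr_ge0 in xy.
have -> : (r - 1) * y `^ (r - 2) * (x - y) - - (r * (y - x) * (x + y) `^ (r - 2))
  = (y - x) * (r * ((x + y) `^ (r - 2) - y `^ (r - 2)) + y `^ (r - 2)) by ring.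
apply: mulr_ge0 => //; apply: addr_ge0; last exact: powR_ge0.
apply: mulr_ge0; first lra.
rewrite subr_ge0 ge0_ler_powR ?nnegrE//; lra.
Qed.

Let phi_lip_sgn r x y : 2 < r -> 0 <= x -> 0 <= y ->
  x `^ (r - 1) + y `^ (r - 1) <= r * (x + y) * (x + y) `^ (r - 2).
Proof.
move=> r2 x0 y0.
have h : forall z, 0 <= z -> z <= x + y ->
    z `^ (r - 1) <= z * (x + y) `^ (r - 2).
  move=> z z0 zxy; rewrite -mulr_powRB1//; last lra.
  have -> : r - 1 - 1 = r - 2 by ring.
  by rewrite ler_wpM2l// ge0_ler_powR ?nnegrE//; lra.
apply: (@le_trans _ _ ((x + y) * (x + y) `^ (r - 2))).
  by rewrite mulrDl lerD// h//; lra.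
rewrite -mulrA ler_peMl//; last lra.
by rewrite mulr_ge0 ?powR_ge0//; lra.
Qed.

(** For equal signs this is the tangent inequality for the power [r - 1 > 1]; for opposite signs
    there is no cancellation and each term is bounded separately. *)
Lemma phi_lip r x y : 2 < r ->
  `|phi r y - phi r x| <= r * `|y - x| * (`|x| + `|y|) `^ (r - 2).
Proof.
move=> r2; have r1 : 1 < r by lra.
wlog x0 : x y / 0 <= x => [h|].
  case: (leP 0 x) => [|x0]; first exact: h.
  have := h (- x) (- y); rewrite !phiN -!opprD !normrN; apply.
  by rewrite oppr_ge0 ltW.
case: (leP 0 y) => [y0|y0].
- wlog xy : x y x0 y0 / x <= y => [h|].
    case: (leP x y) => [|/ltW yx]; first exact: h.
    by rewrite distrC (distrC y) [`|x| + _]addrC; exact: h.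
  rewrite !phi_ge0E// !ger0_norm ?subr_ge0//; first exact: phi_lip_pos.
  by rewrite ge0_ler_powR ?nnegrE//; lra.
- have Ny0 : 0 <= - y by lra.
  rewrite (ltr0_norm y0) (ger0_norm x0) -[in phi r y](opprK y) phiN.
  rewrite !phi_ge0E// -opprD normrN ger0_norm ?addr_ge0 ?powR_ge0//.
  rewrite ltr0_norm; last lra.
  by rewrite opprB addrC; exact: phi_lip_sgn.
Qed.

Lemma powRD_le r x y : 0 < r -> 0 <= x -> 0 <= y ->
  (x + y) `^ r <= 2 `^ r * (x `^ r + y `^ r).
Proof.
move=> r0; wlog xy : x y / x <= y => [h x0 y0|].
  case: (leP x y) => [|/ltW yx]; first by move=> ?; exact: h.
  by rewrite addrC [x `^ _ + _]addrC; exact: h.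
move=> x0 y0; apply: (@le_trans _ _ ((2 * y) `^ r)).
  by rewrite ge0_ler_powR ?nnegrE//; lra.
rewrite powRM//.
by rewrite ler_wpM2l ?powR_ge0// lerDr powR_ge0.
Qed.

(* The second factor tends to the first-order Taylor expansion as [s -> 0]. *)
Lemma powR_rotation r c s x y : 2 < r -> 0 <= c <= 1 -> 0 <= s <= 1 ->
    1 - c <= s ^+ 2 ->
  `| `|c * x + s * y| `^ r - `|x| `^ r - r * s * (phi r x * y)|
    <= s ^+ 2 * ((r ^+ 2 * 4 `^ r + r) * (`|x| `^ r + `|y| `^ r)).
Proof.
move=> r2 /andP[c0 c1] /andP[s0 s1] cs; have r1 : 1 < r by lra.
set z : R := c * x + s * y; set M : R := `|x| + `|y|.
have M0 : 0 <= M by rewrite addr_ge0.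
have zx : `|z - x| <= s * M.
  have -> : z - x = - ((1 - c) * x) + s * y by rewrite /z; ring.
  rewrite (le_trans (ler_normD _ _))// normrN !normrM /M mulrDr.
  rewrite (ger0_norm s0) lerD2r ler_wpM2r// ger0_norm ?subr_ge0//.
  by rewrite (le_trans cs)// expr2 ler_piMl.
have zM : `|z| <= M.
  rewrite (le_trans (ler_normD _ _))// !normrM (ger0_norm c0) (ger0_norm s0) lerD//.
    by rewrite ler_piMl.
  by rewrite ler_piMl.
(* The tangents at [x] and at [z] squeeze the remainder between [0] and
   [r (phi r z - phi r x) (z - x)]; [phi_lip] makes this quadratic in [z - x], hence of order
   [s^2]. *)
have main : `| `|z| `^ r - `|x| `^ r - r * phi r x * (z - x)|
    <= r ^+ 2 * s ^+ 2 * (4 `^ r * (`|x| `^ r + `|y| `^ r)).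
  have := normr_powR_tangent x z r1; rewrite -subr_ge0 opprD addrA => h1.
  have := normr_powR_tangent z x r1; rewrite -lerBrDl => h2.
  rewrite ger0_norm//.
  apply: (@le_trans _ _ (r * ((phi r z - phi r x) * (z - x)))); first lra.
  apply: (@le_trans _ _ (r * (r * `|z - x| * (`|x| + `|z|) `^ (r - 2) * `|z - x|))).
    rewrite ler_pM2l; last lra.
    by rewrite (le_trans (ler_norm _))// normrM ler_wpM2r// phi_lip.
  have -> : r * (r * `|z - x| * (`|x| + `|z|) `^ (r - 2) * `|z - x|) =
    r ^+ 2 * (`|z - x| ^+ 2 * (`|x| + `|z|) `^ (r - 2)) by ring.
  rewrite -mulrA ler_wpM2l ?sqr_ge0//.
  apply: (@le_trans _ _ (s ^+ 2 * (2 * M) ^+ 2 * (2 * M) `^ (r - 2))).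
    apply: ler_pM; rewrite ?sqr_ge0 ?powR_ge0//.
      rewrite -exprMn ler_pXn2r ?nnegrE// ?mulr_ge0//.
      by rewrite (le_trans zx)// ler_wpM2l//; lra.
    rewrite ge0_ler_powR ?nnegrE//;
      [lra|by rewrite mulr_ge0|].
    by rewrite mulr_natl mulr2n lerD// lerDl.
  rewrite -mulrA; apply: ler_wpM2l; first exact: sqr_ge0.
  rewrite expr2 -mulrA (_ : r - 2 = (r - 1) - 1); last ring.
  rewrite mulr_powRB1 ?subr_gt0 ?mulr_ge0// mulr_powRB1 ?mulr_ge0//; last lra.
  rewrite powRM// (_ : 4 = 2 * 2); last lra.
  rewrite (powRM _ (ler0n R 2) (ler0n R 2)) -mulrA ler_wpM2l ?powR_ge0//.
  by apply: powRD_le => //; lra.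
(* [z - x] differs from [s * y] by [(1 - c) * x], which is of second order by the hypothesis on
   [c]. *)
have -> : `|z| `^ r - `|x| `^ r - r * s * (phi r x * y) =
   (`|z| `^ r - `|x| `^ r - r * phi r x * (z - x)) - r * (1 - c) * (phi r x * x).
  by rewrite /z; ring.
rewrite (le_trans (ler_normB _ _))// mulr_phi//.
have -> : s ^+ 2 * ((r ^+ 2 * 4 `^ r + r) * (`|x| `^ r + `|y| `^ r)) =
  r ^+ 2 * s ^+ 2 * (4 `^ r * (`|x| `^ r + `|y| `^ r))
  + r * s ^+ 2 * (`|x| `^ r + `|y| `^ r) by ring.
apply: lerD => //; rewrite ger0_norm; last first.
  by rewrite !mulr_ge0 ?powR_ge0 ?subr_ge0//; lra.
apply: ler_pM; rewrite ?powR_ge0 ?lerDl ?powR_ge0//.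
  by rewrite mulr_ge0 ?subr_ge0//; lra.
by rewrite ler_pM2l//; lra.
Qed.

(** Each of the three numbers is at most [M^(1/q)] or [M^(1/s)], where [M] is the right-hand side,
    and the exponents of [M] in the product add up to [1]. *)
Lemma young3 r q s a b g : 2 < r -> 0 < q -> 0 < s -> (r - 1) / q + s^-1 = 1 ->
  0 <= a -> 0 <= b -> 0 <= g ->
  a * b `^ (r - 2) * g <= a `^ q + b `^ q + g `^ s.
Proof.
move=> r2 q0 s0 rqs a0 b0 g0.
set M := a `^ q + b `^ q + g `^ s.
have M0 : 0 <= M by rewrite !addr_ge0 ?powR_ge0.
have root (x t : R) : 0 <= x -> 0 < t -> x `^ t <= M -> x <= M `^ t^-1.
  move=> x0 t0 xM; rewrite -[leLHS]powRr1// -(divff (lt0r_neq0 t0)) powRrM.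
  by rewrite ge0_ler_powR ?nnegrE ?powR_ge0// invr_ge0 ltW.
have aM : a <= M `^ q^-1.
  by apply: root => //; rewrite /M -addrA lerDl addr_ge0 ?powR_ge0.
have bM : b <= M `^ q^-1.
  by apply: root => //; rewrite /M addrAC lerDr addr_ge0 ?powR_ge0.
have gM : g <= M `^ s^-1 by apply: root => //; rewrite lerDr addr_ge0 ?powR_ge0.
apply: (@le_trans _ _ (M `^ q^-1 * (M `^ q^-1) `^ (r - 2) * M `^ s^-1)).
  apply: ler_pM; rewrite ?mulr_ge0 ?powR_ge0//.
  apply: ler_pM; rewrite ?powR_ge0//.
  by rewrite ge0_ler_powR ?nnegrE ?powR_ge0//; lra.
rewrite (_ : r - 2 = (r - 1) - 1); last ring.
rewrite mulr_powRB1 ?powR_ge0//; last lra.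
rewrite -powRrM [q^-1 * _]mulrC -powRD ?rqs ?powRr1//.
by rewrite oner_eq0.
Qed.

End powR_inequalities.

(** * Euclidean norm and nets *)

Section euclidean.
Context {R : realType}.

Definition dot d (a b : 'rV[R]_d) : R := (a *m b^T) 0 0.

Lemma dotE d (a b : 'rV[R]_d) : dot a b = \sum_(i < d) a 0 i * b 0 i.
Proof. by rewrite /dot !mxE; apply: eq_bigr => i _; rewrite mxE. Qed.

Lemma dotC d (a b : 'rV[R]_d) : dot a b = dot b a.
Proof. by rewrite !dotE; apply: eq_bigr => i _; rewrite mulrC. Qed.

Lemma dotDl d (a b x : 'rV[R]_d) : dot (a + b) x = dot a x + dot b x.
Proof. by rewrite /dot mulmxDl mxE. Qed.

Lemma dotZl d c (a x : 'rV[R]_d) : dot (c *: a) x = c * dot a x.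
Proof. by rewrite /dot -scalemxAl mxE. Qed.

Lemma dotNl d (a x : 'rV[R]_d) : dot (- a) x = - dot a x.
Proof. by rewrite -scaleN1r dotZl mulN1r. Qed.

Lemma dotBl d (a b x : 'rV[R]_d) : dot (a - b) x = dot a x - dot b x.
Proof. by rewrite dotDl dotNl. Qed.

Lemma dotDr d (a b x : 'rV[R]_d) : dot x (a + b) = dot x a + dot x b.
Proof. by rewrite dotC dotDl !(dotC x). Qed.

Lemma dotZr d c (a x : 'rV[R]_d) : dot x (c *: a) = c * dot x a.
Proof. by rewrite dotC dotZl (dotC x). Qed.

Lemma dot0l d (x : 'rV[R]_d) : dot 0 x = 0.
Proof. by rewrite /dot mul0mx mxE. Qed.

Lemma dot_suml d (I : Type) (s : seq I) (P : pred I) (F : I -> 'rV[R]_d) x :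
  dot (\sum_(i <- s | P i) F i) x = \sum_(i <- s | P i) dot (F i) x.
Proof. by rewrite /dot mulmx_suml summxE. Qed.

Lemma dotxx_ge0 d (a : 'rV[R]_d) : 0 <= dot a a.
Proof. by rewrite dotE sumr_ge0// => i _; rewrite -expr2 sqr_ge0. Qed.

Lemma l2normE d (a : 'rV[R]_d) : l2norm a = Num.sqrt (dot a a).
Proof. by rewrite /l2norm dotE; congr Num.sqrt. Qed.

Lemma l2norm_ge0 d (a : 'rV[R]_d) : 0 <= l2norm a.
Proof. exact: sqrtr_ge0. Qed.

Lemma l2norm_sqr d (a : 'rV[R]_d) : l2norm a ^+ 2 = dot a a.
Proof. by rewrite l2normE sqr_sqrtr// dotxx_ge0. Qed.

Lemma l2norm0 d : l2norm (0 : 'rV[R]_d) = 0.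
Proof. by rewrite l2normE dot0l sqrtr0. Qed.

Lemma l2norm_eq0 d (a : 'rV[R]_d) : l2norm a = 0 -> a = 0.
Proof.
move=> /(congr1 (fun z => z ^+ 2)); rewrite l2norm_sqr expr0n/= dotE => /eqP.
rewrite psumr_eq0 => [/allP h|i _]; last by rewrite -expr2 sqr_ge0.
apply/rowP => i; rewrite mxE; apply/eqP.
by have := h i; rewrite mem_index_enum => /(_ isT); rewrite mulf_eq0 orbb.
Qed.

Lemma l2normZ d c (a : 'rV[R]_d) : l2norm (c *: a) = `|c| * l2norm a.
Proof.
by rewrite !l2normE dotZl dotZr mulrA -expr2 sqrtrM ?sqr_ge0// sqrtr_sqr.
Qed.

Lemma normr_dot_le d (a b : 'rV[R]_d) : `|dot a b| <= l2norm a * l2norm b.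
Proof.
rewrite -ler_sqr ?nnegrE ?mulr_ge0 ?l2norm_ge0// real_normK ?num_real//.
rewrite exprMn !l2norm_sqr.
have [b0|b0] := eqVneq (l2norm b) 0.
  by rewrite (l2norm_eq0 b0) !(dotC _ 0) !dot0l expr0n mulr0.
have bb : 0 < dot b b by rewrite -l2norm_sqr exprn_even_gt0.
have := dotxx_ge0 (dot b b *: a - dot a b *: b).
rewrite !(dotBl, dotZl) !(dotC _ (_ - _)) !(dotBl, dotZl) (dotC b a).
rewrite (_ : _ - _ = dot b b * (dot a a * dot b b - dot a b ^+ 2)); last ring.
by rewrite pmulr_rge0// subr_ge0.
Qed.

Lemma dot_le d (a b : 'rV[R]_d) : dot a b <= l2norm a * l2norm b.
Proof. exact: le_trans (ler_norm _) (normr_dot_le _ _). Qed.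

Lemma l2normD_le d (a b : 'rV[R]_d) : l2norm (a + b) <= l2norm a + l2norm b.
Proof.
rewrite -ler_sqr ?nnegrE ?addr_ge0 ?l2norm_ge0// l2norm_sqr.
rewrite dotDl !dotDr -!l2norm_sqr (dotC b) sqrrD.
have := dot_le a b; lra.
Qed.

Lemma l2norm_le_dot d (a : 'rV[R]_d) M : 0 <= M ->
  (forall b, dot a b <= M * l2norm b) -> l2norm a <= M.
Proof.
move=> M0 h; have [->//|a0] := eqVneq (l2norm a) 0.
have ap : 0 < l2norm a by rewrite lt_neqAle eq_sym a0 l2norm_ge0.
by have := h a; rewrite -l2norm_sqr expr2 ler_pM2r.
Qed.

Lemma normr_coord_le d (a : 'rV[R]_d) i : `|a 0 i| <= l2norm a.
Proof.
rewrite -ler_sqr ?nnegrE ?l2norm_ge0// real_normK ?num_real// l2norm_sqr dotE.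
by rewrite (bigD1 i)//= -expr2 lerDl sumr_ge0// => j _; rewrite -expr2 sqr_ge0.
Qed.

Lemma sum_normr_coord_le d (a : 'rV[R]_d) :
  \sum_(i < d) `|a 0 i| <= Num.sqrt d%:R * l2norm a.
Proof.
pose o : 'rV[R]_d := const_mx 1; pose b : 'rV[R]_d := \row_i `|a 0 i|.
have -> : \sum_(i < d) `|a 0 i| = dot o b.
  by rewrite dotE; apply: eq_bigr => i _; rewrite !mxE mul1r.
have -> : l2norm a = l2norm b.
  by congr Num.sqrt; apply: eq_bigr => i _; rewrite mxE real_normK ?num_real.
have -> : Num.sqrt d%:R = l2norm o; last exact: dot_le.
  rewrite l2normE dotE; congr Num.sqrt; under eq_bigr do rewrite mxE mulr1.
  by rewrite sumr_const card_ord.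
Qed.

Lemma l2norm_le_coord d (a : 'rV[R]_d) M : 0 <= M ->
  (forall i, `|a 0 i| <= M) -> l2norm a <= Num.sqrt d%:R * M.
Proof.
move=> M0 h.
rewrite -ler_sqr ?nnegrE ?l2norm_ge0 ?mulr_ge0 ?sqrtr_ge0//.
rewrite l2norm_sqr dotE exprMn sqr_sqrtr ?ler0n//.
apply: (@le_trans _ _ (\sum_(i < d) M ^+ 2)); last first.
  by rewrite sumr_const card_ord mulr_natl.
apply: ler_sum => i _; rewrite -expr2 -real_normK ?num_real//.
by rewrite ler_pXn2r ?nnegrE// (le_trans _ (h i)).
Qed.

End euclidean.

Section ball_nets.
Context {R : realType}.

Lemma geometric_half_le2 n : \sum_(j < n) 2^-1 ^+ j <= 2 :> R.
Proof.
suff -> : \sum_(j < n) 2^-1 ^+ j = 2 - 2 * 2^-1 ^+ n :> R.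
  by rewrite gerBl mulr_ge0// exprn_ge0// invr_ge0.
elim: n => [|n IHn]; first by rewrite big_ord0 expr0 mulr1 subrr.
by rewrite big_ord_recr/= IHn exprS; field.
Qed.

(* Each admissible [z] has weight [\prod_i 2 ^- z_i >= 2 ^- N], while the total
   weight is at most [4 ^ k]. *)
Lemma card_ffun_sum_le k N :
  (#|[pred z : {ffun 'I_k -> bool * 'I_N.+1} | \sum_i val (z i).2 <= N]|
    <= 2 ^ N * 4 ^ k)%N.
Proof.
set A := [pred z | _]; rewrite -(ler_nat R) natrM.
pose F (w : bool * 'I_N.+1) : R := 2^-1 ^+ w.2.
apply: (@le_trans _ _ (\sum_(z in A) (2 ^ N)%:R * \prod_i F (z i))).
  rewrite -sum1_card natr_sum; apply: ler_sum => z; rewrite inE => zN.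
  rewrite /F prodrXr -[leLHS](@divff _ (2 ^ N)%:R) ?pnatr_eq0 ?expn_eq0//.
  rewrite ler_pM2l ?ltr0n ?expn_gt0// natrX -exprVn.
  by rewrite ler_wiXn2l// ?invr_ge0// invf_le1 ?ler1n.
rewrite -mulr_sumr ler_wpM2l//.
apply: (@le_trans _ _ (\sum_(z : {ffun 'I_k -> bool * 'I_N.+1}) \prod_i F (z i))).
  rewrite [leRHS](bigID (mem A))/= lerDl sumr_ge0// => z _.
  by rewrite prodr_ge0// => i _; rewrite exprn_ge0// invr_ge0.
rewrite -(bigA_distr_bigA (fun=> F))/= prodr_const card_ord natrX.
rewrite lerXn2r ?nnegrE//.
  by rewrite sumr_ge0// => w _; rewrite exprn_ge0// invr_ge0.
rewrite (_ : \sum_w F w = \sum_(b : bool) \sum_(j < N.+1) F (b, j)); last first.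
  by rewrite pair_big/=; apply: eq_bigr => -[].
rewrite big_bool/=; have := geometric_half_le2 N.+1; rewrite /F/=; lra.
Qed.

(** Coordinates are rounded towards zero, which keeps points in the ball, to multiples of
    [h = 1 / (sqrt k q)]. By Cauchy-Schwarz the multiplicities of a point of the ball add up to at
    most [k q], so [card_ffun_sum_le] applies with [N = k q], and [k q + 2 k <= 3 k q]. *)
Lemma ball_net k q : (0 < k)%N -> (0 < q)%N ->
  exists s : seq 'rV[R]_k,
    [/\ forall y, y \in s -> l2norm y <= 1,
        (size s <= 2 ^ (3 * k * q))%N
      & forall x, l2norm x <= 1 -> exists2 y, y \in s & l2norm (x - y) <= q%:R^-1].
Proof.
move=> k0 q0; pose N := (k * q)%N.
pose h : R := (Num.sqrt k%:R * q%:R)^-1.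
have sk : 0 < Num.sqrt k%:R :> R by rewrite sqrtr_gt0 ltr0n.
have q0' : 0 < q%:R :> R by rewrite ltr0n.
have h0 : 0 < h by rewrite invr_gt0 mulr_gt0.
pose A := [pred z : {ffun 'I_k -> bool * 'I_N.+1} | (\sum_i val (z i).2 <= N)%N].
pose pt (z : {ffun 'I_k -> bool * 'I_N.+1}) : 'rV[R]_k :=
  \row_i ((-1) ^+ (z i).1 * (val (z i).2)%:R * h).
exists [seq y <- [seq pt z | z in A] | l2norm y <= 1]; split.
- by move=> y; rewrite mem_filter => /andP[].
- rewrite size_filter (leq_trans (count_size _ _))// size_image.
  rewrite (leq_trans (card_ffun_sum_le _ _))// -(expnM 2 2) -expnD leq_exp2l//.
  by rewrite -mulnA (_ : 3 = 1 + 2)%N// mulnDl mul1n leq_add2l leq_mul2l leq_pmulr.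
move=> x x1.
pose t i : nat := Num.truncn (`|x 0 i| / h).
have tP i : (t i)%:R <= `|x 0 i| / h < (t i).+1%:R.
  by rewrite truncn_itv// divr_ge0// ltW.
have sum_t : (\sum_i t i <= N)%N.
  rewrite -(ler_nat R) natr_sum.
  apply: (@le_trans _ _ (\sum_i `|x 0 i| / h)).
    by apply: ler_sum => i _; have /andP[] := tP i.
  rewrite -mulr_suml ler_pdivrMr//.
  have -> : N%:R * h = Num.sqrt k%:R.
    rewrite /N /h natrM -{1}(sqr_sqrtr (ler0n R k)).
    by field; rewrite !gt_eqF.
  by rewrite (le_trans (sum_normr_coord_le x))// ler_piMr// ltW.
have t_lt i : (t i < N.+1)%N.
  by rewrite ltnS (leq_trans _ sum_t)// (bigD1 i)//= leq_addr.
pose z : {ffun 'I_k -> bool * 'I_N.+1} :=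
  [ffun i => (x 0 i < 0, Ordinal (t_lt i))].
have ptE i : pt z 0 i = (-1) ^+ (x 0 i < 0)%R * (t i)%:R * h.
  by rewrite mxE ffunE.
have xE i : x 0 i = (-1) ^+ (x 0 i < 0)%R * `|x 0 i| by rewrite -realEsign ?num_real.
have ht i : (t i)%:R * h <= `|x 0 i| by rewrite -ler_pdivlMr//; have /andP[] := tP i.
have pt1 : l2norm (pt z) <= 1.
  rewrite (le_trans _ x1)// ler_wsqrtr// ler_sum// => i _.
  rewrite -[leLHS]real_normK ?num_real// -[leRHS]real_normK ?num_real//.
  rewrite lerXn2r ?nnegrE// ptE !normrM normr_sign mul1r.
  by rewrite (ger0_norm (ler0n _ _)) (gtr0_norm h0).
exists (pt z).
  rewrite mem_filter pt1/=; apply/mapP; exists z => //.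
  rewrite mem_enum inE; rewrite (eq_bigr t)// => i _.
  by rewrite ffunE.
rewrite (le_trans (l2norm_le_coord (ltW h0) _))//; last first.
  by rewrite /h invfM mulrA divff ?mul1r// gt_eqF.
move=> i; have -> : (x - pt z) 0 i = (-1) ^+ (x 0 i < 0)%R * (`|x 0 i| - (t i)%:R * h).
  by rewrite !mxE ffunE/= {1}xE -mulrA -mulrBr.
rewrite normrM normr_sign mul1r ger0_norm ?subr_ge0//.
have /andP[_] := tP i; rewrite ltr_pdivrMr// -natr1 mulrDl mul1r.
lra.
Qed.

End ball_nets.

(** * Gaussian measures *)

Section density.
Local Open Scope ereal_scope.
Context d (T : measurableType d) (R : realType).
Variables (mu nu : {measure set T -> \bar R}) (g : T -> R).
Hypothesis g0 : forall x, (0 <= g x)%R.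
Hypothesis mg : measurable_fun setT g.
Hypothesis nuE : forall A, measurable A -> nu A = \int[mu]_(x in A) (g x)%:E.

Import HBNNSimple.

Let mgE : measurable_fun setT (fun x => (g x)%:E).
Proof. exact/measurable_EFinP. Qed.

Let density_nnsfun (h : {nnsfun T >-> R}) :
  \int[nu]_x (h x)%:E = \int[mu]_x ((h x)%:E * (g x)%:E).
Proof.
have mi r : measurable_fun setT (\1_(h @^-1` [set r]) : T -> R).
  exact: measurable_indic.
transitivity (\int[nu]_x
    (\sum_(y \in range h) (y * \1_(h @^-1` [set y]) x)%:E)).
  by apply: eq_integral => x _; rewrite fimfunE -fsumEFin.
rewrite ge0_integral_fsum//; last 2 first.
- by move=> r; apply/measurable_EFinP/measurable_funM.
- by move=> r x _; exact: nnfun_muleindic_ge0.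
transitivity (\int[mu]_x
    (\sum_(y \in range h) (y * \1_(h @^-1` [set y]) x)%:E * (g x)%:E)); last first.
  by apply: eq_integral => x _; rewrite fimfunE -fsumEFin// ge0_mule_fsuml// => r;
    exact: nnfun_muleindic_ge0.
rewrite ge0_integral_fsum//; last 2 first.
- move=> r; apply: emeasurable_funM => //.
  by apply/measurable_EFinP/measurable_funM.
- by move=> r x _; rewrite mule_ge0 ?lee_fin//; exact: nnfun_muleindic_ge0.
apply: eq_fsbigr => r; rewrite inE => -[x _ <-].
under eq_integral do rewrite EFinM.
rewrite ge0_integralZl//; last 2 first.
- by apply/measurable_EFinP.
- by rewrite lee_fin.
rewrite integral_indic// setIT nuE// integral_mkcond.
under [RHS]eq_integral do rewrite EFinM -muleA.
rewrite ge0_integralZl ?lee_fin//; last 2 first.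
- by apply: emeasurable_funM => //; exact/measurable_EFinP.
- by move=> y _; rewrite mule_ge0 ?lee_fin.
congr (_ * _); apply: eq_integral => y _; rewrite patchE indicE.
by case: ifPn => _; rewrite ?mul1e ?mul0e.
Qed.

(** Passes from the density formula on sets to integrands, by monotone convergence from simple
    functions. *)
Lemma ge0_integral_density (f : T -> \bar R) :
  measurable_fun setT f -> (forall x, 0 <= f x) ->
  \int[nu]_x f x = \int[mu]_x (f x * (g x)%:E).
Proof.
move=> mf f0; pose h := nnsfun_approx measurableT mf.
have -> : \int[nu]_x f x = lim (\int[nu]_x (EFin \o h n) x @[n --> \oo]).
  have fE x : f x = lim ((EFin \o h n) x @[n --> \oo]).
    by apply/esym/cvg_lim => //; exact: cvg_nnsfun_approx.
  under eq_integral do rewrite fE.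
  apply: monotone_convergence => //.
  - by move=> n; exact/measurable_EFinP.
  - by move=> n x _ //=; rewrite lee_fin.
  - by move=> x _ a b ab; rewrite lee_fin; exact/lefP/nd_nnsfun_approx.
have -> : \int[mu]_x (f x * (g x)%:E) =
    lim (\int[mu]_x ((EFin \o h n) x * (g x)%:E) @[n --> \oo]).
  have fg x : f x * (g x)%:E = lim ((EFin \o h n) x * (g x)%:E @[n --> \oo]).
    by apply/esym/cvg_lim => //; apply: cvgeZr => //; exact: cvg_nnsfun_approx.
  under eq_integral do rewrite fg.
  apply: monotone_convergence => //.
  - by move=> n; apply/emeasurable_funM => //; exact/measurable_EFinP.
  - by move=> n x _ /=; rewrite mule_ge0 ?lee_fin.
  - by move=> x _ a b ab/=; rewrite lee_wpmul2r ?lee_fin//; exact/lefP/nd_nnsfun_approx.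
by under eq_fun do rewrite density_nnsfun.
Qed.

End density.

(** * Rotation invariance of the Lebesgue and Gaussian measures of the plane *)

Section gaussian_plane.
Local Open Scope ereal_scope.
Context {R : realType}.
Notation RR := (measurableTypeR R).
Notation mu := (@lebesgue_measure R).

Lemma lebesgue_measureD (a : R) (A : set RR) : measurable A ->
  pushforward mu (fun x : RR => (x + a)%R : RR) A = mu A.
Proof.
move=> mA.
have ma : measurable_fun setT (fun x : RR => (x + a)%R : RR).
  exact: measurable_funD.
apply/esym/lebesgue_measure_unique => //= _ [[x y]] _ <-.
rewrite /pushforward/=.
have -> : (fun z : RR => (z + a)%R) @^-1` `]x, y]%classic = `](x - a)%R, (y - a)%R]%classic.
  by apply/seteqP; split=> z /=; rewrite !in_itv/= ltrBlDr lerBrDr.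
rewrite !lebesgue_measure_itv/= !lte_fin ltrD2r; case: ifP => // _.
by rewrite -!EFinD; congr EFin; ring.
Qed.

Lemma ge0_integral_translation (a : R) (f : RR -> \bar R) :
  measurable_fun setT f -> (forall x, 0 <= f x) ->
  \int[mu]_x f (x + a)%R = \int[mu]_x f x.
Proof.
move=> mf f0.
have ma : measurable_fun setT (fun x : RR => (x + a)%R : RR).
  exact: measurable_funD.
have := @ge0_integral_pushforward _ _ _ _ R _ ma mu setT f measurableT mf (fun y _ => f0 y).
rewrite preimage_setT => <-.
by apply: eq_measure_integral => B mB _; exact: lebesgue_measureD.
Qed.

Let measurable_shear1 (a : R) :
  measurable_fun setT (fun z : RR * RR => ((z.1 + a * z.2)%R : RR, z.2)).
Proof.
apply/measurable_fun_pair => //.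
by apply: measurable_funD => //; exact: measurable_funM.
Qed.

Let measurable_shear2 (a : R) :
  measurable_fun setT (fun z : RR * RR => (z.1, (z.2 + a * z.1)%R : RR)).
Proof.
apply/measurable_fun_pair => //.
by apply: measurable_funD => //; exact: measurable_funM.
Qed.

(** After Tonelli the inner integral is a translation by [a * y] for fixed [y]. *)
Lemma ge0_integral_shear1 (a : R) (F : RR * RR -> \bar R) :
  measurable_fun setT F -> (forall z, 0 <= F z) ->
  \int[mu]_x \int[mu]_y F ((x + a * y)%R, y) = \int[mu]_x \int[mu]_y F (x, y).
Proof.
move=> mF F0.
pose G (z : RR * RR) := F ((z.1 + a * z.2)%R, z.2).
have mG : measurable_fun setT G := measurableT_comp mF (measurable_shear1 a).
have G0 z : 0 <= G z by exact: F0.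
have swapG := @fubini_tonelli _ _ RR RR R mu mu G mG G0.
have swapF := @fubini_tonelli _ _ RR RR R mu mu F mF F0.
apply: (etrans swapG); apply: etrans (esym swapF).
apply: eq_integral => y _.
have mFy : measurable_fun setT (fun x : RR => F (x, y)).
  exact: (@measurable_fun_pair1 _ _ _ RR RR _ F y mF).
exact: (@ge0_integral_translation (a * y) _ mFy (fun x => F0 (x, y))).
Qed.

Lemma ge0_integral_shear2 (a : R) (F : RR * RR -> \bar R) :
  measurable_fun setT F -> (forall z, 0 <= F z) ->
  \int[mu]_x \int[mu]_y F (x, (y + a * x)%R) = \int[mu]_x \int[mu]_y F (x, y).
Proof.
move=> mF F0; apply: eq_integral => x _ /=.
rewrite (ge0_integral_translation (a * x) (f := fun y : RR => F (x, y)))//.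
exact/measurable_fun_pair2.
Qed.

(* The rotation whose half-angle has tangent [t]. *)
Definition rot_cos (t : R) : R := (1 - t ^+ 2) / (1 + t ^+ 2).
Definition rot_sin (t : R) : R := 2 * t / (1 + t ^+ 2).

Lemma rot_den_gt0 (t : R) : (0 < 1 + t ^+ 2)%R.
Proof. by rewrite ltr_pwDl// sqr_ge0. Qed.

Lemma rot_sqrD (t : R) : (rot_cos t ^+ 2 + rot_sin t ^+ 2 = 1)%R.
Proof. by rewrite /rot_cos /rot_sin; field; exact/lt0r_neq0/rot_den_gt0. Qed.

(* A rotation is a product of three shears. *)
Lemma ge0_integral_rotation (t : R) (F : RR * RR -> \bar R) :
  measurable_fun setT F -> (forall z, 0 <= F z) ->
  \int[mu]_x \int[mu]_y F ((rot_cos t * x + rot_sin t * y)%R,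
                          (- rot_sin t * x + rot_cos t * y)%R)
  = \int[mu]_x \int[mu]_y F (x, y).
Proof.
move=> mF F0.
pose F1 (z : RR * RR) := F ((z.1 + t * z.2)%R, z.2).
have mF1 : measurable_fun setT F1.
  exact: (measurableT_comp mF (measurable_shear1 t)).
pose F2 (z : RR * RR) := F1 (z.1, (z.2 + - rot_sin t * z.1)%R).
have mF2 : measurable_fun setT F2.
  exact: (measurableT_comp mF1 (measurable_shear2 _)).
have F10 z : 0 <= F1 z by exact: F0.
have F20 z : 0 <= F2 z by exact: F10.
apply: etrans (ge0_integral_shear1 t mF F0).
apply: etrans (ge0_integral_shear2 (- rot_sin t) mF1 F10).
apply: etrans (ge0_integral_shear1 t mF2 F20).
apply: eq_integral => x _; apply: eq_integral => y _.
have h : (1 + t ^+ 2 != 0)%R by exact/lt0r_neq0/rot_den_gt0.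
(* Half-angle identities: they make the composite of the shears with slopes [t], [- rot_sin t] and
   [t] equal to the rotation. *)
have hs : (rot_sin t * t = 1 - rot_cos t)%R by rewrite /rot_sin /rot_cos; field.
have hc : (rot_cos t * t = rot_sin t - t)%R by rewrite /rot_sin /rot_cos; field.
rewrite /F2 /F1/=.
have -> : (y + - rot_sin t * (x + t * y) = - rot_sin t * x + rot_cos t * y)%R.
  rewrite (_ : y + _ = - rot_sin t * x + y - (rot_sin t * t) * y)%R; last by ring.
  by rewrite hs; ring.
have -> // : (x + t * y + t * (- rot_sin t * x + rot_cos t * y) =
  rot_cos t * x + rot_sin t * y)%R.
rewrite (_ : _ + _ = x + t * y - (rot_sin t * t) * x + (rot_cos t * t) * y)%R; last by ring.
by rewrite hs hc; ring.
Qed.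

Notation gauss := (normal_prob 0 1 : probability RR R).

Lemma ge0_integral_gauss (f : RR -> \bar R) :
  measurable_fun setT f -> (forall x, 0 <= f x) ->
  \int[gauss]_x f x = \int[mu]_x (f x * (normal_pdf 0 1 x)%:E).
Proof.
move=> mf f0; apply: ge0_integral_density => //.
- exact: normal_pdf_ge0.
- exact: measurable_normal_pdf.
Qed.

Lemma normal_pdf01E (x : R) :
  normal_pdf 0 1 x = (normal_peak 1 * expR (- x ^+ 2 / 2))%R.
Proof.
rewrite normal_pdfE ?oner_neq0// /normal_fun subr0 expr1n.
by congr (_ * expR (_ / _))%R.
Qed.

(** The product density depends on [x^2 + y^2] only, so it can be carried along as a factor of the
    integrand in the Lebesgue statement. *)
Lemma ge0_integral_gauss_rotation (t : R) (F : RR * RR -> \bar R) :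
  measurable_fun setT F -> (forall z, 0 <= F z) ->
  \int[gauss]_x \int[gauss]_y F ((rot_cos t * x + rot_sin t * y)%R,
                                (- rot_sin t * x + rot_cos t * y)%R)
  = \int[gauss]_x \int[gauss]_y F (x, y).
Proof.
have mpdf : measurable_fun setT (fun x : RR => (normal_pdf 0 1 x)%:E : \bar R).
  by apply/measurable_EFinP; exact: measurable_normal_pdf.
have pdf0 x : 0 <= (normal_pdf 0 1 x : R)%:E by rewrite lee_fin normal_pdf_ge0.
pose D (z : RR * RR) := (normal_pdf 0 1 z.1)%:E * (normal_pdf 0 1 z.2)%:E : \bar R.
have mD : measurable_fun setT D.
  apply: emeasurable_funM.
    exact: (measurableT_comp mpdf measurable_fst).
  exact: (measurableT_comp mpdf measurable_snd).
have E (H : RR * RR -> \bar R) : measurable_fun setT H -> (forall z, 0 <= H z) ->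
    \int[gauss]_x \int[gauss]_y H (x, y) = \int[mu]_x \int[mu]_y (H (x, y) * D (x, y)).
  move=> mH H0; rewrite ge0_integral_gauss; last 2 first.
  - exact: (measurable_fun_fubini_tonelli_F H).
  - by move=> x; apply: integral_ge0.
  apply: eq_integral => x _; rewrite ge0_integral_gauss//; last first.
    exact/measurable_fun_pair2.
  rewrite -ge0_integralZr//; last 2 first.
  - by apply: emeasurable_funM => //; exact/measurable_fun_pair2.
  - by move=> y _; rewrite mule_ge0.
  by apply: eq_integral => y _; rewrite /D/= [X in _ = _ * X]muleC muleA.
move=> mF F0.
have mr : measurable_fun setT (fun z : RR * RR =>
    ((rot_cos t * z.1 + rot_sin t * z.2)%R : RR,
     (- rot_sin t * z.1 + rot_cos t * z.2)%R : RR)).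
  by apply/measurable_fun_pair => /=; apply: measurable_funD;
    exact: measurable_funM.
pose Fr (z : RR * RR) := F ((rot_cos t * z.1 + rot_sin t * z.2)%R,
                             (- rot_sin t * z.1 + rot_cos t * z.2)%R).
have mFr : measurable_fun setT Fr := measurableT_comp mF mr.
have Fr0 z : 0 <= Fr z by exact: F0.
apply: (etrans (E _ mFr Fr0)); rewrite (E _ mF F0).
pose FD (z : RR * RR) := F z * D z.
have mFD : measurable_fun setT FD by exact: emeasurable_funM.
have FD0 z : 0 <= FD z by rewrite mule_ge0 ?mule_ge0.
apply: etrans (ge0_integral_rotation t mFD FD0).
apply: eq_integral => x _; apply: eq_integral => y _ /=; congr (_ * _).
rewrite /D/= -!EFinM; congr EFin; rewrite !normal_pdf01E.
have pdfM (a b : R) : (normal_peak 1 * expR a * (normal_peak 1 * expR b)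
    = normal_peak 1 * normal_peak 1 * expR (a + b) :> R)%R.
  by rewrite mulrACA expRD.
rewrite !pdfM; congr (_ * expR _)%R.
transitivity (- (rot_cos t ^+ 2 + rot_sin t ^+ 2) * (x ^+ 2 + y ^+ 2) / 2)%R.
  by rewrite rot_sqrD; ring.
by ring.
Qed.

End gaussian_plane.

Section probability_integral.
Local Open Scope ereal_scope.
Context d (T : measurableType d) (R : realType) (P : probability T R).

Lemma integral_cst_probability (c : \bar R) : \int[P]_x c = c.
Proof.
by rewrite integral_cst//=; rewrite probability_setT mule1.
Qed.

End probability_integral.

(** * Moments of the standard Gaussian *)

Section gauss_moments.
Local Open Scope ereal_scope.
Context {R : realType}.
Notation RR := (measurableTypeR R).
Notation mu := (@lebesgue_measure R).
Notation gauss := (normal_prob 0 1 : probability RR R).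

(** A right angle, [t = 1], sends the second coordinate to [- x]. *)
Lemma ge0_integral_gaussN (f : RR -> \bar R) :
  measurable_fun setT f -> (forall x, 0 <= f x) ->
  \int[gauss]_x f (- x)%R = \int[gauss]_x f x.
Proof.
move=> mf f0; pose F (z : RR * RR) := f z.2.
have mF : measurable_fun setT F by exact: measurableT_comp.
have F0 z : 0 <= F z by exact: f0.
have := ge0_integral_gauss_rotation 1 mF F0; rewrite /F/=.
have -> : rot_cos (1 : R) = 0%R by rewrite /rot_cos expr1n subrr mul0r.
have -> : rot_sin (1 : R) = 1%R.
  by rewrite /rot_sin expr1n mulr1 divff.
under eq_integral do under eq_integral do rewrite mulN1r mul0r addr0.
under eq_integral do rewrite integral_cst_probability.
by move=> ->; rewrite integral_cst_probability.
Qed.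

(** Completing the square leaves [expR (l^2 / 2)] times the density of mean [l]. *)
Lemma gauss_mgf (l : R) :
  \int[gauss]_x (expR (l * x))%:E = (expR (l ^+ 2 / 2))%:E.
Proof.
have me : measurable_fun setT (fun x : RR => (expR (l * x))%:E : \bar R).
  by apply/measurable_EFinP; apply: measurableT_comp => //; exact: measurable_funM.
rewrite ge0_integral_gauss//.
transitivity (\int[mu]_x ((expR (l ^+ 2 / 2))%:E * (normal_pdf l 1 x)%:E)).
  apply: eq_integral => x _; rewrite -!EFinM normal_pdf01E.
  rewrite normal_pdfE ?oner_neq0// /normal_fun expr1n mulrCA [in RHS]mulrCA.
  rewrite -!expRD; congr (_ * expR _)%:E%R.
  by field.
rewrite ge0_integralZl ?lee_fin//; last 2 first.
- by apply/measurable_EFinP; exact: measurable_normal_pdf.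
- by move=> x _; rewrite lee_fin normal_pdf_ge0.
by rewrite integral_normal_pdf mule1.
Qed.

Definition gauss_moment (r : R) : \bar R := \int[gauss]_x (`|x| `^ r)%:E.

Lemma measurable_normr_powR d (T : measurableType d) (f : T -> R) (r : R) :
  measurable_fun setT f -> measurable_fun setT (fun x => (`|f x| `^ r)%R : R).
Proof.
move=> mf; apply: (measurableT_comp (measurable_powR _)).
exact: measurableT_comp.
Qed.

(** Since [ln t <= t], [|x|^r <= exp (r |x|) <= exp (r x) + exp (- r x)]. *)
Lemma gauss_moment_fin (r : R) : (0 < r)%R -> gauss_moment r < +oo.
Proof.
move=> r0.
have me (l : R) : measurable_fun setT (fun x : RR => (expR (l * x))%:E : \bar R).
  by apply/measurable_EFinP; apply: measurableT_comp => //; exact: measurable_funM.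
apply: (@le_lt_trans _ _ (\int[gauss]_x ((expR (r * x))%:E + (expR (- r * x))%:E))).
  apply: ge0_le_integral => //.
  - by apply/measurable_EFinP; exact: measurable_normr_powR.
  - by apply: emeasurable_funD; exact: me.
  move=> x _; rewrite -EFinD lee_fin.
  have [->|x0] := eqVneq x 0%R.
    by rewrite normr0 powR0 ?gt_eqF// addr_ge0// expR_ge0.
  have nx0 : (0 < `|x|)%R by rewrite normr_gt0.
  rewrite /powR gt_eqF//.
  apply: (@le_trans _ _ (expR (r * `|x|))%R).
    by rewrite ler_expR ler_pM2l// ltW// ln_sublinear.
  have [x1|x1] := leP 0%R x.
    by rewrite ger0_norm// lerDl expR_ge0.
  by rewrite ltr0_norm// mulrN mulNr lerDr expR_ge0.
rewrite ge0_integralD//.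
by rewrite !gauss_mgf -EFinD ltry.
Qed.

Lemma gauss_moment_gt0 (r : R) : (0 <= r)%R -> 0 < gauss_moment r.
Proof.
move=> r0; set I := `[1%R, 2%R]%classic : set RR.
have mI : measurable I by exact: measurable_itv.
(* The value of the density at [2], its minimum on [[1, 2]]. *)
pose c : R := (normal_peak 1 * expR (- 2))%R.
have c0 : (0 < c)%R by rewrite mulr_gt0 ?expR_gt0// normal_peak_gt0// oner_neq0.
apply: (@lt_le_trans _ _ (gauss I)).
  apply: (@lt_le_trans _ _ (\int[mu]_(x in I) (cst c%:E x))).
    rewrite integral_cst//= lebesgue_measure_itv/= lte_fin ltr1n/=.
    by rewrite -EFinD -EFinM lte_fin mulr_gt0//; lra.
  rewrite /= /normal_prob; apply: ge0_le_integral => //.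
  - by move=> x _; rewrite lee_fin ltW.
  - apply/measurable_EFinP/measurable_funTS; exact: measurable_normal_pdf.
  move=> x; rewrite /I/= in_itv/= => /andP[x1 x2]; rewrite lee_fin normal_pdf01E.
  rewrite ler_wpM2l ?normal_peak_ge0// ler_expR; nra.
rewrite -[leLHS]mul1e -integral_cst// /gauss_moment.
apply: (@le_trans _ _ (\int[gauss]_(x in I) (`|x| `^ r)%:E)).
  apply: ge0_le_integral => //.
  - apply: measurable_funTS; apply/measurable_EFinP.
    exact: measurable_normr_powR.
  move=> x; rewrite /I/= in_itv/= => /andP[x1 x2]; rewrite lee_fin.
  rewrite -[leLHS](powRr0 `|x|) ler_powR//.
  by rewrite (le_trans x1)// ler_norm.
apply: ge0_subset_integral => //.
by apply/measurable_EFinP; exact: measurable_normr_powR.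
Qed.

End gauss_moments.

(** * Gaussian vectors and rotations of independent pairs *)

Section gaussian_vectors.
Local Open Scope ereal_scope.
Context {R : realType}.
Notation RR := (measurableTypeR R).
Notation gauss := (normal_prob 0 1 : probability RR R).

(* The rotations of the pair of independent copies are required to be induced
   by measure-preserving maps of [T * T]. *)
Definition gaussian_vector k d (T : measurableType d) (P : probability T R)
    (X : T -> 'rV[R]_k) : Prop :=
  [/\ forall i, measurable_fun setT (fun w => X w 0%R i : R),
      forall (a : 'rV[R]_k) (f : RR -> \bar R), measurable_fun setT f ->
        (forall x, 0 <= f x) ->
        \int[P]_w f (dot a (X w)) = \int[gauss]_x f (l2norm a * x)%R
    & forall t : R, exists rho : T * T -> T * T,
        [/\ measurable_fun setT rho,
            forall F : T * T -> \bar R, measurable_fun setT F ->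
              (forall z, 0 <= F z) ->
              \int[P]_x \int[P]_y F (rho (x, y)) = \int[P]_x \int[P]_y F (x, y),
            forall z, X (rho z).1 = (rot_cos t *: X z.1 + rot_sin t *: X z.2)%R
          & forall z, X (rho z).2 = (- rot_sin t *: X z.1 + rot_cos t *: X z.2)%R]].

Lemma gaussian_vector0 : gaussian_vector gauss (fun=> 0%R : 'rV[R]_0).
Proof.
split.
- by case.
- move=> a f mf f0; have -> : l2norm a = 0%R by rewrite thinmx0 l2norm0.
  by apply: eq_integral => x _; rewrite thinmx0 dot0l mul0r.
- by move=> t; exists id; split => // z; apply/rowP; case.
Qed.

(** Writing [(a, b)] as [r] times a cosine and a sine, the half-angle tangent is [b / (r + a)], and
    rotation invariance leaves a single Gaussian. The case [r + a = 0], where the rational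
    parametrisation breaks down, forces [b = 0] and reduces to the symmetry of the Gaussian. *)
Lemma gauss_add2 (a b : R) (f : RR -> \bar R) : measurable_fun setT f ->
  (forall x, 0 <= f x) -> (0 <= b)%R ->
  \int[gauss]_x \int[gauss]_y f (a * x + b * y)%R =
  \int[gauss]_x f (Num.sqrt (a ^+ 2 + b ^+ 2) * x)%R.
Proof.
move=> mf f0 b0; set r := Num.sqrt _.
have ab0 : (0 <= a ^+ 2 + b ^+ 2)%R by rewrite addr_ge0 ?sqr_ge0.
have r2 : (r ^+ 2 = a ^+ 2 + b ^+ 2)%R by rewrite sqr_sqrtr.
have r0 : (0 <= r)%R by exact: sqrtr_ge0.
have mfM (c : R) : measurable_fun setT (fun x : RR => f (c * x)%R).
  by apply: (measurableT_comp mf); exact: measurable_funM.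
have ar : (`|a| <= r)%R.
  by rewrite -ler_sqr ?nnegrE// real_normK ?num_real// r2 lerDl sqr_ge0.
have [ra|ra] := eqVneq (r + a)%R 0%R.
  have ra' : (r = - a)%R by apply/eqP; rewrite -addr_eq0 ra.
  have bE : (b = 0)%R.
    apply/eqP; rewrite -sqrf_eq0; apply/eqP.
    by move: r2; rewrite ra' sqrrN => /eqP; rewrite eq_sym -subr_eq0 addrAC subrr add0r => /eqP.
  rewrite ra' bE -(ge0_integral_gaussN (mfM (- a)%R)) //.
  apply: eq_integral => x _; rewrite -[RHS](integral_cst_probability gauss).
  by apply: eq_integral => y _; rewrite mul0r addr0 mulrNN.
have rp : (0 < r)%R.
  rewrite lt_neqAle r0 andbT eq_sym; apply/eqP => rE.
  move: ra ar; rewrite rE add0r normr_le0 => /eqP h /eqP; exact: h.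
have ra0 : (0 < r + a)%R.
  rewrite lt_neqAle eq_sym ra/= -lerBlDr sub0r.
  by rewrite (le_trans _ ar)// -normrN ler_norm.
pose t := (b / (r + a))%R.
have den : ((r + a) ^+ 2 + b ^+ 2 = 2 * r * (r + a))%R.
  have -> : (b ^+ 2 = r ^+ 2 - a ^+ 2)%R by rewrite r2 addrC addKr.
  by ring.
have tden : (1 + t ^+ 2 = 2 * r / (r + a))%R.
  rewrite /t expr_div_n; apply: (mulIf (expf_neq0 2 ra)).
  rewrite mulrDl mul1r divfK ?expf_neq0// den; field.
  exact: ra.
have ct : (r * rot_cos t = a)%R.
  rewrite /rot_cos (_ : 1 - t ^+ 2 = 2 - (1 + t ^+ 2))%R; last by ring.
  by rewrite tden; field; rewrite ?ra ?gt_eqF.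
have st : (r * rot_sin t = b)%R.
  by rewrite /rot_sin tden /t; field; rewrite ?ra ?gt_eqF.
pose F (z : RR * RR) := f (r * z.1)%R.
have mF : measurable_fun setT F by exact: (measurableT_comp (mfM r)).
have F0 z : 0 <= F z by exact: f0.
have := ge0_integral_gauss_rotation t mF F0; rewrite /F/= => h.
transitivity (\int[gauss]_x \int[gauss]_y f (r * (rot_cos t * x + rot_sin t * y))%R).
  apply: eq_integral => x _; apply: eq_integral => y _.
  rewrite (_ : r * _ = (r * rot_cos t) * x + (r * rot_sin t) * y)%R; last by ring.
  by rewrite ct st.
by rewrite h; apply: eq_integral => x _; rewrite integral_cst_probability.
Qed.

End gaussian_vectors.

Section product_integral.
Local Open Scope ereal_scope.
Context {R : realType} {d1 d2} {S : measurableType d1} {T : measurableType d2}.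
Variables (Q : probability S R) (P : probability T R).

Definition prod_prob : probability (S * T)%type R := (Q \x P)%E.

Lemma measurable_integral_slice (F : (S * T) * (S * T) -> \bar R) :
  measurable_fun setT F -> (forall z, 0 <= F z) ->
  measurable_fun setT
    (fun z : S * S => \int[P]_x \int[P]_y F ((z.1, x), (z.2, y))).
Proof.
move=> mF F0.
pose G (z : (S * S) * T * T) := F ((z.1.1.1, z.1.2), (z.1.1.2, z.2)).
have mG : measurable_fun setT G.
  apply: (measurableT_comp mF); apply/measurable_fun_pair => /=.
    apply/measurable_fun_pair => /=.
      by do 2 apply: (measurableT_comp measurable_fst) => //.
    by apply: (measurableT_comp measurable_snd).
  apply/measurable_fun_pair => //=.
  by apply: (measurableT_comp measurable_snd); apply: (measurableT_comp measurable_fst).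
have G0 z : 0 <= G z by exact: F0.
have mG1 := @measurable_fun_fubini_tonelli_F _ _ _ _ R P G mG G0.
have mG2 := @measurable_fun_fubini_tonelli_F _ _ _ _ R P _ mG1.
apply: mG2 => z; exact: integral_ge0.
Qed.

(** Regroups two copies of [S * T] as a pair in [S] and a pair in [T], so that rotations of the two
    pairs can be applied one after the other. *)
Lemma ge0_integral_prod2 (F : (S * T) * (S * T) -> \bar R) :
  measurable_fun setT F -> (forall z, 0 <= F z) ->
  \int[prod_prob]_z \int[prod_prob]_z' F (z, z') =
  \int[Q]_s \int[Q]_u \int[P]_x \int[P]_y F ((s, x), (u, y)).
Proof.
move=> mF F0.
have mK : measurable_fun setT (fun z => \int[prod_prob]_z' F (z, z')).
  exact: (@measurable_fun_fubini_tonelli_F _ _ _ _ R prod_prob F mF F0).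
have K0 z : 0 <= \int[prod_prob]_z' F (z, z') by apply: integral_ge0.
apply: (etrans (@fubini_tonelli1 _ _ _ _ R Q P _ mK K0)).
apply: eq_integral => s _; rewrite /fubini_F.
pose G (z : T * S * T) := F ((s, z.1.1), (z.1.2, z.2)).
have mG : measurable_fun setT G.
  apply: (measurableT_comp mF); apply/measurable_fun_pair => /=.
    apply/measurable_fun_pair => //=.
    by apply: (measurableT_comp measurable_fst).
  apply/measurable_fun_pair => //=.
  by apply: (measurableT_comp measurable_snd).
have G0 z : 0 <= G z by exact: F0.
have mG1 := @measurable_fun_fubini_tonelli_F _ _ _ _ R P G mG G0.
have G10 z : 0 <= fubini_F P G z by apply: integral_ge0.
apply: (etrans _ (@fubini_tonelli _ _ _ _ R P Q _ mG1 G10)).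
apply: eq_integral => x _.
have mFx : measurable_fun setT (fun z' => F ((s, x), z')).
  exact: (measurableT_comp mF (measurable_pair1 _)).
exact: (@fubini_tonelli1 _ _ _ _ R Q P _ mFx (fun z' => F0 _)).
Qed.

End product_integral.

Section gaussian_vectors_exist.
Local Open Scope ereal_scope.
Context {R : realType}.
Notation RR := (measurableTypeR R).
Notation gauss := (normal_prob 0 1 : probability RR R).

Lemma measurable_dot k d (T : measurableType d) (X : T -> 'rV[R]_k)
    (a : 'rV[R]_k) :
  (forall i, measurable_fun setT (fun w => X w 0%R i : R)) ->
  measurable_fun setT (fun w => dot a (X w)).
Proof.
move=> mX; under eq_fun do rewrite dotE.
apply: measurable_sum => i; exact: measurable_funM.
Qed.

Lemma dot_row_mx k1 k2 (a b : 'rV[R]_k1) (u v : 'rV[R]_k2) :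
  dot (row_mx a u) (row_mx b v) = (dot a b + dot u v)%R.
Proof. by rewrite /dot tr_row_mx mul_row_col mxE. Qed.

Section step.
Context {k : nat} {d} {T : measurableType d} (P : probability T R).
Variable X : T -> 'rV[R]_k.
Hypothesis XP : gaussian_vector P X.

Let X' (z : RR * T) : 'rV[R]_(1 + k) := row_mx (const_mx z.1) (X z.2).

(** The law of a linear form follows from [gauss_add2]. For the rotation, the map given for [T] acts
    while the two Gaussian coordinates are frozen, and the plane rotation then acts on these
    coordinates. *)
Lemma gaussian_vectorS : gaussian_vector (prod_prob gauss P) X'.
Proof.
have [mX lawX rotX] := XP.
have mX' i : measurable_fun setT (fun w => X' w 0%R i : R).
  rewrite -(splitK i); case: (fintype.split i) => j /=.
    under eq_fun do rewrite /X' row_mxEl mxE.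
    exact: measurable_fst.
  under eq_fun do rewrite /X' row_mxEr.
  exact: (measurableT_comp (mX j) measurable_snd).
split=> //.
- move=> a f mf f0.
  have mfX : measurable_fun setT (fun w => f (dot a (X' w))).
    by apply: (measurableT_comp mf); exact: measurable_dot.
  apply: (etrans (@fubini_tonelli1 _ _ _ _ R gauss P _ mfX (fun z => f0 _))).
  rewrite -[a]hsubmxK; set al := lsubmx a; set ar := rsubmx a.
  transitivity (\int[gauss]_s \int[gauss]_u
      f (al 0 0 * s + l2norm ar * u)%R).
    apply: eq_integral => s _; rewrite /fubini_F.
    rewrite -(lawX ar (fun v => f (al 0 0 * s + v)%R)) //; last first.
      by apply: (measurableT_comp mf); exact: measurable_funD.
    apply: eq_integral => x _; rewrite /X' dot_row_mx; congr (f (_ + _)%R).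
    by rewrite dotE big_ord1 [const_mx _ _ _]mxE; congr (al _ _ * _)%R; exact/val_inj.
  apply: (etrans (gauss_add2 (al 0 0)%R mf f0 (l2norm_ge0 ar))).
  apply: eq_integral => s _; congr (f (_ * _)%R).
  by rewrite l2norm_sqr l2normE dot_row_mx; congr Num.sqrt; rewrite [dot al al]dotE big_ord1 expr2;
    congr (al _ _ * al _ _ + _)%R; exact/val_inj.
move=> t; have [rho [mrho rhoP rho1 rho2]] := rotX t.
pose c := rot_cos t; pose s := rot_sin t.
pose rho' (z : (RR * T) * (RR * T)) : (RR * T) * (RR * T) :=
  (((c * z.1.1 + s * z.2.1)%R, (rho (z.1.2, z.2.2)).1),
   ((- s * z.1.1 + c * z.2.1)%R, (rho (z.1.2, z.2.2)).2)).
have mrho' : measurable_fun setT rho'.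
  have m11 : measurable_fun setT (fun z : (RR * T) * (RR * T) => z.1.1).
    exact: (measurableT_comp measurable_fst measurable_fst).
  have m21 : measurable_fun setT (fun z : (RR * T) * (RR * T) => z.2.1).
    exact: (measurableT_comp measurable_fst measurable_snd).
  have mrho2 : measurable_fun setT
      (fun z : (RR * T) * (RR * T) => rho (z.1.2, z.2.2)).
    apply: (measurableT_comp mrho); apply/measurable_fun_pair => /=.
      exact: (measurableT_comp measurable_snd measurable_fst).
    exact: (measurableT_comp measurable_snd measurable_snd).
  apply/measurable_fun_pair; apply/measurable_fun_pair => /=.
  - by apply: measurable_funD; exact: measurable_funM.
  - exact: (measurableT_comp measurable_fst mrho2).
  - by apply: measurable_funD; exact: measurable_funM.
  - exact: (measurableT_comp measurable_snd mrho2).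
exists rho'; split; first exact: mrho'.
- move=> F mF F0.
  pose G z := F (rho' z).
  have mG : measurable_fun setT G by exact: (measurableT_comp mF mrho').
  have G0 z : 0 <= G z by exact: F0.
  apply: (etrans (@ge0_integral_prod2 R _ _ RR T gauss P G mG G0)).
  apply: (etrans _ (esym (@ge0_integral_prod2 R _ _ RR T gauss P F mF F0))).
  pose H (z : RR * RR) := \int[P]_x \int[P]_y F ((z.1, x), (z.2, y)).
  have mH : measurable_fun setT H by exact: (measurable_integral_slice P mF F0).
  have H0 z : 0 <= H z by do 2 apply: integral_ge0 => ? _.
  apply: (etrans _ (ge0_integral_gauss_rotation t mH H0)).
  apply: eq_integral => s1 _; apply: eq_integral => s2 _; rewrite /H/=.
  pose F' (z : T * T) := F (((c * s1 + s * s2)%R, z.1), ((- s * s1 + c * s2)%R, z.2)).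
  have mF' : measurable_fun setT F'.
    apply: (measurableT_comp mF); apply/measurable_fun_pair => /=;
      exact/measurable_fun_pair.
  exact: (rhoP F' mF' (fun z => F0 _)).
- move=> z; rewrite /X'/= rho1 !scale_row_mx add_row_mx; congr row_mx.
  by apply/rowP => i; rewrite !mxE.
- move=> z; rewrite /X'/= rho2 !scale_row_mx add_row_mx; congr row_mx.
  by apply/rowP => i; rewrite !mxE.
Qed.

End step.

Lemma gaussian_vector_exists k : exists d (T : measurableType d)
  (P : probability T R) (X : T -> 'rV[R]_k), gaussian_vector P X.
Proof.
elim: k => [|k [d [T [P [X XP]]]]].
  by do 4 eexists; exact: gaussian_vector0.
by do 4 eexists; exact: (gaussian_vectorS XP).
Qed.

End gaussian_vectors_exist.

(** * Chaining *)

Section max_over_seq.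
Context {R : realType} {I : eqType}.
Implicit Types (s : seq I) (f : I -> R).

(** The floor [0] covers the empty sequence; the functions it is used for are nonnegative. *)
Definition smax s f : R := \big[Num.max/0]_(x <- s) f x.

Lemma smax_ge0 s f : 0 <= smax s f.
Proof.
rewrite /smax; elim: s => [|x s IHs]; first by rewrite big_nil.
by rewrite big_cons le_max IHs orbT.
Qed.

Lemma le_smax s f x : x \in s -> f x <= smax s f.
Proof. by move=> xs; exact: le_bigmax_seq. Qed.

Lemma smax_le s f M : 0 <= M -> (forall x, x \in s -> f x <= M) -> smax s f <= M.
Proof.
move=> M0; rewrite /smax; elim: s => [|x s IHs] h; first by rewrite big_nil.
rewrite big_cons ge_max h ?mem_head//= IHs// => y ys.
by rewrite h// inE ys orbT.
Qed.

Lemma le_sum_seq s f x : (forall y, 0 <= f y) -> x \in s ->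
  f x <= \sum_(y <- s) f y.
Proof. by move=> f0 xs; rewrite (big_rem x)//= lerDl sumr_ge0. Qed.

Lemma measurable_smax d (T : measurableType d) s (F : I -> T -> R) :
  (forall x, measurable_fun setT (F x)) ->
  measurable_fun setT (fun w => smax s (F^~ w)).
Proof.
move=> mF; rewrite /smax; elim: s => [|x s IHs].
  by under eq_fun do rewrite big_nil; exact: measurable_cst.
under eq_fun do rewrite big_cons.
exact: measurable_maxr.
Qed.

End max_over_seq.

Section expectation.
Local Open Scope ereal_scope.
Context {R : realType} {d} {T : measurableType d} (P : probability T R).
Implicit Types f g h : T -> R.

Definition EE f : \bar R := \int[P]_w (f w)%:E.

Lemma EE_ge0 f : (forall w, 0 <= f w)%R -> 0 <= EE f.
Proof. by move=> f0; apply: integral_ge0 => w _; rewrite lee_fin. Qed.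

Lemma EE_le f g : measurable_fun setT f -> measurable_fun setT g ->
  (forall w, 0 <= f w <= g w)%R -> EE f <= EE g.
Proof.
move=> mf mg fg; apply: ge0_le_integral => //.
- by move=> w _; rewrite lee_fin; have /andP[] := fg w.
- exact/measurable_EFinP.
- exact/measurable_EFinP.
- by move=> w _; rewrite lee_fin; have /andP[] := fg w.
Qed.

Lemma EE_cst (c : R) : EE (fun=> c) = c%:E.
Proof. exact: integral_cst_probability. Qed.

Lemma EED f g : measurable_fun setT f -> measurable_fun setT g ->
  (forall w, 0 <= f w)%R -> (forall w, 0 <= g w)%R ->
  EE (fun w => f w + g w)%R = EE f + EE g.
Proof.
move=> mf mg f0 g0; rewrite /EE -ge0_integralD//.
- by move=> w _; rewrite lee_fin.
- exact/measurable_EFinP.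
- by move=> w _; rewrite lee_fin.
- exact/measurable_EFinP.
Qed.

Lemma EEZ (c : R) f : measurable_fun setT f -> (0 <= c)%R ->
  (forall w, 0 <= f w)%R -> EE (fun w => c * f w)%R = c%:E * EE f.
Proof.
move=> mf c0 f0; rewrite /EE -ge0_integralZl_EFin//.
- by move=> w _; rewrite lee_fin.
- exact/measurable_EFinP.
Qed.

Lemma EE_sum (I : Type) (s : seq I) (f : I -> T -> R) :
  (forall i, measurable_fun setT (f i)) -> (forall i w, 0 <= f i w)%R ->
  EE (fun w => \sum_(i <- s) f i w)%R = \sum_(i <- s) EE (f i).
Proof.
move=> mf f0; rewrite /EE -ge0_integral_sum//.
- by apply: eq_integral => w _; rewrite sumEFin.
- by move=> i; exact/measurable_EFinP.
- by move=> i w _; rewrite lee_fin.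
Qed.

Lemma EE_le_comb (a b : R) f g h : (0 <= a)%R -> (0 <= b)%R ->
  measurable_fun setT f -> measurable_fun setT g -> measurable_fun setT h ->
  (forall w, 0 <= f w)%R -> (forall w, 0 <= g w)%R -> (forall w, 0 <= h w)%R ->
  (forall w, f w <= a * g w + b * h w)%R ->
  EE f <= a%:E * EE g + b%:E * EE h.
Proof.
move=> a0 b0 mf mg mh f0 g0 h0 fgh; rewrite -!EEZ// -EED//; first last.
- by move=> w; rewrite mulr_ge0.
- by move=> w; rewrite mulr_ge0.
- exact: measurable_funM.
- exact: measurable_funM.
apply: EE_le => //; first by apply: measurable_funD; exact: measurable_funM.
by move=> w; rewrite f0 fgh.
Qed.

Lemma EE_exists_le f (b : R) : measurable_fun setT f -> (forall w, 0 <= f w)%R ->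
  (0 < b)%R -> EE f <= b%:E -> exists w, (f w <= 2 * b)%R.
Proof.
move=> mf f0 b0 fb; apply: contrapT => /forallNP h.
have : EE (fun=> 2 * b)%R <= EE f.
  apply: EE_le => // w; rewrite mulr_ge0//=; last exact: ltW.
  by rewrite ltW// ltNge; apply/negP/h.
rewrite EE_cst => /le_trans/(_ fb); rewrite lee_fin; apply/negP; rewrite -ltNge.
lra.
Qed.

End expectation.

Section chaining.
Context {R : realType} {k dim : nat} {d} {T : measurableType d}.
Variables (P : probability T R) (X : T -> 'rV[R]_dim) (S : nat -> seq 'rV[R]_k).
Hypothesis k0 : (0 < k)%N.
Hypothesis XP : gaussian_vector P X.
Hypothesis S_ball : forall j y, y \in S j -> l2norm y <= 1.
Hypothesis S_size : forall j, (size (S j) <= 2 ^ (3 * k * 4 ^ j))%N.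
Hypothesis S_net : forall j x, l2norm x <= 1 ->
  exists2 y, y \in S j & l2norm (x - y) <= (4 ^ j)%:R^-1.

Variables (a : 'rV[R]_k -> 'rV[R]_dim) (L : R).
Hypothesis L0 : 0 < L.
Hypothesis a0 : a 0 = 0.
Hypothesis aL : forall x y, l2norm x <= 1 -> l2norm y <= 1 ->
  l2norm (a x - a y) <= L * l2norm (x - y).

Let mX : forall i, measurable_fun setT (fun w => X w 0 i : R).
Proof. by case: XP. Qed.

Let mdot b : measurable_fun setT (fun w => dot b (X w)).
Proof. exact: measurable_dot. Qed.

Lemma gaussian_vector_mgf b l :
  EE P (fun w => expR (l * dot b (X w))) = (expR ((l * l2norm b) ^+ 2 / 2))%:E.
Proof.
have [_ law _] := XP.
have := law b (fun x => (expR (l * x))%:E); rewrite /EE => -> //.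
- rewrite -gauss_mgf; apply: eq_integral => x _; congr (expR _)%:E; ring.
- by apply/measurable_EFinP; apply: measurableT_comp => //; exact: measurable_funM.
Qed.

(** Plays the part of a union bound over tails: adding up these exponentials bounds a maximum of
    many variables pointwise, and the expectation of the sum is known from the moment generating
    function. *)
Lemma normr_le_expR_shift (u v l : R) : 0 < l ->
  `|u| <= v + l^-1 * (expR (l * u - l * v) + expR (- l * u - l * v)).
Proof.
move=> l0.
have h (x : R) : x <= v + l^-1 * expR (l * x - l * v).
  rewrite -lerBlDl ler_pdivlMl// mulrBr.
  by rewrite (le_trans _ (expR_ge1Dx _))// lerDr.
have [u0|u0] := leP 0 u.
  rewrite ger0_norm// (le_trans (h u))// lerD2l ler_pM2l ?invr_gt0//.
  by rewrite lerDl expR_ge0.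
rewrite ltr0_norm// (le_trans (h (- u)))// lerD2l ler_pM2l ?invr_gt0//.
by rewrite mulrN mulNr lerDr expR_ge0.
Qed.

(** Scales of level [i]: the logarithm of the size of the net is of order [q i ^ 2], [sg i] bounds
    the norm of a link of the chain, [lam i] is the parameter of the exponential moment and [tt i]
    the threshold. *)
Let q (i : nat) : R := Num.sqrt k%:R * 2 ^+ i.
Let sg (i : nat) : R := 4 * L / 4 ^+ i.
Let lam i := q i / sg i.
Let tt i := 5 * sg i * q i.

Let q_ge1 i : 1 <= q i.
Proof.
rewrite /q mulr_ege1//; last by rewrite exprn_ege1// ler1n.
by rewrite -[leLHS]sqrtr1 ler_wsqrtr// ler1n.
Qed.
Let q_gt0 i : 0 < q i. Proof. exact: lt_le_trans (q_ge1 i). Qed.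
Let sg_gt0 i : 0 < sg i.
Proof. by rewrite /sg divr_gt0 ?mulr_gt0// exprn_gt0. Qed.
Let lam_gt0 i : 0 < lam i. Proof. by rewrite divr_gt0. Qed.

Let M (b : 'rV[R]_k -> 'rV[R]_dim) (i : nat) (w : T) : R :=
  tt i + (lam i)^-1 * \sum_(y <- S i)
    (expR (lam i * dot (b y) (X w) - lam i * tt i)
     + expR (- lam i * dot (b y) (X w) - lam i * tt i)).

Let mexp b (l c : R) :
  measurable_fun setT (fun w => expR (l * dot b (X w) - c)).
Proof.
apply: measurableT_comp => //; apply: measurable_funB => //.
exact: measurable_funM.
Qed.

Let mM b i : measurable_fun setT (M b i).
Proof.
apply: measurable_funD => //; apply: measurable_funM => //.
apply: measurable_sum => y; apply: measurable_funD; exact: mexp.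
Qed.

Let M_ge0 b i w : 0 <= M b i w.
Proof.
rewrite /M addr_ge0//; first by rewrite /tt !mulr_ge0// ltW.
apply: mulr_ge0; first by rewrite invr_ge0 ltW.
by rewrite sumr_ge0.
Qed.

(** An exponential has mean at most [B = exp (q^2 / 2 - 5 q^2)], while twice the size of the net is
    at most [exp (4 q^2)]; the [5] in the threshold thus makes the weighted sum at most
    [1 / lam <= sg q], for a total of [6 sg q]. *)
Let EM b i : (forall y, y \in S i -> l2norm (b y) <= sg i) ->
  (EE P (M b i) <= (24 * L * Num.sqrt k%:R / 2 ^+ i)%:E)%E.
Proof.
move=> bsg.
pose B : R := expR ((q i) ^+ 2 / 2 - 5 * (q i) ^+ 2).
have lsg : lam i * sg i = q i by rewrite /lam divfK// gt_eqF.
have ltE : lam i * tt i = 5 * (q i) ^+ 2.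
  by transitivity (5 * (lam i * sg i) * q i); [rewrite /tt; ring|rewrite lsg; ring].
have Eexp y (l : R) : y \in S i -> `|l| = lam i ->
    (EE P (fun w => expR (l * dot (b y) (X w) - lam i * tt i)%R) <= B%:E)%E.
  move=> yS ll.
  under [X in EE P X]funext => w do rewrite addrC expRD.
  rewrite EEZ ?expR_ge0//; last first.
    by apply: measurableT_comp => //; exact: measurable_funM.
  rewrite gaussian_vector_mgf -EFinM lee_fin -expRD ler_expR /B ltE addrC lerD2r.
  rewrite ler_pM2r ?invr_gt0// -(real_normK (num_real (l * _))) normrM ll.
  rewrite lerXn2r ?nnegrE//; first by rewrite mulr_ge0// ltW.
    exact: ltW.
  by rewrite ger0_norm ?l2norm_ge0// -lsg ler_pM2l// bsg.
have e0 (l c : R) y w : 0 <= expR (l * dot (b y) (X w) - c) by exact: expR_ge0.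
rewrite /M EED//; last 3 first.
- apply: measurable_funM => //.
  by apply: measurable_sum => y; apply: measurable_funD; exact: mexp.
- by move=> w; rewrite /tt !mulr_ge0// ltW.
- move=> w; apply: mulr_ge0; first by rewrite invr_ge0 ltW.
  by rewrite sumr_ge0.
rewrite EE_cst EEZ; last 3 first.
- by apply: measurable_sum => y; apply: measurable_funD; exact: mexp.
- by rewrite invr_ge0 ltW.
- by move=> w; rewrite sumr_ge0.
rewrite EE_sum//; last by move=> y; apply: measurable_funD; exact: mexp.
have sumB : (\sum_(y <- S i) EE P (fun w => (expR (lam i * dot (b y) (X w) - lam i * tt i)
     + expR (- lam i * dot (b y) (X w) - lam i * tt i))%R) <= (\sum_(y <- S i) (B + B))%R%:E)%E.
  rewrite -sumEFin big_seq [leRHS]big_seq; apply: lee_sum => y yS.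
  rewrite EED//; try exact: mexp.
  rewrite EFinD leeD// Eexp//; first by rewrite gtr0_norm.
  by rewrite normrN gtr0_norm.
apply: (@le_trans _ _ (tt i + (lam i)^-1 * (\sum_(y <- S i) (B + B)))%R%:E).
  rewrite EFinD; apply: leeD2l; rewrite [leRHS]EFinM; apply: lee_wpmul2l => //.
  by rewrite lee_fin invr_ge0 ltW.
rewrite lee_fin big_const_seq count_predT iter_addr_0.
have sizeB : (B + B) *+ size (S i) <= 1.
  rewrite -mulr2n -mulrnA -mulr_natl.
  apply: (@le_trans _ _ ((expR 1) ^+ (4 * k * 4 ^ i)%N * B)).
    rewrite ler_pM2r ?expR_gt0//.
    apply: (@le_trans _ _ (2 ^+ (1 + 3 * k * 4 ^ i)%N)).
      rewrite -natrX ler_nat expnD expn1 leq_mul2l/= S_size//.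
    apply: (@le_trans _ _ (2 ^+ (4 * k * 4 ^ i)%N)).
      rewrite ler_weXn2l ?ler1n// -!mulnA; have : (0 < k * 4 ^ i)%N.
        by rewrite muln_gt0 k0 expn_gt0.
      by move=> h; rewrite [leqRHS]mulSn leq_add2r.
    by rewrite lerXn2r ?nnegrE ?expR_ge0// (le_trans _ (expR_ge1Dx 1)).
  rewrite -expRM_natl /B -expRD -[leRHS]expR0 ler_expR.
  have -> : (q i) ^+ 2 = k%:R * 4 ^+ i.
    rewrite /q exprMn sqr_sqrtr// -exprM mulnC exprM; congr (_ * _ ^+ _); ring.
  rewrite !natrM natrX.
  set z := 4 ^+ i; have z0 : 0 < z by rewrite exprn_gt0.
  have k1 : 0 < k%:R :> R by rewrite ltr0n.
  have := mulr_gt0 k1 z0; nra.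
apply: (@le_trans _ _ (tt i + (lam i)^-1)).
  by rewrite lerD2l ler_piMr// invr_ge0 ltW.
have sq : (lam i)^-1 <= sg i * q i.
  rewrite /lam invf_div ler_pM2l// (le_trans _ (q_ge1 i))// invf_le1//.
have -> : 24 * L * Num.sqrt k%:R / 2 ^+ i = 6 * (sg i * q i).
  rewrite /sg /q (_ : 4 ^+ i = 2 ^+ i * 2 ^+ i :> R).
    by field; rewrite expf_neq0.
  by rewrite -exprMn; congr (_ ^+ _); ring.
by move: sq; rewrite /tt; lra.
Qed.

(** Every net point is joined to the origin through approximations in coarser nets. The bounds for
    the links decay like [2^-i], so the sum is at most twice the first one, [48 = 2 * 24], whatever
    [J] is. *)
Lemma chaining_bound J :
  (EE P (fun w => smax (flatten [seq S j | j <- iota 0 J.+1])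
                       (fun x => `|dot (a x) (X w)|%R)) <=
   (48 * L * Num.sqrt k%:R)%:E)%E.
Proof.
have /boolp.choice [p pP] : forall xj : 'rV[R]_k * nat,
    exists y, l2norm xj.1 <= 1 -> y \in S xj.2 /\ l2norm (xj.1 - y) <= (4 ^ xj.2)%:R^-1.
  move=> [x j] /=; have [x1|x1] := boolP (l2norm x <= 1); last by exists 0.
  by have [y] := S_net j x1; exists y.
(* Links of the chain; one of level [0] starts at the origin, where [a] vanishes. *)
pose b i y := if i is j.+1 then a y - a (p (y, j)) else a y.
have bsg i y : y \in S i -> l2norm (b i y) <= sg i.
  move=> /S_ball y1; case: i => [|j] /=.
    rewrite /sg expr0 divr1 -[a y]subr0 -a0 (le_trans (aL y1 _))//.
      by rewrite l2norm0.
    by rewrite subr0 mulrC ler_pM2r// (le_trans y1)// ler1n.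
  have [/= pS pn] := pP (y, j) y1.
  rewrite (le_trans (aL y1 (S_ball pS)))// /sg exprS.
  have -> : 4 * L / (4 * 4 ^+ j) = L * (4 ^+ j)^-1.
    by field; rewrite expf_neq0.
  by rewrite ler_pM2l// -natrX.
have step i : forall y w, y \in S i -> `|dot (b i y) (X w)| <= M (b i) i w.
  move=> y w yS; apply: (le_trans (normr_le_expR_shift _ (tt i) (lam_gt0 i))).
  rewrite /M lerD2l ler_pM2l ?invr_gt0// (big_rem y)//= lerDl.
  by rewrite sumr_ge0.
have tele i : forall y w, y \in S i ->
    `|dot (a y) (X w)| <= \sum_(j < i.+1) M (b j) j w.
  elim: i => [|i IHi] y w yS.
    by rewrite big_ord1; exact: (step 0).
  have [/= pS _] := pP (y, i) (S_ball yS).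
  rewrite big_ord_recr/= -[a y](subrK (a (p (y, i)))) dotDl.
  by rewrite (le_trans (ler_normD _ _))// addrC lerD ?IHi// (step i.+1).
apply: (@le_trans _ _ (EE P (fun w => \sum_(j <- index_enum 'I_J.+1) M (b j) j w)%R)).
  apply: EE_le.
  - by apply: measurable_smax => x; apply: measurableT_comp.
  - by apply: measurable_sum => j; exact: mM.
  move=> w; rewrite smax_ge0 andTb; apply: smax_le; first by rewrite sumr_ge0.
  move=> x /flatten_mapP[j]; rewrite mem_iota /= add0n ltnS => jJ xS.
  apply: (le_trans (tele j x w xS)).
  rewrite -(big_mkord xpredT (fun j => M (b j) j w)).
  rewrite -(big_mkord xpredT (fun j => M (b j) j w)).
  by rewrite [leRHS](big_cat_nat _ (n := j.+1))//= lerDl sumr_ge0.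
rewrite EE_sum//.
apply: (@le_trans _ _ (\sum_(j < J.+1) (24 * L * Num.sqrt k%:R / 2 ^+ j)%:E)%E).
  by apply: lee_sum => j _; apply: EM => y; exact: bsg.
rewrite sumEFin lee_fin -mulr_sumr.
have -> : 48 * L * Num.sqrt k%:R = 24 * L * Num.sqrt k%:R * 2 by ring.
rewrite ler_wpM2l//; first by rewrite !mulr_ge0// ltW.
apply: (le_trans _ (@geometric_half_le2 R J.+1)).
by apply: ler_sum => j _; rewrite exprVn.
Qed.

End chaining.

(** * Decoupling by rotations *)

Section rotation_angles.
Context {R : realType}.
Implicit Types t u : R.

Lemma rot_cos_le t : 0 <= t <= 1 -> 0 <= rot_cos t <= 1.
Proof.
move=> /andP[t0 t1]; have D := rot_den_gt0 t.
by rewrite /rot_cos divr_ge0 ?(ltW D)//= ?ler_pdivrMr//; nra.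
Qed.

Lemma rot_sin_le t : 0 <= t <= 1 -> 0 <= rot_sin t <= 1.
Proof.
move=> /andP[t0 t1]; have D := rot_den_gt0 t.
by rewrite /rot_sin divr_ge0 ?(ltW D)//= ?ler_pdivrMr//; nra.
Qed.

Lemma rot_sin_le2 t : 0 <= t -> rot_sin t <= 2 * t.
Proof.
move=> t0; have D := rot_den_gt0 t; rewrite /rot_sin ler_pdivrMr//.
have := sqr_ge0 t; nra.
Qed.

Lemma rot_1subcos_le t : 0 <= t <= 1 -> 1 - rot_cos t <= rot_sin t ^+ 2.
Proof.
move=> t01; have /andP[c0 c1] := rot_cos_le t01.
have -> : rot_sin t ^+ 2 = 1 - rot_cos t ^+ 2 by rewrite -(rot_sqrD t); ring.
nra.
Qed.

Lemma rot_double t u : 1 - u ^+ 2 != 0 -> t = 2 * u / (1 - u ^+ 2) ->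
  rot_cos t = rot_cos u ^+ 2 - rot_sin u ^+ 2 /\
  rot_sin t = 2 * rot_cos u * rot_sin u.
Proof.
move=> u1 ->; have D : 1 + u ^+ 2 != 0 by exact/lt0r_neq0/rot_den_gt0.
have D2 : (1 - u ^+ 2) ^+ 2 + (2 * u) ^+ 2 != 0.
  by rewrite (_ : _ + _ = (1 + u ^+ 2) ^+ 2) ?expf_neq0//; ring.
by rewrite /rot_cos /rot_sin; split; field; rewrite ?u1 ?D ?D2.
Qed.

(** The tangent of [pi / 4] divided by [2^i], by the half-angle formula: as half-angle tangent it
    gives the rotation by a [2^i]-th of a right angle. *)
Fixpoint half_tan (i : nat) : R :=
  if i is j.+1 then half_tan j / (1 + Num.sqrt (1 + half_tan j ^+ 2)) else 1.

Lemma half_tan_bounds i : 0 < half_tan i <= (2 ^+ i)^-1.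
Proof.
elim: i => [|i /andP[h0 hi]] /=; first by rewrite invr1 lexx ltr01.
set t := half_tan i in h0 hi *.
have s1 : 1 <= Num.sqrt (1 + t ^+ 2).
  by rewrite -[leLHS]sqrtr1 ler_wsqrtr// lerDl sqr_ge0.
have sp : 0 < 1 + Num.sqrt (1 + t ^+ 2) by lra.
rewrite divr_gt0//= ler_pdivrMr//.
rewrite exprS invfM; set h := (2 ^+ i)^-1 in hi *.
have h00 : 0 <= h * (Num.sqrt (1 + t ^+ 2) - 1).
  by rewrite mulr_ge0 ?subr_ge0// (le_trans _ hi)// ltW.
lra.
Qed.

Lemma half_tan_le1 i : 0 <= half_tan i <= 1.
Proof.
have /andP[h0 h1] := half_tan_bounds i; rewrite (ltW h0)/= (le_trans h1)//.
by rewrite invf_le1 ?exprn_gt0// exprn_ege1// ler1n.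
Qed.

Lemma rot_half_tan i :
  rot_cos (half_tan i) = rot_cos (half_tan i.+1) ^+ 2 - rot_sin (half_tan i.+1) ^+ 2 /\
  rot_sin (half_tan i) = 2 * rot_cos (half_tan i.+1) * rot_sin (half_tan i.+1).
Proof.
apply: rot_double.
  have /andP[h0 h1] := half_tan_bounds i.+1; rewrite gt_eqF// subr_gt0.
  rewrite expr_lt1//; last exact: ltW.
  by rewrite (le_lt_trans h1)// invf_lt1 ?exprn_gt0// exprn_egt1// ltr1n.
have /andP[h0 _] := half_tan_bounds i.
rewrite /=; set t := half_tan i in h0 *; set s := Num.sqrt _.
have s2 : s ^+ 2 = 1 + t ^+ 2 by rewrite sqr_sqrtr// addr_ge0// sqr_ge0.
have s1 : 1 <= s by rewrite -[leLHS]sqrtr1 ler_wsqrtr// lerDl sqr_ge0.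
have sp : 1 + s != 0 by rewrite gt_eqF//; lra.
have t2 : t ^+ 2 = s ^+ 2 - 1 by rewrite s2; ring.
have -> : 1 - (t / (1 + s)) ^+ 2 = 2 / (1 + s).
  by rewrite expr_div_n t2; field.
by field.
Qed.

Lemma rot_cos1 : rot_cos 1 = 0 :> R.
Proof. by rewrite /rot_cos expr1n subrr mul0r. Qed.

Lemma rot_sin1 : rot_sin 1 = 1 :> R.
Proof. by rewrite /rot_sin expr1n mulr1 divff. Qed.

(* Summing [2 ^ i] rotations by a [2 ^ i]-th of the right angle, the first
   order terms stay bounded and the second order ones vanish in the limit. *)
Lemma halving_limit (r C : R) (x g : \bar R) : 0 <= r -> 0 <= C -> (0 <= g)%E ->
  (forall i, x <= (2 ^+ i)%:E * ((r * rot_sin (half_tan i))%:E * g +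
                       (rot_sin (half_tan i) ^+ 2)%:E * C%:E))%E ->
  (x <= (2 * r)%:E * g)%E.
Proof.
move=> r0 C0 g0 h.
have bound i : (x <= (2 * r)%:E * g + (4 * C / 2 ^+ i)%:E)%E.
  apply: (le_trans (h i)).
  have /andP[h0 h1] := half_tan_bounds i; have h01 := half_tan_le1 i.
  set t := half_tan i in h0 h1 h01 *.
  have /andP[s0 s1] := rot_sin_le h01.
  have s2 := rot_sin_le2 (ltW h0).
  have pow0 : 0 < 2 ^+ i :> R by rewrite exprn_gt0.
  have ti : 2 ^+ i * t <= 1 by rewrite mulrC -ler_pdivlMr// div1r.
  rewrite ge0_muleDr; last 2 first.
  - by rewrite mule_ge0// lee_fin mulr_ge0.
  - by rewrite mule_ge0// lee_fin ?sqr_ge0.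
  rewrite !muleA -!EFinM; apply: leeD.
    apply: lee_wpmul2r => //; rewrite lee_fin mulrCA mulrC ler_wpM2r//.
    by rewrite (le_trans (ler_wpM2l (ltW pow0) s2))//; lra.
  rewrite lee_fin.
  have -> : 4 * C / 2 ^+ i = C * (4 * (2 ^+ i)^-1) by ring.
  rewrite mulrC; apply: ler_wpM2l => //.
  apply: (@le_trans _ _ (2 ^+ i * (2 * t) ^+ 2)).
    by rewrite ler_pM2l// lerXn2r ?nnegrE// mulr_ge0// ltW.
  rewrite (_ : 2 ^+ i * _ = 4 * ((2 ^+ i * t) * t)); last by ring.
  by rewrite ler_pM2l// (le_trans _ h1)// ler_piMl// ltW.
apply/lee_addgt0Pr => e e0.
have [i Ci] : exists i, 4 * C / 2 ^+ i <= e.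
  pose i := (Num.truncn (e^-1 * (4 * C))).+1; exists i.
  rewrite ler_pdivrMr ?exprn_gt0// -ler_pdivrMl//.
  rewrite (le_trans (ltW (truncnS_gt _)))// -natrX ler_nat.
  by rewrite ltnW// ltn_expl.
by rewrite (le_trans (bound i))// leeD2l// lee_fin.
Qed.

End rotation_angles.

(** * Power sums of linear forms and their gradients *)

Section power_sums.
Context {R : realType} {N k dim : nat}.
Variables (c : 'I_N -> R) (E : 'I_N -> 'M[R]_(k, dim)).
Hypothesis c0 : forall i, 0 <= c i.
Implicit Types (r q : R) (g : 'rV[R]_dim) (x y : 'rV[R]_k).

(** In the application [g] lists the entries of the matrix [G] and [E i] is [outer_mx k (u i)], so
    that this is [<u_i, xG>]. *)
Definition lform g (i : 'I_N) x : R := dot (x *m E i) g.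
Definition psum r g x : R := \sum_i c i * `|lform g i x| `^ r.
(** The gradient of [psum r] in [g], divided by [r]. *)
Definition pgrad r g x : 'rV[R]_dim :=
  \sum_i (c i * phi r (lform g i x)) *: (x *m E i).

Lemma lformB g i x y : lform g i (x - y) = lform g i x - lform g i y.
Proof. by rewrite /lform mulmxBl dotBl. Qed.

Lemma lformZ g i a x : lform g i (a *: x) = a * lform g i x.
Proof. by rewrite /lform -scalemxAl dotZl. Qed.

Lemma lform_comb a b g g' i x :
  lform (a *: g + b *: g') i x = a * lform g i x + b * lform g' i x.
Proof. by rewrite /lform dotDr !dotZr. Qed.

Lemma psum_ge0 r g x : 0 <= psum r g x.
Proof. by rewrite sumr_ge0// => i _; rewrite mulr_ge0 ?powR_ge0. Qed.

Lemma psumZ r g a x : psum r g (a *: x) = `|a| `^ r * psum r g x.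
Proof.
rewrite /psum mulr_sumr; apply: eq_bigr => i _.
by rewrite lformZ normrM powRM// mulrCA.
Qed.

Lemma pgrad0 r g : pgrad r g 0 = 0.
Proof. by rewrite /pgrad big1// => i _; rewrite mul0mx scaler0. Qed.

Lemma dot_pgrad r g g' x :
  dot (pgrad r g x) g' = \sum_i c i * (phi r (lform g i x) * lform g' i x).
Proof.
by rewrite /pgrad dot_suml; apply: eq_bigr => i _; rewrite dotZl mulrA.
Qed.

Lemma psum_rotation r t g g' x : 2 < r -> 0 <= t <= 1 ->
  `|psum r g x - psum r (rot_cos t *: g + rot_sin t *: g') x| <=
  r * rot_sin t * `|dot (pgrad r g x) g'| +
  rot_sin t ^+ 2 * ((r ^+ 2 * 4 `^ r + r) * (psum r g x + psum r g' x)).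
Proof.
move=> r2 t01; rewrite distrC.
have -> : psum r (rot_cos t *: g + rot_sin t *: g') x - psum r g x =
    r * rot_sin t * dot (pgrad r g x) g' +
    \sum_i c i * (`|rot_cos t * lform g i x + rot_sin t * lform g' i x| `^ r
      - `|lform g i x| `^ r
      - r * rot_sin t * (phi r (lform g i x) * lform g' i x)).
  rewrite dot_pgrad mulr_sumr -sumrB -big_split/=; apply: eq_bigr => i _.
  by rewrite lform_comb; ring.
have /andP[s0 _] := rot_sin_le t01.
rewrite (le_trans (ler_normD _ _))//; apply: lerD.
  by rewrite normrM ger0_norm// mulr_ge0//; lra.
rewrite (le_trans (ler_norm_sum _ _ _))//.
rewrite -big_split/= !mulr_sumr; apply: ler_sum => i _.
rewrite normrM ger0_norm//.
rewrite (_ : rot_sin t ^+ 2 * _ = c i * (rot_sin t ^+ 2 * ((r ^+ 2 * 4 `^ r + r) *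
  (`|lform g i x| `^ r + `|lform g' i x| `^ r)))); last by ring.
apply: ler_wpM2l => //; apply: powR_rotation => //.
- exact: rot_cos_le.
- exact: rot_sin_le.
- exact: rot_1subcos_le.
Qed.

Lemma measurable_psum r d (T : measurableType d) (G : T -> 'rV[R]_dim) x :
  (forall i, measurable_fun setT (fun w => G w 0 i : R)) ->
  measurable_fun setT (fun w => psum r (G w) x).
Proof.
move=> mG; apply: measurable_sum => i; apply: measurable_funM => //.
by apply: measurable_normr_powR; exact: measurable_dot.
Qed.

Lemma measurable_phi r d (T : measurableType d) (f : T -> R) :
  measurable_fun setT f -> measurable_fun setT (fun w => phi r (f w)).
Proof.
move=> mf; under eq_fun do rewrite phiE.
by apply: measurable_funM => //; exact: measurable_normr_powR.
Qed.

Lemma measurable_dot_pgrad r d (T : measurableType d) (G G' : T -> 'rV[R]_dim) x :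
  (forall i, measurable_fun setT (fun w => G w 0 i : R)) ->
  (forall i, measurable_fun setT (fun w => G' w 0 i : R)) ->
  measurable_fun setT (fun w => dot (pgrad r (G w) x) (G' w)).
Proof.
move=> mG mG'; under eq_fun do rewrite dot_pgrad.
apply: measurable_sum => i; apply: measurable_funM => //.
apply: measurable_funM; last exact: measurable_dot.
by apply: measurable_phi; exact: measurable_dot.
Qed.

End power_sums.

Lemma EE_prod {R : realType} d1 d2 (T1 : measurableType d1) (T2 : measurableType d2)
    (P1 : probability T1 R) (P2 : probability T2 R) (f : T1 * T2 -> R) :
  measurable_fun setT f -> (forall z, 0 <= f z) ->
  EE (prod_prob P1 P2) f = (\int[P1]_x EE P2 (fun y => f (x, y)))%E.
Proof.
move=> mf f0; apply: (@fubini_tonelli1 _ _ _ _ R P1 P2 (fun z => (f z)%:E)).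
  exact/measurable_EFinP.
by move=> z; rewrite lee_fin.
Qed.

Lemma mule_2l {R : realType} (x : \bar R) : (2%:E * x = x + x)%E.
Proof. by rewrite mule_natl mule2n. Qed.

(** [rho] preserves the law of the pair, so both terms of the bound on [h] have the same mean. *)
Lemma EE_le_double {R : realType} d (T : measurableType d)
    (P : probability T R) (rho : T * T -> T * T) :
  measurable_fun setT rho ->
  (forall F : T * T -> \bar R, measurable_fun setT F -> (forall z, 0 <= F z)%E ->
     (\int[P]_x \int[P]_y F (rho (x, y)) = \int[P]_x \int[P]_y F (x, y))%E) ->
  forall f h : T * T -> R, measurable_fun setT f -> measurable_fun setT h ->
  (forall z, 0 <= f z) -> (forall z, 0 <= h z) ->
  (forall z, h z <= f z + f (rho z)) ->
  (EE (prod_prob P P) h <= 2%:E * EE (prod_prob P P) f)%E.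
Proof.
move=> mrho rhoP f h mf mh f0 h0 hf.
have mfr : measurable_fun setT (fun z => f (rho z)).
  exact: (measurableT_comp mf mrho).
have fr0 z : 0 <= f (rho z) by [].
have E : EE (prod_prob P P) (fun z => f (rho z)) = EE (prod_prob P P) f.
  rewrite (EE_prod P P mfr fr0) (EE_prod P P mf f0).
  apply: (rhoP (fun z => (f z)%:E)); first exact/measurable_EFinP.
  by move=> z; rewrite lee_fin.
rewrite mule_2l -{2}E -EED//; apply: EE_le => //; first exact: measurable_funD.
by move=> z; rewrite h0 hf.
Qed.

Section decoupling.
Context {R : realType} {N k dim : nat} {d} {T : measurableType d}.
Variables (P : probability T R) (X : T -> 'rV[R]_dim).
Variables (c : 'I_N -> R) (E : 'I_N -> 'M[R]_(k, dim)) (r : R).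
Hypothesis XP : gaussian_vector P X.
Hypothesis c0 : forall i, 0 <= c i.
Hypothesis E_iso : forall i x, l2norm (x *m E i) = l2norm x.
Hypothesis r2 : 2 < r.

Notation PP := (prod_prob P P).
Notation Y := (psum c E r).
Notation gam := (fine (gauss_moment r)).

Let mX : forall i, measurable_fun setT (fun w => X w 0 i : R).
Proof. by case: XP. Qed.

Let mX1 i : measurable_fun setT (fun z : T * T => X z.1 0 i : R).
Proof. exact: (measurableT_comp (mX i) measurable_fst). Qed.

Let mX2 i : measurable_fun setT (fun z : T * T => X z.2 0 i : R).
Proof. exact: (measurableT_comp (mX i) measurable_snd). Qed.

Lemma gauss_moment_fine q : 0 < q ->
  gauss_moment q = (fine (gauss_moment q) : R)%:E.
Proof.
move=> q0; rewrite fineK// ge0_fin_numE; first exact: gauss_moment_fin.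
by apply: integral_ge0 => x _; rewrite lee_fin powR_ge0.
Qed.

Lemma EE_psum q x : 0 < q ->
  EE P (fun w => psum c E q (X w) x) =
  ((\sum_i c i) * fine (gauss_moment q) * l2norm x `^ q)%:E.
Proof.
move=> q0; have [_ law _] := XP.
have mV i : measurable_fun setT (fun w => `|lform E (X w) i x| `^ q).
  by apply: measurable_normr_powR; exact: measurable_dot.
rewrite /psum EE_sum; last 2 first.
- by move=> i; exact: measurable_funM.
- by move=> i w; rewrite mulr_ge0 ?powR_ge0.
rewrite -mulrA mulr_suml -sumEFin; apply: eq_bigr => i _.
rewrite EEZ//.
rewrite EFinM; congr (_ * _)%E.
have ml : measurable_fun setT (fun t : measurableTypeR R => (`|t| `^ q)%:E).
  by apply/measurable_EFinP; exact: measurable_normr_powR.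
rewrite /EE (law (x *m E i) _ ml)//.
rewrite E_iso.
under eq_integral do rewrite normrM powRM// ger0_norm ?l2norm_ge0// EFinM.
rewrite ge0_integralZl_EFin ?powR_ge0//.
by rewrite -/(gauss_moment q) gauss_moment_fine// -EFinM mulrC.
Qed.

Lemma EE_psum_pair (a : R) x : 0 <= a ->
  EE PP (fun z => a * (Y (X z.1) x + Y (X z.2) x)) =
  (a * ((\sum_i c i) * gam * l2norm x `^ r +
        (\sum_i c i) * gam * l2norm x `^ r))%:E.
Proof.
move=> a0; have r0 : 0 < r by exact: lt_trans r2.
have m1 : measurable_fun setT (fun z : T * T => Y (X z.1) x).
  exact: measurable_psum.
have m2 : measurable_fun setT (fun z : T * T => Y (X z.2) x).
  exact: measurable_psum.
have p1 (z : T * T) : 0 <= Y (X z.1) x by exact: psum_ge0.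
have p2 (z : T * T) : 0 <= Y (X z.2) x by exact: psum_ge0.
have E1 : EE PP (fun z : T * T => Y (X z.1) x) =
    ((\sum_i c i) * gam * l2norm x `^ r)%:E.
  apply: (etrans (EE_prod P P m1 p1)); apply: (etrans _ (EE_psum x r0)).
  by apply: eq_integral => w _; exact: (EE_cst P (Y (X w) x)).
have E2 : EE PP (fun z : T * T => Y (X z.2) x) =
    ((\sum_i c i) * gam * l2norm x `^ r)%:E.
  apply: (etrans (EE_prod P P m2 p2)).
  apply: (etrans _ (integral_cst_probability P _)).
  by apply: eq_integral => w _; exact: EE_psum.
have p12 (z : T * T) : 0 <= Y (X z.1) x + Y (X z.2) x by rewrite addr_ge0.
apply: (etrans (EEZ PP (measurable_funD m1 m2) a0 p12)).
rewrite [RHS]EFinM; apply: congr1.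
by apply: (etrans (EED PP m1 m2 p1 p2)); rewrite E1 E2.
Qed.

Variable s : seq 'rV[R]_k.

Let D (t : R) (z : T * T) : R :=
  smax s (fun x => `|Y (X z.1) x -
                     Y (rot_cos t *: X z.1 + rot_sin t *: X z.2) x|).

Let mD t : measurable_fun setT (D t).
Proof.
apply: measurable_smax => x; apply: measurableT_comp => //.
apply: measurable_funB; apply: measurable_psum => // i.
under eq_fun do rewrite !mxE.
by apply: measurable_funD; exact: measurable_funM.
Qed.

Let D_ge0 t z : 0 <= D t z. Proof. exact: smax_ge0. Qed.

(** The doubled angle is reached in two steps. The second one starts from the rotated pair, which is
    again a pair of independent copies, so each step contributes the same mean. *)
Let D_double t u : rot_cos t = rot_cos u ^+ 2 - rot_sin u ^+ 2 ->
  rot_sin t = 2 * rot_cos u * rot_sin u ->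
  (EE PP (D t) <= 2%:E * EE PP (D u))%E.
Proof.
move=> ct st; have [_ _ rot] := XP; have [rho [mrho rhoP rho1 rho2]] := rot u.
apply: (EE_le_double mrho rhoP (mD u) (mD t) (D_ge0 u) (D_ge0 t)).
move=> z; apply: smax_le; first by rewrite addr_ge0.
move=> x xs.
apply: (@le_trans _ _ (`|Y (X z.1) x - Y (X (rho z).1) x| +
    `|Y (X (rho z).1) x - Y (rot_cos t *: X z.1 + rot_sin t *: X z.2) x|)).
  exact: ler_distD.
apply: lerD.
  by rewrite rho1; exact: (le_smax (fun x => `|Y (X z.1) x -
    Y (rot_cos u *: X z.1 + rot_sin u *: X z.2) x|)).
have -> : rot_cos t *: X z.1 + rot_sin t *: X z.2 =
    rot_cos u *: X (rho z).1 + rot_sin u *: X (rho z).2.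
  rewrite rho1 rho2 ct st; apply/rowP => i; rewrite !mxE; ring.
exact: (le_smax (fun x => `|Y (X (rho z).1) x -
  Y (rot_cos u *: X (rho z).1 + rot_sin u *: X (rho z).2) x|)).
Qed.

Let D_half i : (EE PP (D 1) <= (2 ^+ i)%:E * EE PP (D (@half_tan R i)))%E.
Proof.
elim: i => [|i IHi]; first by rewrite expr0 mul1e.
apply: (le_trans IHi); rewrite exprSr EFinM -muleA.
have [ct st] := @rot_half_tan R i.
by apply: lee_wpmul2l; [rewrite lee_fin exprn_ge0|exact: D_double].
Qed.

Let G (z : T * T) : R := smax s (fun x => `|dot (pgrad c E r (X z.1) x) (X z.2)|).

Let mG : measurable_fun setT G.
Proof.
apply: measurable_smax => x; apply: measurableT_comp => //.
exact: measurable_dot_pgrad.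
Qed.

(** A crude majorant of the second-order terms. Only the finiteness of its mean matters, since its
    coefficient, [2^i] times a squared sine, tends to [0]. *)
Let K (z : T * T) : R := \sum_(x <- s) (r ^+ 2 * 4 `^ r + r) * (Y (X z.1) x + Y (X z.2) x).

Let mK : measurable_fun setT K.
Proof.
apply: measurable_sum => x; apply: measurable_funM => //.
by apply: measurable_funD; exact: measurable_psum.
Qed.

Let Cr0 : 0 <= r ^+ 2 * 4 `^ r + r.
Proof.
apply: addr_ge0; last by rewrite (le_trans _ (ltW r2)).
by rewrite mulr_ge0 ?sqr_ge0 ?powR_ge0.
Qed.

Let K_ge0 z : 0 <= K z.
Proof. by rewrite sumr_ge0// => x _; rewrite mulr_ge0// addr_ge0 ?psum_ge0. Qed.

Let K_fin : exists C : R, 0 <= C /\ EE PP K = C%:E.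
Proof.
pose C (x : 'rV[R]_k) : R := (r ^+ 2 * 4 `^ r + r) *
   ((\sum_i c i) * gam * l2norm x `^ r + (\sum_i c i) * gam * l2norm x `^ r).
have KE : EE PP K = (\sum_(x <- s) C x)%:E.
  rewrite EE_sum; last 2 first.
  - by move=> x; apply: measurable_funM => //; apply: measurable_funD; exact: measurable_psum.
  - by move=> x z; rewrite mulr_ge0// addr_ge0 ?psum_ge0.
  by rewrite -sumEFin; apply: eq_bigr => x _; exact: EE_psum_pair.
exists (\sum_(x <- s) C x); split=> //.
by rewrite -lee_fin -KE EE_ge0.
Qed.

Lemma gaussian_decoupling :
  (EE PP (fun z => smax s (fun x => `|Y (X z.1) x - Y (X z.2) x|%R))
   <= (2 * r)%:E * EE PP G)%E.
Proof.
(* The right angle, [t = 1], turns the first copy into the second. *)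
have DE : (fun z => smax s (fun x => `|Y (X z.1) x - Y (X z.2) x|)) = D 1.
  apply/funext => z; apply: eq_bigr => x _.
  by rewrite rot_cos1 rot_sin1 scale0r add0r scale1r.
rewrite DE; have [C [C0 KC]] := K_fin.
have r0 : 0 <= r by rewrite (le_trans _ (ltW r2)).
have G0 z : 0 <= G z by exact: smax_ge0.
apply: (halving_limit r0 C0 (EE_ge0 PP G0)) => i; apply: (le_trans (D_half i)).
apply: lee_wpmul2l; first by rewrite lee_fin exprn_ge0.
rewrite -KC.
have h01 := @half_tan_le1 R i; have /andP[s0 s1] := rot_sin_le h01.
apply: (EE_le_comb PP (mulr_ge0 r0 s0) (sqr_ge0 _) (mD _) mG mK (D_ge0 _) G0 K_ge0).
move=> z; apply: smax_le.
  exact (addr_ge0 (mulr_ge0 (mulr_ge0 r0 s0) (G0 z))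
                  (mulr_ge0 (sqr_ge0 _) (K_ge0 z))).
move=> x xs; apply: (le_trans (psum_rotation E c0 _ _ _ r2 h01)).
apply: lerD.
  apply: ler_wpM2l; first exact: mulr_ge0.
  exact (le_smax (fun x => `|dot (pgrad c E r (X z.1) x) (X z.2)|) xs).
apply: ler_wpM2l; first exact: sqr_ge0.
apply: (le_sum_seq (f := fun y =>
  (r ^+ 2 * 4 `^ r + r) * (Y (X z.1) y + Y (X z.2) y)) _ xs) => y.
exact (mulr_ge0 Cr0 (addr_ge0 (psum_ge0 E c0 _ _ _) (psum_ge0 E c0 _ _ _))).
Qed.

End decoupling.

Lemma powR_div {R : realType} (u v q : R) : 0 <= u -> 0 < v ->
  (u / v) `^ q = u `^ q / v `^ q.
Proof.
move=> u0 v0; have vq : v `^ q != 0 by rewrite gt_eqF// powR_gt0.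
apply: (mulIf vq); rewrite divfK// -powRM ?divfK ?gt_eqF//; last exact: ltW.
by rewrite divr_ge0// ltW.
Qed.

(** * Concentration of power sums *)

Section psum_estimates.
Context {R : realType} {N k dim : nat}.
Variables (c : 'I_N -> R) (E : 'I_N -> 'M[R]_(k, dim)).
Hypothesis c0 : forall i, 0 <= c i.
Hypothesis E_iso : forall i x, l2norm (x *m E i) = l2norm x.
Hypothesis cE : forall x h,
  \sum_i c i * dot (x *m E i) h ^+ 2 <= l2norm x ^+ 2 * l2norm h ^+ 2.
Implicit Types (r q s : R) (g h : 'rV[R]_dim) (x y : 'rV[R]_k).

Lemma normr_lform_le g i x : `|lform E g i x| <= l2norm x * l2norm g.
Proof. by rewrite /lform (le_trans (normr_dot_le _ _))// E_iso. Qed.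

(** Divided by their common bound, the forms are at most [1] in absolute value; their power [s >= 2]
    is then at most their square, to which [cE] applies. *)
Lemma psum_le s g x : 2 <= s -> psum c E s g x <= (l2norm x * l2norm g) `^ s.
Proof.
move=> s2; have s0 : 0 < s by lra.
set M := l2norm x * l2norm g.
have M0 : 0 <= M by rewrite mulr_ge0 ?l2norm_ge0.
have [M00|M00] := eqVneq M 0.
  rewrite /psum big1 ?powR_ge0// => i _.
  have := normr_lform_le g i x; rewrite -/M M00 normr_le0 => /eqP ->.
  by rewrite normr0 powR0 ?mulr0// gt_eqF.
have Mp : 0 < M by rewrite lt_neqAle eq_sym M00.
apply: (@le_trans _ _ (\sum_i c i * (M `^ s * (lform E g i x ^+ 2 / M ^+ 2)))).
  apply: ler_sum => i _; apply: ler_wpM2l => //.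
  rewrite -[`|_|](@divfK _ M)// mulrC powRM//; last by rewrite divr_ge0.
  rewrite ler_wpM2l ?powR_ge0//.
  have u1 : 0 <= `|lform E g i x| / M <= 1.
    by rewrite divr_ge0//= ler_pdivrMr// mul1r; exact: normr_lform_le.
  have -> : lform E g i x ^+ 2 / M ^+ 2 = (`|lform E g i x| / M) `^ 2.
    have /andP[u0 _] := u1.
    by rewrite (powR_mulrn 2 u0) expr_div_n real_normK ?num_real.
  move: u1; set u := _ / M => /andP[u0 u1].
  have [->|un] := eqVneq u 0; first by rewrite !powR0 ?gt_eqF.
  by apply: ger_powR => //; rewrite lt_neqAle eq_sym un u0.
have -> : \sum_i c i * (M `^ s * (lform E g i x ^+ 2 / M ^+ 2)) =
    M `^ s / M ^+ 2 * \sum_i c i * lform E g i x ^+ 2.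
  by rewrite mulr_sumr; apply: eq_bigr => i _; ring.
rewrite -mulrA ler_piMr ?powR_ge0//.
rewrite mulrC ler_pdivrMr ?exprn_gt0// mul1r /M exprMn.
exact: cE.
Qed.

Lemma psum_normalized q g x a : 0 < q -> 0 < a -> psum c E q g x <= a `^ q ->
  \sum_i c i * (`|lform E g i x| / a) `^ q <= 1.
Proof.
move=> q0 a0 h.
have -> : \sum_i c i * (`|lform E g i x| / a) `^ q = psum c E q g x / a `^ q.
  rewrite /psum mulr_suml; apply: eq_bigr => i _.
  by rewrite powR_div// mulrA.
by rewrite ler_pdivrMr ?powR_gt0// mul1r.
Qed.

(** What remains when the five normalised sums in [pgrad_lipschitz] are replaced by [1]. *)
Definition lip_cst r q : R := 3 + r * (2 + 2 * 2 `^ q).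

Lemma lip_cst_bound r q (u1 u2 u3 u4 u5 : R) : 0 <= r ->
  u1 <= 1 -> u2 <= 1 -> u3 <= 1 -> u4 <= 1 -> u5 <= 1 ->
  (2 * u1 + u2) + r * (u3 + 2 `^ q * (u1 + u4) + u5) <= lip_cst r q.
Proof.
move=> r0 h1 h2 h3 h4 h5; rewrite /lip_cst; apply: lerD; first lra.
apply: ler_wpM2l => //.
have : 2 `^ q * (u1 + u4) <= 2 `^ q * 2 by apply: ler_wpM2l; [exact: powR_ge0|lra].
lra.
Qed.

(** Tested against [h], the difference splits into [phi] at [x] times the form of [h] at [x - y],
    and a difference of [phi] times the form of [h] at [y]. [young3] separates the factors, scaled
    so that their sums of powers are at most [1]: for the power [q] by hypothesis, for the power [s]
    by [psum_le]. *)
Lemma pgrad_lipschitz r q s g a : 2 < r -> 0 < q -> 2 <= s ->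
  (r - 1) / q + s^-1 = 1 -> 0 < a ->
  (forall x, psum c E q g x <= (a * l2norm x) `^ q) ->
  forall x y, l2norm x <= 1 -> l2norm y <= 1 ->
  l2norm (pgrad c E r g x - pgrad c E r g y)
    <= lip_cst r q * a `^ (r - 1) * l2norm (x - y).
Proof.
move=> r2 q0 s2 rqs a0 ha x y x1 y1; have r1 : 1 < r by lra.
have s0 : 0 < s by lra.
have r0 : 0 <= r by lra.
have r10 : 0 < r - 1 by lra.
have r2E : r - 2 = r - 1 - 1 by ring.
have L0 : 0 <= lip_cst r q.
  by rewrite /lip_cst addr_ge0// mulr_ge0//; lra.
have [xy0|xy0] := eqVneq (l2norm (x - y)) 0.
  by rewrite (eqP (_ : x == y)) ?subrr ?l2norm0 ?mulr0// -subr_eq0 (l2norm_eq0 xy0).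
have hp : 0 < l2norm (x - y) by rewrite lt_neqAle eq_sym xy0 l2norm_ge0.
apply: l2norm_le_dot; first by rewrite !mulr_ge0 ?powR_ge0 ?l2norm_ge0.
move=> h; have [h0|h0] := eqVneq (l2norm h) 0.
  by rewrite (l2norm_eq0 h0) dotC dot0l l2norm0 mulr0.
have Hp : 0 < l2norm h by rewrite lt_neqAle eq_sym h0 l2norm_ge0.
set hn := l2norm (x - y) in hp *; set Hn := l2norm h in Hp *.
(* The forms scaled to have sums of powers at most [1]: exponent [q] for [Bx], [By], [A], exponent
   [s] for [G1], [G2]. *)
pose Bx i := `|lform E g i x| / a.
pose By i := `|lform E g i y| / a.
pose A i := `|lform E g i (x - y)| / (a * hn).
pose G1 i := `|lform E h i (x - y)| / (hn * Hn).
pose G2 i := `|lform E h i y| / Hn.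
have ball z : l2norm z <= 1 -> \sum_i c i * (`|lform E g i z| / a) `^ q <= 1.
  move=> z1; apply: psum_normalized => //; apply: (le_trans (ha z)).
  rewrite ge0_ler_powR ?nnegrE//; [exact: ltW|..].
  - by rewrite mulr_ge0 ?l2norm_ge0// ltW.
  - exact: ltW.
  - by rewrite ler_piMr// ltW.
have SBx : \sum_i c i * Bx i `^ q <= 1 by exact: ball.
have SBy : \sum_i c i * By i `^ q <= 1 by exact: ball.
have SA : \sum_i c i * A i `^ q <= 1.
  by apply: psum_normalized => //; rewrite mulr_gt0.
have SG1 : \sum_i c i * G1 i `^ s <= 1.
  apply: psum_normalized => //; first by rewrite mulr_gt0.
  exact: psum_le.
have SG2 : \sum_i c i * G2 i `^ s <= 1.
  apply: psum_normalized => //; apply: (le_trans (psum_le _ _ s2)).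
  rewrite ge0_ler_powR ?nnegrE//; [exact: ltW|..].
  - by rewrite mulr_ge0 ?l2norm_ge0.
  - exact: ltW.
  - by rewrite ler_piMl// ltW.
have nn (u v : R) : 0 < v -> 0 <= `|u| / v by move=> v0; rewrite divr_ge0// ltW.
have term i : phi r (lform E g i x) * lform E h i x
     - phi r (lform E g i y) * lform E h i y <=
   a `^ (r - 1) * hn * Hn * ((2 * Bx i `^ q + G1 i `^ s) +
     r * (A i `^ q + 2 `^ q * (Bx i `^ q + By i `^ q) + G2 i `^ s)).
  have -> : phi r (lform E g i x) * lform E h i x
      - phi r (lform E g i y) * lform E h i y =
      phi r (lform E g i x) * lform E h i (x - y) +
      (phi r (lform E g i x) - phi r (lform E g i y)) * lform E h i y.
    by rewrite lformB; ring.
  have vx : `|lform E g i x| = a * Bx i by rewrite mulrC divfK// gt_eqF.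
  have vy : `|lform E g i y| = a * By i by rewrite mulrC divfK// gt_eqF.
  have vh : `|lform E g i x - lform E g i y| = a * hn * A i.
    by rewrite -lformB mulrC divfK// mulf_neq0// gt_eqF.
  have w1 : `|lform E h i (x - y)| = hn * Hn * G1 i.
    by rewrite mulrC divfK// mulf_neq0// gt_eqF.
  have w2 : `|lform E h i y| = Hn * G2 i by rewrite mulrC divfK// gt_eqF.
  have Bx0 : 0 <= Bx i by exact: nn.
  have By0 : 0 <= By i by exact: nn.
  have A0 : 0 <= A i by apply: nn; rewrite mulr_gt0.
  have G10 : 0 <= G1 i by apply: nn; rewrite mulr_gt0.
  have G20 : 0 <= G2 i by exact: nn.
  have a00 : 0 <= a by exact: ltW.
  have aE : a * a `^ (r - 2) = a `^ (r - 1).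
    by rewrite r2E mulr_powRB1.
  have p0 : 0 <= a `^ (r - 1) * hn * Hn.
    by rewrite !mulr_ge0 ?powR_ge0// ltW.
  rewrite mulrDr; apply: lerD.
    rewrite (le_trans (ler_norm _))// normrM normr_phi// vx w1.
    rewrite powRM//.
    have -> : a `^ (r - 1) * Bx i `^ (r - 1) * (hn * Hn * G1 i) =
       a `^ (r - 1) * hn * Hn * (Bx i `^ (r - 1) * G1 i) by ring.
    apply: ler_wpM2l => //.
    have := young3 r2 q0 s0 rqs Bx0 Bx0 G10.
    rewrite (_ : Bx i * _ = Bx i `^ (r - 1)); first by rewrite mulr_natl mulr2n.
    by rewrite r2E mulr_powRB1.
  rewrite (le_trans (ler_norm _))// normrM w2.
  apply: (@le_trans _ _ ((r * (a * hn * A i) * (a * By i + a * Bx i) `^ (r - 2)) * (Hn * G2 i))).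
    apply: ler_wpM2r; first by rewrite mulr_ge0// ltW.
    by rewrite -vx -vy -vh; exact: phi_lip.
  rewrite -mulrDr powRM//; last by rewrite addr_ge0.
  have -> : r * (a * hn * A i) * (a `^ (r - 2) * (By i + Bx i) `^ (r - 2)) * (Hn * G2 i)
    = (a * a `^ (r - 2)) * hn * Hn * (r * (A i * (By i + Bx i) `^ (r - 2) * G2 i)) by ring.
  rewrite aE; apply: ler_wpM2l => //.
  apply: ler_wpM2l; first exact: r0.
  apply: (le_trans (young3 r2 q0 s0 rqs A0 (addr_ge0 By0 Bx0) G20)).
  rewrite lerD2r lerD2l addrC [_ + By i `^ q]addrC addrC; exact: powRD_le.
rewrite dotBl !dot_pgrad -sumrB.
under eq_bigr do rewrite -mulrBr.
apply: (@le_trans _ _ (a `^ (r - 1) * hn * Hn * \sum_i c i *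
   ((2 * Bx i `^ q + G1 i `^ s) +
     r * (A i `^ q + 2 `^ q * (Bx i `^ q + By i `^ q) + G2 i `^ s)))).
  rewrite mulr_sumr; apply: ler_sum => i _.
  by rewrite [leRHS]mulrCA; apply: ler_wpM2l.
have -> : lip_cst r q * a `^ (r - 1) * hn * Hn =
  a `^ (r - 1) * hn * Hn * lip_cst r q by ring.
apply: ler_wpM2l; first by rewrite !mulr_ge0 ?powR_ge0// ltW.
have -> : \sum_i c i * ((2 * Bx i `^ q + G1 i `^ s) +
     r * (A i `^ q + 2 `^ q * (Bx i `^ q + By i `^ q) + G2 i `^ s)) =
  (2 * \sum_i c i * Bx i `^ q + \sum_i c i * G1 i `^ s) +
  r * (\sum_i c i * A i `^ q + 2 `^ q * (\sum_i c i * Bx i `^ q + \sum_i c i * By i `^ q)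
     + \sum_i c i * G2 i `^ s).
  rewrite !(mulrDr, mulr_sumr) -!big_split/=.
  by apply: eq_bigr => i _; ring.
exact (lip_cst_bound q r0 SBx SG1 SA SBy SG2).
Qed.

(** With [y] in the net at distance at most [1/4] from [x], the part [x - y] contributes at most
    [2^q 4^-q <= 1/4] of the supremum over the ball. This supremum is finite by [psum_le], so a
    quarter of it can be subtracted from both sides. *)
Lemma psum_le_net (s0 : seq 'rV[R]_k) q g : 2 < q ->
  (forall x, l2norm x <= 1 -> exists2 y, y \in s0 & l2norm (x - y) <= 4^-1) ->
  forall x, psum c E q g x <=
    4 / 3 * 2 `^ q * smax s0 (psum c E q g) * l2norm x `^ q.
Proof.
move=> q2 net; have q0 : 0 < q by lra.
pose A := [set psum c E q g x | x in [set x | l2norm x <= 1]].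
have supA : has_sup A.
  split; first by exists (psum c E q g 0), 0 => //=; rewrite l2norm0.
  exists (l2norm g `^ q) => _ [x /= x1 <-].
  rewrite (le_trans (psum_le _ _ _))//; first exact: ltW.
  rewrite ge0_ler_powR ?nnegrE ?mulr_ge0 ?l2norm_ge0//; first exact: ltW.
  by rewrite ler_piMl ?l2norm_ge0.
set F := smax s0 _.
have F0 : 0 <= F by exact: smax_ge0.
have ub x : l2norm x <= 1 -> psum c E q g x <= sup A.
  by move=> x1; apply: ub_le_sup; [case: supA|exists x].
have supA0 : 0 <= sup A by rewrite (le_trans _ (ub 0 _)) ?psum_ge0 ?l2norm0.
have two4 : 2 `^ q * 4^-1 `^ q <= 4^-1 :> R.
  rewrite -powRM// (_ : 2 * 4^-1 = 2^-1); last by field.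
  apply: (@le_trans _ _ (2^-1 `^ 2)).
    by apply: ger_powR; [lra|exact: ltW].
  by rewrite powR_mulrn// ; lra.
have step x : l2norm x <= 1 -> psum c E q g x <= 2 `^ q * F + 4^-1 * sup A.
  move=> x1; have [y ys xy] := net x x1.
  have : psum c E q g x <= 2 `^ q * (psum c E q g y + psum c E q g (x - y)).
    rewrite /psum -big_split/= mulr_sumr; apply: ler_sum => i _.
    rewrite -mulrDr mulrCA; apply: ler_wpM2l => //.
    apply: (le_trans _ (powRD_le q0 (normr_ge0 _) (normr_ge0 _))).
    rewrite ge0_ler_powR ?nnegrE ?addr_ge0//; first exact: ltW.
    by rewrite lformB (le_trans _ (ler_normD _ _))// addrC subrK.
  move=> /le_trans; apply; rewrite mulrDr; apply: lerD.
    by apply: ler_wpM2l; [exact: powR_ge0|exact: le_smax].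
  have -> : x - y = 4^-1 *: (4 *: (x - y)) by rewrite scalerA mulVf ?scale1r.
  rewrite psumZ ger0_norm// mulrA; apply: ler_pM => //.
  - exact: psum_ge0.
  - apply: ub; rewrite l2normZ ger0_norm//.
    by rewrite -ler_pdivlMl// mulr1.
have supF : sup A <= 4 / 3 * 2 `^ q * F.
  have : sup A <= 2 `^ q * F + 4^-1 * sup A.
    by apply: ge_sup; [case: supA|move=> _ [x /= x1 <-]; exact: step].
  set u := _ * F; rewrite (_ : 4 / 3 * _ * F = 4 / 3 * u); last by rewrite /u; ring.
  lra.
move=> x; have [x0|x0] := eqVneq (l2norm x) 0.
  rewrite (l2norm_eq0 x0) /psum big1 ?mulr_ge0 ?powR_ge0// => i _.
  by rewrite /lform mul0mx dot0l normr0 powR0 ?mulr0// gt_eqF.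
have xp : 0 < l2norm x by rewrite lt_neqAle eq_sym x0 l2norm_ge0.
have xE : x = l2norm x *: ((l2norm x)^-1 *: x).
  by rewrite scalerA divff// scale1r.
rewrite [X in psum _ _ _ _ X <= _]xE psumZ (ger0_norm (ltW xp)) mulrC.
apply: ler_wpM2r; first exact: powR_ge0.
apply: le_trans supF; apply: ub.
by rewrite l2normZ gtr0_norm ?invr_gt0// mulVf.
Qed.

End psum_estimates.

(** * Symmetrisation by an independent copy *)

Section independent_copy.
Context {R : realType} {d} {T : measurableType d} {I : eqType}.
Variables (P : probability T R) (s : seq I) (Y : I -> T -> R) (v : I -> R).
Hypothesis mY : forall x, measurable_fun setT (Y x).
Hypothesis Y0 : forall x w, 0 <= Y x w.
Hypothesis EY : forall x, EE P (Y x) = (v x)%:E.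
Notation PP := (prod_prob P P).

Definition copy_diff (z : T * T) : R := smax s (fun x => `|Y x z.1 - Y x z.2|).

Lemma measurable_copy_diff : measurable_fun setT copy_diff.
Proof.
apply: measurable_smax => x; apply: measurableT_comp => //.
apply: measurable_funB.
  exact: (measurableT_comp (mY x) measurable_fst).
exact: (measurableT_comp (mY x) measurable_snd).
Qed.

Lemma copy_diff_ge0 z : 0 <= copy_diff z.
Proof. exact: smax_ge0. Qed.

Lemma smax_attained (f : I -> R) :
  smax s f = 0 \/ exists2 x, x \in s & smax s f = f x.
Proof.
rewrite /smax; elim: s => [|x t IHt]; first by left; rewrite big_nil.
rewrite big_cons; set M := \big[_/_]_(_ <- _) _ in IHt *.
have [xM|Mx] := leP (f x) M.
  case: IHt => [->|[y yt ->]]; first by left.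
  by right; exists y => //; rewrite inE yt orbT.
by right; exists x => //; rewrite mem_head.
Qed.

Let mslice w : measurable_fun setT (fun w' => copy_diff (w, w')).
Proof. exact: (measurableT_comp measurable_copy_diff (measurable_pair1 w)). Qed.

(* Jensen's inequality for the integration over the copy. *)
Lemma EE_centered_le :
  (EE P (fun w => smax s (fun x => `|Y x w - v x|%R)) <= EE PP copy_diff)%E.
Proof.
have d0 w w' : 0 <= copy_diff (w, w') by exact: copy_diff_ge0.
rewrite (EE_prod P P measurable_copy_diff copy_diff_ge0).
have pt w x : x \in s -> ((`|Y x w - v x|)%:E <= EE P (fun w' => copy_diff (w, w')))%E.
  move=> xs; have le w' : `|Y x w - Y x w'| <= copy_diff (w, w').
    exact: (le_smax (fun x => `|Y x w - Y x w'|)).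
  have h1 : ((Y x w)%:E <= (v x)%:E + EE P (fun w' => copy_diff (w, w')))%E.
    rewrite -(EE_cst P (Y x w)) -(EY x) -EED//; apply: EE_le => //.
      exact: measurable_funD.
    by move=> y; rewrite Y0/= -lerBlDl (le_trans _ (le y))// ler_norm.
  have h2 : ((v x)%:E <= (Y x w)%:E + EE P (fun w' => copy_diff (w, w')))%E.
    rewrite -(EE_cst P (Y x w)) -(EY x) -EED//; apply: EE_le => //.
      exact: measurable_funD.
    by move=> y; rewrite Y0/= -lerBlDl (le_trans _ (le y))// distrC ler_norm.
  have [vY|Yv] := leP (v x) (Y x w).
    by rewrite ger0_norm ?subr_ge0// EFinB leeBlDr// addeC.
  by rewrite ltr0_norm ?subr_lt0// opprB EFinB leeBlDr// addeC.
apply: ge0_le_integral => //.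
- by move=> w _; rewrite lee_fin smax_ge0.
- apply/measurable_EFinP; apply: measurable_smax => x.
  by apply: measurableT_comp => //; exact: measurable_funB.
- have md : measurable_fun setT (fun z => (copy_diff z)%:E).
    by apply/measurable_EFinP; exact: measurable_copy_diff.
  apply: (@measurable_fun_fubini_tonelli_F _ _ _ _ R P _ md) => z.
  by rewrite lee_fin copy_diff_ge0.
move=> w _; case: (smax_attained (fun x => `|Y x w - v x|)) => [->|[x xs ->]].
  by apply: EE_ge0.
exact: pt.
Qed.

Lemma EE_smax_le M : 0 <= M -> (forall x, x \in s -> v x <= M) ->
  (EE P (fun w => smax s (Y^~ w)) <= M%:E + EE PP copy_diff)%E.
Proof.
move=> M0 vM.
have mc : measurable_fun setT (fun w => smax s (fun x => `|Y x w - v x|)).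
  apply: measurable_smax => x; apply: measurableT_comp => //.
  exact: measurable_funB.
apply: (@le_trans _ _ (M%:E + EE P (fun w => smax s (fun x => `|Y x w - v x|%R)))%E); last first.
  by apply: leeD2l; exact: EE_centered_le.
rewrite -(EE_cst P M) -EED//; last by move=> w; exact: smax_ge0.
apply: EE_le.
- exact: measurable_smax.
- exact: measurable_funD.
move=> w; rewrite smax_ge0/=; apply: smax_le; first by rewrite addr_ge0 ?smax_ge0.
move=> x xs; rewrite -[Y x w](subrK (v x)) addrC; apply: lerD; first exact: vM.
apply: (le_trans (ler_norm _)).
exact: (le_smax (fun x => `|Y x w - v x|)).
Qed.

End independent_copy.

Lemma powR_le1 {R : realType} (x r : R) : 0 <= x -> x <= 1 -> 0 <= r ->
  x `^ r <= 1.
Proof.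
move=> x0 x1 r0; have <- : 1 `^ r = 1 :> R by rewrite powR1.
by apply: ge0_ler_powR; rewrite ?nnegrE.
Qed.

Lemma powR_ge1 {R : realType} (x r : R) : 1 <= x -> 0 <= r -> 1 <= x `^ r.
Proof. by move=> x1 r0; rewrite -[leLHS](powRr0 x) ler_powR. Qed.

(** * Expected suprema of Gaussian power sums *)

Section random_power_sums.
Context {R : realType} {N k dim : nat} {d} {T : measurableType d}.
Variables (P : probability T R) (X : T -> 'rV[R]_dim).
Variables (c : 'I_N -> R) (E : 'I_N -> 'M[R]_(k, dim)).
Variables (S : nat -> seq 'rV[R]_k) (J : nat).
Hypothesis k0 : (0 < k)%N.
Hypothesis XP : gaussian_vector P X.
Hypothesis c0 : forall i, 0 <= c i.
Hypothesis E_iso : forall i x, l2norm (x *m E i) = l2norm x.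
Hypothesis cE : forall x h,
  \sum_i c i * dot (x *m E i) h ^+ 2 <= l2norm x ^+ 2 * l2norm h ^+ 2.
Hypothesis S_ball : forall j y, y \in S j -> l2norm y <= 1.
Hypothesis S_size : forall j, (size (S j) <= 2 ^ (3 * k * 4 ^ j))%N.
Hypothesis S_net : forall j x, l2norm x <= 1 ->
  exists2 y, y \in S j & l2norm (x - y) <= (4 ^ j)%:R^-1.
Hypothesis J1 : (0 < J)%N.

Implicit Types (q r p : R).
Notation PP := (prod_prob P P).
Notation m := (\sum_i c i).
Notation sk := (Num.sqrt (k%:R : R)).
Notation gam q := (fine (gauss_moment q)).
Notation net := (flatten [seq S j | j <- iota 0 J.+1]).

Definition psum_sup q (w : T) : R := smax net (psum c E q (X w)).
(** Controls [psum] on the whole unit ball; the added [1] keeps it positive. *)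
Definition psum_bound q (w : T) : R := 4 / 3 * 2 `^ q * psum_sup q w + 1.
Definition psum_diff r : T * T -> R :=
  copy_diff net (fun x w => psum c E r (X w) x).

Let mX : forall i, measurable_fun setT (fun w => X w 0 i : R).
Proof. by case: XP. Qed.

Let mY q x : measurable_fun setT (fun w => psum c E q (X w) x).
Proof. exact: measurable_psum. Qed.

Let netP j x : (j <= J)%N -> l2norm x <= 1 ->
  exists2 y, y \in net & l2norm (x - y) <= (4 ^ j)%:R^-1.
Proof.
move=> jJ /(S_net j)[y yS xy]; exists y => //.
by apply/flatten_mapP; exists j => //; rewrite mem_iota.
Qed.

Let net_ball y : y \in net -> l2norm y <= 1.
Proof. by move=> /flatten_mapP[j _]; exact: S_ball. Qed.

Lemma psum_sup_ge0 q w : 0 <= psum_sup q w.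
Proof. exact: smax_ge0. Qed.

Lemma psum_bound_gt0 q w : 0 < psum_bound q w.
Proof. by rewrite /psum_bound ltr_wpDl// !mulr_ge0 ?powR_ge0 ?psum_sup_ge0. Qed.

Lemma measurable_psum_sup q : measurable_fun setT (psum_sup q).
Proof. exact (measurable_smax net (mY q)). Qed.

Lemma measurable_psum_bound q : measurable_fun setT (psum_bound q).
Proof.
apply: measurable_funD => //; apply: measurable_funM => //.
exact: measurable_psum_sup.
Qed.

Lemma psum_le_bound q w x : 2 < q ->
  psum c E q (X w) x <= psum_bound q w * l2norm x `^ q.
Proof.
move=> q2.
have n4 y : l2norm y <= 1 -> exists2 z, z \in net & l2norm (y - z) <= 4^-1.
  by move=> y1; have [z zn] := netP J1 y1; rewrite expn1 => yz; exists z.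
apply: (le_trans (psum_le_net c0 E_iso cE (X w) q2 n4 x)).
by rewrite ler_wpM2r ?powR_ge0// lerDl.
Qed.

(** The factor [2 * r] comes from decoupling, [48 * lip_cst r q] from chaining. *)
Definition diff_cst (r q : R) : R := 2 * r * (48 * lip_cst r q).

Lemma diff_cst_gt0 r q : 0 < r -> 0 < diff_cst r q.
Proof.
move=> r0; have L : 0 < lip_cst r q.
  by rewrite /lip_cst ltr_wpDr// mulr_ge0// ltW.
by rewrite /diff_cst !mulr_gt0.
Qed.

(** For a fixed first copy the gradient term is a Gaussian process linear in the second copy. Its
    Lipschitz constant is known, so chaining bounds the inner integral. *)
Lemma EE_psum_diff_le r q s : 2 < r -> 2 < q -> 2 <= s -> (r - 1) / q + s^-1 = 1 ->
  (EE PP (psum_diff r) <=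
   (diff_cst r q * sk)%:E * EE P (fun w => psum_bound q w `^ ((r - 1) / q))%R)%E.
Proof.
move=> r2 q2 s2 rqs; have q0 : 0 < q by exact: lt_trans q2.
have r0 : 0 <= r by rewrite (le_trans _ (ltW r2)).
have L0 : 0 < lip_cst r q by rewrite /lip_cst ltr_wpDr// mulr_ge0.
apply: (le_trans (gaussian_decoupling XP c0 E_iso r2 net)).
pose G (z : T * T) : R := smax net (fun x => `|dot (pgrad c E r (X z.1) x) (X z.2)|).
have mX1 i : measurable_fun setT (fun z : T * T => X z.1 0 i : R).
  exact: (measurableT_comp (mX i) measurable_fst).
have mX2 i : measurable_fun setT (fun z : T * T => X z.2 0 i : R).
  exact: (measurableT_comp (mX i) measurable_snd).
have mG : measurable_fun setT G.
  apply: measurable_smax => x; apply: measurableT_comp => //.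
  exact: measurable_dot_pgrad.
have G0 z : 0 <= G z by exact: smax_ge0.
pose B w := psum_bound q w `^ ((r - 1) / q).
have mB : measurable_fun setT B.
  by apply: (measurableT_comp (measurable_powR _)); exact: measurable_psum_bound.
have B0 w : 0 <= B w by exact: powR_ge0.
rewrite -/G -/B /diff_cst.
have -> : ((2 * r * (48 * lip_cst r q) * sk)%:E * EE P B =
    (2 * r)%:E * ((48 * lip_cst r q * sk)%:E * EE P B))%E.
  by rewrite muleA -EFinM; congr (_%:E * _)%E; ring.
apply: lee_wpmul2l; first by rewrite lee_fin mulr_ge0.
have c48 : 0 <= 48 * lip_cst r q * sk by rewrite !mulr_ge0// ltW.
rewrite -(EEZ P mB c48 B0) (EE_prod P P mG G0).
apply: ge0_le_integral => //.
- by move=> w _; apply: EE_ge0.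
- have md : measurable_fun setT (fun z => (G z)%:E) by exact/measurable_EFinP.
  apply: (@measurable_fun_fubini_tonelli_F _ _ _ _ R P _ md) => z.
  by rewrite lee_fin.
- by apply/measurable_EFinP; exact: measurable_funM.
move=> w _; rewrite /G/=.
(* Makes [a^q] the bound on [psum] over the ball, so that the Lipschitz factor [a^(r - 1)] is
   [B w]. *)
pose a := psum_bound q w `^ q^-1.
have a0 : 0 < a by rewrite powR_gt0// psum_bound_gt0.
have aB : a `^ (r - 1) = B w by rewrite /a -powRrM mulrC.
have L := pgrad_lipschitz c0 E_iso cE r2 q0 s2 rqs a0 (g := X w).
have aY x : psum c E q (X w) x <= (a * l2norm x) `^ q.
  rewrite powRM ?l2norm_ge0//; last exact: ltW.
  rewrite /a -powRrM mulVf ?gt_eqF// powRr1; last exact/ltW/psum_bound_gt0.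
  exact: psum_le_bound.
have Lp : 0 < lip_cst r q * B w by rewrite -aB mulr_gt0// powR_gt0.
have := chaining_bound k0 XP S_ball S_size S_net Lp (pgrad0 c E r (X w)).
move=> /(_ _ J);
  rewrite (_ : 48 * lip_cst r q * sk * B w = 48 * (lip_cst r q * B w) * sk); last by ring.
apply; rewrite -aB; exact: L.
Qed.

(** If the left side exceeds [e * B], then [B^(1/r) < u / e], and the second term dominates. *)
Lemma young_self (r u e B : R) : 1 < r -> 0 <= u -> 0 < e -> 0 < B ->
  u * B `^ ((r - 1) / r) <= e * B + u * (u / e) `^ (r - 1).
Proof.
move=> r1 u0 e0 B0; have r0 : 0 < r by rewrite (lt_trans _ r1).
have r10 : 0 <= r - 1 by rewrite subr_ge0 ltW.
have ue : 0 <= u / e by rewrite divr_ge0// ltW.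
have [h|h] := leP (u * B `^ ((r - 1) / r)) (e * B).
  by rewrite (le_trans h)// lerDl mulr_ge0 ?powR_ge0.
rewrite (le_trans _ (_ : u * (u / e) `^ (r - 1) <= _))//; last first.
  by rewrite lerDr mulr_ge0// ltW.
apply: ler_wpM2l => //; rewrite mulrC powRrM; apply: ge0_ler_powR => //.
- by rewrite nnegrE powR_ge0.
- rewrite ler_pdivlMr//; apply: ltW.
  rewrite -(ltr_pM2r (powR_gt0 ((r - 1) / r) B0)); apply: le_lt_trans h.
  rewrite mulrAC -powRD; last by rewrite (gt_eqF B0) implybT.
  rewrite (_ : r^-1 + (r - 1) / r = 1); first by rewrite powRr1 1?mulrC// ltW.
  by field; rewrite gt_eqF.
Qed.

Let m_ge0 : 0 <= m. Proof. by rewrite sumr_ge0. Qed.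

Let sk1 : 1 <= sk.
Proof. by rewrite -[leLHS]sqrtr1 ler_wsqrtr// ler1n. Qed.

Lemma gauss_moment_fine_ge0 q : 0 <= gam q.
Proof.
by apply: fine_ge0; apply: integral_ge0 => x _; rewrite lee_fin powR_ge0.
Qed.

(** Finiteness is what allows half of this expectation to be subtracted from both sides in
    [EE_psum_sup_le]. *)
Lemma EE_psum_sup_fin q : 0 < q -> exists2 f : R, 0 <= f & EE P (psum_sup q) = f%:E.
Proof.
move=> q0; have lt : (EE P (psum_sup q) < +oo)%E.
  apply: (@le_lt_trans _ _ (EE P (fun w => \sum_(x <- net) psum c E q (X w) x))).
    apply: EE_le; [exact: measurable_psum_sup|exact: measurable_sum|].
    move=> w; rewrite psum_sup_ge0 andTb; apply: smax_le.
      by rewrite sumr_ge0// => x _; exact: psum_ge0.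
    move=> x xn; apply: (le_sum_seq (f := psum c E q (X w)) _ xn) => y.
    exact: psum_ge0.
  rewrite EE_sum//; last by move=> x w; exact: psum_ge0.
  by under eq_bigr do rewrite (EE_psum XP c0 E_iso)//; rewrite sumEFin ltry.
have ge : (0 <= EE P (psum_sup q))%E by apply: EE_ge0 => w; exact: psum_sup_ge0.
exists (fine (EE P (psum_sup q))); first exact: fine_ge0.
by rewrite fineK// ge0_fin_numE.
Qed.

Definition sup_cst (r : R) : R :=
  2 * (diff_cst r r * (2 * (4 / 3 * 2 `^ r) * diff_cst r r) `^ (r - 1)) + 1.

(* The bound is self-improving: the fluctuation of the supremum is controlled
   by a power less than 1 of the supremum itself. *)
Lemma EE_psum_sup_le r : 2 < r ->
  (EE P (psum_sup r) <= (2 * (m * gam r) + sup_cst r * sk `^ r)%:E)%E.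
Proof.
move=> r2; have r0 : 0 < r by exact: lt_trans r2.
have r1 : 1 < r by rewrite (lt_trans _ r2)// ltr1n.
have conj : (r - 1) / r + r^-1 = 1 by field; rewrite gt_eqF.
set K := diff_cst r r; have K0 : 0 < K by exact: diff_cst_gt0.
set al : R := 4 / 3 * 2 `^ r.
have al1 : 1 <= al.
  have : 1 <= 2 `^ r :> R by rewrite powR_ge1 ?ler1n// ltW.
  by rewrite /al; lra.
have al0 : 0 < al by exact: lt_le_trans al1.
(* With this [e], the term [e * psum_bound] contains exactly half of [psum_sup]. *)
pose e := (2 * al)^-1; have e0 : 0 < e by rewrite invr_gt0 mulr_gt0.
pose u := K * sk; have u0 : 0 <= u by rewrite mulr_ge0// ltW.
pose D := u * (u / e) `^ (r - 1).
have D0 : 0 <= D by rewrite mulr_ge0 ?powR_ge0.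
have DE : D = K * (2 * al * K) `^ (r - 1) * sk `^ r.
  rewrite /D (_ : u / e = (2 * al * K) * sk); last by rewrite /u /e invrK; ring.
  have h0 : 0 <= 2 * al * K by apply: mulr_ge0; [apply: mulr_ge0|]; rewrite // ltW.
  rewrite (powRM _ h0 (sqrtr_ge0 _)).
  by rewrite -[in RHS](mulr_powRB1 (x := sk) _ r0)// /u; ring.
have [f f0 fE] := EE_psum_sup_fin r0.
have mB : measurable_fun setT (psum_bound r) by exact: measurable_psum_bound.
have mS : measurable_fun setT (psum_sup r) by exact: measurable_psum_sup.
have H1 : (EE P (psum_sup r) <= (m * gam r)%:E + EE PP (psum_diff r))%E.
  apply: (EE_smax_le (mY r) _ (fun x => EE_psum XP c0 E_iso x r0)).
  - by move=> x w; exact: psum_ge0.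
  - by rewrite mulr_ge0// gauss_moment_fine_ge0.
  move=> x /net_ball x1; rewrite ler_piMr ?mulr_ge0 ?gauss_moment_fine_ge0//.
  by rewrite powR_le1 ?l2norm_ge0// ltW.
have H2 := EE_psum_diff_le r2 r2 (ltW r2) conj.
have mBp : measurable_fun setT (fun w => psum_bound r w `^ ((r - 1) / r)).
  by apply: (measurableT_comp (measurable_powR _)).
have H3 : ((K * sk)%:E * EE P (fun w => psum_bound r w `^ ((r - 1) / r))%R <=
    (f / 2 + (e + D))%:E)%E.
  rewrite -EEZ//; last by move=> w; exact: powR_ge0.
  have -> : (f / 2 + (e + D))%:E =
      EE P (fun w => 2^-1 * psum_sup r w + (e + D)).
    rewrite EED//; last 3 first.
    - exact: measurable_funM.
    - by move=> w; rewrite mulr_ge0// psum_sup_ge0.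
    - by move=> w; rewrite addr_ge0// ltW.
    by rewrite EE_cst EEZ ?fE// ?[f / 2]mulrC// => w; exact: psum_sup_ge0.
  apply: EE_le.
  - exact: measurable_funM.
  - by apply: measurable_funD => //; exact: measurable_funM.
  move=> w; rewrite mulr_ge0 ?powR_ge0// andTb.
  apply: (le_trans (young_self r1 u0 e0 (psum_bound_gt0 r w))).
  have bE : e * psum_bound r w = 2^-1 * psum_sup r w + e.
    by rewrite /psum_bound -/al /e; field; rewrite gt_eqF.
  by rewrite bE addrA.
have : (f%:E <= (m * gam r + (f / 2 + (e + D)))%:E)%E.
  rewrite -fE (le_trans H1)// EFinD leeD2l// (le_trans H2)//.
rewrite fE !lee_fin => h.
have e1 : 2 * e <= 1 by rewrite /e invfM mulrA divff ?mul1r ?invf_le1.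
have skr : 1 <= sk `^ r by rewrite powR_ge1// ltW.
have -> : sup_cst r * sk `^ r = 2 * D + sk `^ r.
  by rewrite /sup_cst -/K -/al DE; ring.
lra.
Qed.

(** The exponent [q] for which [(p - 1) / q + 1 / 2 = 1]. *)
Let twop p := 2 * p - 2.

Definition moment_cst p : R :=
  4 / 3 * 2 `^ twop p * (2 * gam (twop p) + sup_cst (twop p)) + 1.
Definition fluct_cst p : R := diff_cst p (twop p) * (moment_cst p + 1).

Lemma sup_cst_ge0 r : 0 < r -> 0 <= sup_cst r.
Proof.
move=> r0; rewrite /sup_cst addr_ge0// mulr_ge0// mulr_ge0 ?powR_ge0//.
exact/ltW/diff_cst_gt0.
Qed.

Lemma moment_cst_ge0 p : 2 < p -> 0 <= moment_cst p.
Proof.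
move=> p2; have q0 : 0 < twop p by rewrite /twop; lra.
rewrite addr_ge0// mulr_ge0 ?mulr_ge0 ?powR_ge0//.
by rewrite addr_ge0 ?mulr_ge0 ?sup_cst_ge0 ?gauss_moment_fine_ge0.
Qed.

Lemma fluct_cst_gt0 p : 2 < p -> 0 < fluct_cst p.
Proof.
move=> p2; rewrite mulr_gt0 ?diff_cst_gt0//; first exact: lt_trans p2.
by rewrite ltr_wpDl// moment_cst_ge0.
Qed.

Lemma EE_psum_bound_le p : 2 < p ->
  (EE P (psum_bound (twop p)) <= (moment_cst p * (m + sk `^ twop p))%:E)%E.
Proof.
move=> p2; have q2 : 2 < twop p by rewrite /twop; lra.
have q0 : 0 < twop p by exact: lt_trans q2.
have al0 : 0 <= 4 / 3 * 2 `^ twop p :> R by rewrite mulr_ge0 ?powR_ge0.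
have mS := measurable_psum_sup (twop p).
rewrite /psum_bound EED//; last 2 first.
- exact: measurable_funM.
- by move=> w; rewrite mulr_ge0// psum_sup_ge0.
rewrite EE_cst EEZ//; last by move=> w; exact: psum_sup_ge0.
apply: (le_trans (leeD2r _ (lee_wpmul2l _ (EE_psum_sup_le q2)))); first by rewrite lee_fin.
rewrite -EFinM -EFinD lee_fin.
have skq : 1 <= sk `^ twop p by rewrite powR_ge1// ltW.
have g0 := gauss_moment_fine_ge0 (twop p).
have s0 := sup_cst_ge0 q0.
rewrite /moment_cst; move: al0; set al := 4 / 3 * _; set b := sk `^ _ in skq *.
set g := gam _ in g0 *; set s := sup_cst _ in s0 *; move=> al0.
have -> : (al * (2 * g + s) + 1) * (m + b) =
  al * (2 * (m * g) + s * b) + b + (al * (2 * (g * b) + s * m) + m) by ring.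
rewrite -addrA lerD2l ler_wpDr//.
by rewrite addr_ge0// mulr_ge0// addr_ge0// !mulr_ge0// (le_trans ler01).
Qed.

(** The exponent of [psum_bound] is now [1/2]. The root is linearised by [sqrt B <= B / tau + tau],
    with [tau^2] dominating the order [m + sk^(2p - 2)] of the mean of [B]; finally [sk * tau] is
    the claimed sum. *)
Lemma EE_psum_diff_final p : 2 < p ->
  (EE PP (psum_diff p) <=
   (fluct_cst p * (sk * Num.sqrt m + sk `^ p))%:E)%E.
Proof.
move=> p2; have q2 : 2 < twop p by rewrite /twop; lra.
have p0 : 0 < p by exact: lt_trans p2.
have p1 : 0 <= p - 1 by lra.
have p12 : (p - 1) / twop p = 2^-1 by rewrite /twop; field; rewrite gt_eqF//; lra.
have conj : (p - 1) / twop p + 2^-1 = 1 by rewrite p12; lra.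
apply: (le_trans (EE_psum_diff_le p2 q2 (lexx 2) conj)).
have sk0 : 0 < sk by exact: lt_le_trans sk1.
pose tau := Num.sqrt m + sk `^ (p - 1).
have tau0 : 0 < tau by rewrite ltr_wpDl ?sqrtr_ge0 ?powR_gt0.
have mB := measurable_psum_bound (twop p).
have tau2 : m + sk `^ twop p <= tau ^+ 2.
  rewrite /tau sqrrD sqr_sqrtr// -[X in _ + X <= _]addr0 addrA.
  have -> : sk `^ twop p = (sk `^ (p - 1)) ^+ 2.
    rewrite -powR_mulrn ?powR_ge0// -powRrM; congr (_ `^ _).
    by rewrite /twop; ring.
  rewrite addr0 lerD2r lerDl mulrn_wge0// mulr_ge0 ?sqrtr_ge0 ?powR_ge0//.
have C0 := moment_cst_ge0 p2.
have h : (EE P (fun w => psum_bound (twop p) w `^ ((p - 1) / twop p))%R <=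
    ((moment_cst p + 1) * tau)%:E)%E.
  apply: (@le_trans _ _ (EE P (fun w => tau^-1 * psum_bound (twop p) w + tau))).
    apply: EE_le.
    - exact: (measurableT_comp (measurable_powR _)).
    - by apply: measurable_funD => //; exact: measurable_funM.
    move=> w; rewrite powR_ge0 p12 andTb.
    have B0 := psum_bound_gt0 (twop p) w.
    rewrite powR12_sqrt; last exact: ltW.
    set B := psum_bound _ _ in B0 *.
    have t0 := sqrtr_ge0 B; have tB : Num.sqrt B ^+ 2 = B by rewrite sqr_sqrtr// ltW.
    rewrite -{2}tB; set t := Num.sqrt B in t0 *.
    rewrite -(ler_pM2l tau0) mulrDr mulrA divff ?gt_eqF// mul1r.
    have := sqr_ge0 (t - tau); have := sqr_ge0 t; have := sqr_ge0 tau; nra.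
  have ti : 0 <= tau^-1 by rewrite invr_ge0 ltW.
  have B0 w : 0 <= psum_bound (twop p) w by exact/ltW/psum_bound_gt0.
  rewrite EED//; last 3 first.
  - exact: measurable_funM.
  - by move=> w; rewrite mulr_ge0.
  - by move=> w; exact: ltW.
  rewrite EE_cst EEZ// (_ : (moment_cst p + 1) * tau = moment_cst p * tau + tau);
    last by ring.
  rewrite [leRHS]EFinD; apply: leeD2r.
  apply: (le_trans (lee_wpmul2l _ (EE_psum_bound_le p2))); first by rewrite lee_fin.
  rewrite -EFinM lee_fin mulrC ler_pdivrMr// -mulrA -expr2.
  exact: ler_wpM2l.
have K0 : 0 <= diff_cst p (twop p) * sk by rewrite mulr_ge0// ltW// diff_cst_gt0.
apply: (le_trans (lee_wpmul2l _ h)); first by rewrite lee_fin.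
rewrite -EFinM lee_fin /fluct_cst.
have -> : sk * Num.sqrt m + sk `^ p = sk * tau.
  by rewrite /tau mulrDr mulr_powRB1// ltW.
by rewrite le_eqVlt; apply/orP; left; apply/eqP; ring.
Qed.

Lemma psum_concentrated p : 2 < p -> exists w, forall x, x \in net ->
  `|psum c E p (X w) x - m * gam p * l2norm x `^ p| <=
    2 * (fluct_cst p * (sk * Num.sqrt m + sk `^ p)).
Proof.
move=> p2; have p0 : 0 < p by exact: lt_trans p2.
have sk0 : 0 < sk by exact: lt_le_trans sk1.
have Y0 x w : 0 <= psum c E p (X w) x by exact: psum_ge0.
have := EE_centered_le net (mY p) Y0 (fun x => EE_psum XP c0 E_iso x p0).
move=> /le_trans/(_ (EE_psum_diff_final p2)) h.
have mf : measurable_fun setT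
    (fun w => smax net (fun x => `|psum c E p (X w) x - m * gam p * l2norm x `^ p|)).
  apply: measurable_smax => x; apply: measurableT_comp => //.
  exact: measurable_funB.
have f0 w : 0 <= smax net (fun x => `|psum c E p (X w) x - m * gam p * l2norm x `^ p|).
  exact: smax_ge0.
have b0 : 0 < fluct_cst p * (sk * Num.sqrt m + sk `^ p).
  by rewrite mulr_gt0 ?fluct_cst_gt0// ltr_wpDl ?powR_gt0// mulr_ge0 ?sqrtr_ge0.
have [w wP] := EE_exists_le mf f0 b0 h.
exists w => x xn; apply: le_trans wP.
exact: (le_smax (fun x => `|psum c E p (X w) x - m * gam p * l2norm x `^ p|)).
Qed.

End random_power_sums.

(** * From the net to the whole sphere *)

Section almost_spherical.
Context {R : realType}.
Implicit Types (p e : R).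
Notation gam q := (fine (gauss_moment q)).

Lemma gauss_moment_fine_gt0 p : 0 < p -> 0 < gam p.
Proof.
move=> p0; rewrite -lte_fin -gauss_moment_fine//.
by apply: gauss_moment_gt0; exact: ltW.
Qed.

Section sphere.
Context {N k dim : nat}.
Variables (c : 'I_N -> R) (E : 'I_N -> 'M[R]_(k, dim)) (g : 'rV[R]_dim).
Hypothesis c0 : forall i, 0 <= c i.

Lemma normr_powRB_le p (a b : R) : 1 < p ->
  `| `|a| `^ p - `|b| `^ p| <= p * (`|a - b| * `|a| `^ (p - 1) + `|a - b| * `|b| `^ (p - 1)).
Proof.
move=> p1; have p0 : 0 <= p by lra.
have h (u v : R) : `|u| `^ p - `|v| `^ p <= p * (`|u - v| * `|u| `^ (p - 1)).
  have := normr_powR_tangent u v p1; rewrite -lerBrDl -lerN2 opprB.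
  move=> /(fun H => le_trans H _); apply.
  rewrite -mulrN opprB -mulrA ler_wpM2l// (le_trans (ler_norm _))//.
  by rewrite normrM normr_phi// mulrC.
rewrite ler_norml; apply/andP; split.
  rewrite lerNl opprB (le_trans (h b a))// distrC mulrDr lerDr.
  by rewrite mulr_ge0// mulr_ge0 ?powR_ge0.
by rewrite (le_trans (h a b))// mulrDr lerDl mulr_ge0// mulr_ge0 ?powR_ge0.
Qed.

(** A bound on the ball alone controls the oscillation, which carries estimates from a fine net to
    the sphere. The [6] is [3] from [young3], for each of the two endpoints. *)
Lemma psum_lipschitz p (B : R) x y : 2 < p -> 0 <= B ->
  (forall z, psum c E p g z <= B * l2norm z `^ p) ->
  l2norm x <= 1 -> l2norm y <= 1 ->
  `|psum c E p g x - psum c E p g y| <= 6 * p * B * l2norm (x - y).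
Proof.
move=> p2 B0 hB x1 y1; have p1 : 1 < p by lra.
have p0 : 0 < p by lra.
have [h0|h0] := eqVneq (l2norm (x - y)) 0.
  have -> : x = y by apply/eqP; rewrite -subr_eq0 (l2norm_eq0 h0).
  by rewrite subrr normr0 subrr l2norm0 mulr0.
have hp : 0 < l2norm (x - y) by rewrite lt_neqAle eq_sym h0 l2norm_ge0.
set d := l2norm (x - y) in hp *.
pose A i := `|lform E g i (x - y)| / d.
have SA : \sum_i c i * A i `^ p <= B.
  have -> : \sum_i c i * A i `^ p = psum c E p g (x - y) / d `^ p.
    rewrite /psum mulr_suml; apply: eq_bigr => i _.
    by rewrite /A powR_div// mulrA.
  by rewrite ler_pdivrMr ?powR_gt0//; exact: hB.
have conj : (p - 1) / p + p^-1 = 1 by field; rewrite gt_eqF.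
have one z : l2norm z <= 1 -> \sum_i c i * `|lform E g i z| `^ p <= B.
  move=> z1; apply: (le_trans (hB z)); rewrite ler_piMr//.
  by rewrite powR_le1 ?l2norm_ge0// ltW.
have term z : l2norm z <= 1 ->
    \sum_i c i * (`|lform E g i (x - y)| * `|lform E g i z| `^ (p - 1)) <= 3 * B * d.
  move=> z1.
  apply: (@le_trans _ _ (d * \sum_i c i * (2 * `|lform E g i z| `^ p + A i `^ p))).
    rewrite mulr_sumr; apply: ler_sum => i _; rewrite [leRHS]mulrCA.
    apply: ler_wpM2l => //.
    have -> : `|lform E g i (x - y)| = d * A i by rewrite /A mulrC divfK// gt_eqF.
    rewrite -mulrA ler_pM2l//.
    have Ai0 : 0 <= A i by rewrite /A divr_ge0// ltW.
    have := young3 p2 p0 p0 conj (normr_ge0 (lform E g i z)) (normr_ge0 (lform E g i z)) Ai0.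
    have -> : `|lform E g i z| * `|lform E g i z| `^ (p - 2) = `|lform E g i z| `^ (p - 1).
      by rewrite (_ : p - 2 = p - 1 - 1) ?mulr_powRB1 ?subr_gt0//; ring.
    by rewrite mulr_natl mulr2n mulrC.
  rewrite mulrC ler_pM2r//.
  have -> : \sum_i c i * (2 * `|lform E g i z| `^ p + A i `^ p) =
     2 * (\sum_i c i * `|lform E g i z| `^ p) + \sum_i c i * A i `^ p.
    by rewrite mulr_sumr -big_split/=; apply: eq_bigr => i _; ring.
  have := one z z1; lra.
apply: (@le_trans _ _ (p * (\sum_i c i * (`|lform E g i (x - y)| * `|lform E g i x| `^ (p - 1))
   + \sum_i c i * (`|lform E g i (x - y)| * `|lform E g i y| `^ (p - 1))))).
  rewrite /psum -sumrB (le_trans (ler_norm_sum _ _ _))//.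
  rewrite -big_split/= mulr_sumr; apply: ler_sum => i _.
  rewrite -mulrBr normrM ger0_norm// -mulrDr [leRHS]mulrCA; apply: ler_wpM2l => //.
  by rewrite lformB; exact: normr_powRB_le.
have -> : 6 * p * B * d = p * (3 * B * d + 3 * B * d) by ring.
by rewrite ler_pM2l// lerD// term.
Qed.

End sphere.

(** The [8] is the [2] lost in [psum_concentrated] times [4], so that deviations on the net use up a
    quarter of the tolerance; dividing by [gam p] expresses them relative to the mean
    [m * gam p]. *)
Definition embed_cst p : R := 8 * fluct_cst p / gam p.

Lemma embed_cst_gt0 p : 2 < p -> 0 < embed_cst p.
Proof.
move=> p2; apply: divr_gt0; first by apply: mulr_gt0 => //; exact: fluct_cst_gt0.
by apply: gauss_moment_fine_gt0; exact: lt_trans p2.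
Qed.

Lemma psum_almost_spherical p e (N k dim : nat) (c : 'I_N -> R)
    (E : 'I_N -> 'M[R]_(k, dim)) :
  2 < p -> 0 < e < 1 -> (0 < k)%N ->
  (forall i, 0 <= c i) -> 0 < \sum_i c i ->
  (forall i x, l2norm (x *m E i) = l2norm x) ->
  (forall x h, \sum_i c i * dot (x *m E i) h ^+ 2 <= l2norm x ^+ 2 * l2norm h ^+ 2) ->
  embed_cst p * (Num.sqrt k%:R * Num.sqrt (\sum_i c i) + Num.sqrt k%:R `^ p)
    <= e * \sum_i c i ->
  exists g, forall x,
    (1 - e) * ((\sum_i c i) * gam p) * l2norm x `^ p <= psum c E p g x
      <= (1 + e) * ((\sum_i c i) * gam p) * l2norm x `^ p.
Proof.
move=> p2 /andP[e0 e1] k0 c0; set m := \sum_i c i => m0 E_iso cE small.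
have p0 : 0 < p by exact: lt_trans p2.
have gp : 0 < gam p by exact: gauss_moment_fine_gt0.
set A := m * gam p; have A0 : 0 < A by rewrite mulr_gt0.
have [d [T [P [X XP]]]] := @gaussian_vector_exists R dim.
have /boolp.choice [S SP] : forall j, exists s : seq 'rV[R]_k,
    [/\ forall y, y \in s -> l2norm y <= 1, (size s <= 2 ^ (3 * k * 4 ^ j))%N
      & forall x, l2norm x <= 1 -> exists2 y, y \in s & l2norm (x - y) <= (4 ^ j)%:R^-1].
  by move=> j; apply: ball_net => //; rewrite expn_gt0.
have S_ball j y : y \in S j -> l2norm y <= 1 by have [+ _ _] := SP j; apply.
have S_size j : (size (S j) <= 2 ^ (3 * k * 4 ^ j))%N by have [] := SP j.
have S_net j x : l2norm x <= 1 -> exists2 y, y \in S j & l2norm (x - y) <= (4 ^ j)%:R^-1.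
  by have [_ _ +] := SP j; apply.
(* The Lipschitz constant of [Y] on the ball relative to [A], plus [p] for replacing [l2norm y ^ p]
   by [1] when the net point [y] is close to the sphere. *)
pose Q := 6 * p * (4 / 3 * 2 `^ p * 2) + p.
have Q0 : 0 < Q by rewrite ltr_wpDl// !mulr_ge0 ?powR_ge0// ltW.
have [J J1 JQ] : exists2 J, (0 < J)%N & Q * (4 ^ J)%:R^-1 <= e / 2.
  exists (Num.truncn (2 * Q / e)).+1 => //.
  rewrite ler_pdivrMr ?ltr0n ?expn_gt0// mulrC -ler_pdivrMr ?divr_gt0//.
  rewrite invf_div mulrA [Q * 2]mulrC (le_trans (ltW (truncnS_gt _)))//.
  by rewrite ler_nat ltnW// ltn_expl.
have [w wP] := psum_concentrated k0 XP c0 E_iso cE S_ball S_size S_net J1 p2.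
move: wP; set net := flatten _; rewrite -/m -/A => wP.
exists (X w); set Y := psum c E p (X w).
have dev : 2 * (fluct_cst p * (Num.sqrt k%:R * Num.sqrt m + Num.sqrt k%:R `^ p)) <= e / 4 * A.
  move: small; rewrite /embed_cst /A mulrAC ler_pdivrMr//.
  set V := _ + _; set f := fluct_cst p => small; lra.
have netP x : x \in net -> `|Y x - A * l2norm x `^ p| <= e / 4 * A.
  by move=> xn; apply: le_trans dev; exact: wP.
have net_ball x : x \in net -> l2norm x <= 1.
  by move=> /flatten_mapP[j _]; exact: S_ball.
have Sx j x : (j <= J)%N -> l2norm x <= 1 ->
    exists2 y, y \in net & l2norm (x - y) <= (4 ^ j)%:R^-1.
  move=> jJ /(S_net j)[y yS xy]; exists y => //.
  by apply/flatten_mapP; exists j => //; rewrite mem_iota.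
have supY : smax net Y <= 2 * A.
  apply: smax_le => [|x xn]; first by rewrite mulr_ge0// ltW.
  have := netP x xn; rewrite ler_norml => /andP[_].
  have : A * l2norm x `^ p <= A.
    by rewrite ler_piMr ?powR_le1 ?l2norm_ge0 ?net_ball// ltW.
  have : e / 4 * A <= A by rewrite ler_piMl ?(ltW A0)//; lra.
  lra.
have net4 x : l2norm x <= 1 -> exists2 y, y \in net & l2norm (x - y) <= 4^-1.
  by move=> x1; have [y yn] := Sx 1%N x J1 x1; rewrite expn1 => xy; exists y.
pose B := 4 / 3 * 2 `^ p * 2 * A.
have B0 : 0 <= B by rewrite !mulr_ge0 ?powR_ge0// ltW.
have YB x : Y x <= B * l2norm x `^ p.
  apply: (le_trans (psum_le_net c0 E_iso cE (X w) p2 net4 x)).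
  rewrite ler_wpM2r ?powR_ge0// /B -[leRHS]mulrA.
  by apply: ler_wpM2l supY; rewrite mulr_ge0 ?powR_ge0.
have unit x : l2norm x = 1 -> `|Y x - A| <= e * A.
  move=> x1; have xle1 : l2norm x <= 1 by rewrite x1.
  have [y yn xy] := Sx J x (leqnn _) xle1.
  have y1 := net_ball y yn; have ny0 := l2norm_ge0 y.
  have yl : 1 - (4 ^ J)%:R^-1 <= l2norm y.
    have := l2normD_le y (x - y); rewrite addrC subrK x1 => h.
    by rewrite lerBlDr (le_trans h)// lerD2l.
  have L := psum_lipschitz c0 p2 B0 YB xle1 y1.
  have yp : 1 - p * (4 ^ J)%:R^-1 <= l2norm y `^ p.
    apply: le_trans (powR_tangent (lt_trans _ p2) ler01 ny0); last by rewrite ltr1n.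
    rewrite !powR1 mulr1 lerD2l -mulrN ler_pM2l//; lra.
  have yp1 : l2norm y `^ p <= 1 by rewrite powR_le1// ltW.
  set dl := (4 ^ J)%:R^-1 in JQ xy yl yp.
  have h1 : `|Y x - Y y| <= 6 * p * B * dl.
    by rewrite (le_trans L)// ler_wpM2l// !mulr_ge0// ltW.
  have h2 := netP y yn.
  have h3 : `|A * l2norm y `^ p - A| <= A * (p * dl).
    rewrite distrC -{1}[A]mulr1 -mulrBr normrM (gtr0_norm A0) ler_pM2l//.
    by rewrite ger0_norm ?subr_ge0//; lra.
  have -> : Y x - A = (Y x - Y y) + (Y y - A * l2norm y `^ p) + (A * l2norm y `^ p - A).
    by ring.
  rewrite (le_trans (ler_normD _ _))//.
  rewrite (le_trans (lerD (le_trans (ler_normD _ _) (lerD h1 h2)) h3))//.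
  have -> : 6 * p * B * dl + e / 4 * A + A * (p * dl) = A * (Q * dl + e / 4).
    by rewrite /B /Q; ring.
  by rewrite mulrC ler_pM2r//; lra.
move=> x; have [x0|x0] := eqVneq (l2norm x) 0.
  rewrite (l2norm_eq0 x0) l2norm0 powR0 ?gt_eqF// !mulr0.
  rewrite /Y /psum big1 ?lexx// => i _.
  by rewrite /lform mul0mx dot0l normr0 powR0 ?mulr0// gt_eqF.
have xp : 0 < l2norm x by rewrite lt_neqAle eq_sym x0 l2norm_ge0.
have YE : Y x = l2norm x `^ p * Y ((l2norm x)^-1 *: x).
  rewrite /Y psumZ mulrA ger0_norm ?invr_ge0 1?ltW// -powRM ?invr_ge0 1?ltW//.
  by rewrite divff// powR1 mul1r.
have z1 : l2norm ((l2norm x)^-1 *: x) = 1.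
  by rewrite l2normZ gtr0_norm ?invr_gt0// mulVf.
have := unit _ z1; rewrite ler_norml => /andP[lo hi].
rewrite YE ![_ * _ `^ p]mulrC !ler_pM2l ?powR_gt0//.
by apply/andP; split; lra.
Qed.

End almost_spherical.

(** * A Lewis-type position *)

Section lewis.
Context {R : realType}.

(** One block matrix factored in two ways through block triangular ones. *)
Lemma det_1sub_rank1 n (a : R) (y : 'rV[R]_n) :
  \det (1%:M - a *: (y^T *m y)) = 1 - a * dot y y.
Proof.
have h : block_mx 1%:M (a *: y^T) 0 1%:M *m block_mx (1%:M - a *: (y^T *m y)) 0 y 1%:M
    = block_mx 1%:M 0 y 1%:M *m block_mx 1%:M (a *: y^T) 0 (1%:M - a *: (y *m y^T)).
  rewrite !mulmx_block !mul1mx !mul0mx !mulmx1 !addr0 !add0r ?mulmx0.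
  by rewrite -scalemxAl -scalemxAr subrK addrC subrK.
move/(congr1 (@determinant _ _)): h.
rewrite !det_mulmx det_ublock !det_lblock det_ublock !det1 !mul1r !mulr1 => ->.
by rewrite det_mx11 !mxE eqxx -[dot y y]/((y *m y^T) 0 0) !mxE.
Qed.

Variables (p : R) (n N : nat) (w : 'I_N -> R) (s : 'I_N -> 'rV[R]_n) (kappa : R).
Hypotheses (p2 : 2 < p) (n0 : (0 < n)%N) (w0 : forall i, 0 <= w i) (kappa0 : 0 < kappa).
Hypothesis skappa : forall a, kappa * l2norm a `^ p <= \sum_i w i * `|dot a (s i)| `^ p.

(** The constraint of the extremal problem: [|det B|] is nearly maximised subject to
    [pmass B <= 1]. *)
Definition pmass (B : 'M[R]_n) : R := \sum_i w i * l2norm (s i *m B) `^ p.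

Lemma pmass_ge0 B : 0 <= pmass B.
Proof. by apply: sumr_ge0 => i _; rewrite mulr_ge0// powR_ge0. Qed.

Lemma pmassZ t B : 0 <= t -> pmass (t *: B) = t `^ p * pmass B.
Proof.
move=> t0; rewrite /pmass mulr_sumr; apply: eq_bigr => i _.
by rewrite -scalemxAr l2normZ ger0_norm// powRM ?l2norm_ge0// mulrCA.
Qed.

(** [skappa] applied to the columns of [B] makes the constraint set bounded, so that the
    determinants have a finite supremum. *)
Lemma mx_coord_le_pmass B i j : pmass B <= 1 -> `|B i j| <= kappa^-1 `^ p^-1.
Proof.
move=> B1; have p0 : 0 < p by apply: lt_trans p2.
pose b := (col j B)^T.
have -> : B i j = b 0 i by rewrite !mxE.
apply: (le_trans (normr_coord_le _ _)).
have : l2norm b `^ p <= kappa^-1.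
  rewrite -(ler_pM2l kappa0) mulfV ?gt_eqF//.
  apply: (le_trans (skappa b)); apply: (le_trans _ B1).
  apply: ler_sum => l _; apply: ler_wpM2l => //.
  apply: ge0_ler_powR; rewrite ?nnegrE ?normr_ge0 ?l2norm_ge0 ?(ltW p0)//.
  suff -> : dot b (s l) = (s l *m B) 0 j by exact: normr_coord_le.
  by rewrite dotC dotE mxE; apply: eq_bigr => q _; rewrite !mxE.
move=> h; rewrite -[leLHS](@powRr1 R) ?l2norm_ge0// -(@mulfV _ p) ?gt_eqF// powRrM.
by apply: ge0_ler_powR; rewrite ?nnegrE ?powR_ge0 ?invr_ge0 ?(ltW p0) ?(ltW kappa0).
Qed.

Lemma det_bounded_pmass : exists M, forall B, pmass B <= 1 -> `|\det B| <= M.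
Proof.
eexists => B B1; rewrite /determinant; apply: (le_trans (ler_norm_sum _ _ _)).
apply: ler_sum => t _; rewrite normrM normrX normrN1 expr1n mul1r normr_prod.
have h : \prod_i `|B i (t i)| <= \prod_(i : 'I_n) (kappa^-1 `^ p^-1); last exact: h.
by apply: ler_prod => i _; rewrite normr_ge0 mx_coord_le_pmass.
Qed.

(** A matrix reaching [3/4] of the supremum is rescaled to [pmass = 1], which does not decrease its
    determinant. Its [pmass] is not [0]: otherwise its double would be admissible, with a
    determinant beyond the supremum. *)
Lemma exists_near_max_det : exists B, [/\ pmass B = 1, 0 < `|\det B| &
  forall B', pmass B' <= 1 -> `|\det B'| <= 4 / 3 * `|\det B|].
Proof.
have p0 : 0 < p by apply: lt_trans p2.
pose D : set R := [set r | exists2 B, pmass B <= 1 & r = `|\det B|].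
have hD : has_sup D.
  split; first by exists `|\det (0 : 'M[R]_n)|; exists 0 => //; rewrite -(scale0r 0) pmassZ// powR0 ?gt_eqF// mul0r.
  by have [M hM] := det_bounded_pmass; exists M => _ [B B1 ->]; exact: hM.
have Dle B : pmass B <= 1 -> `|\det B| <= sup D.
  by move=> B1; apply: ub_le_sup; [exact: hD.2|exists B].
have sD0 : 0 < sup D.
  pose t := (1 + pmass 1%:M)^-1 `^ p^-1.
  have M0 := pmass_ge0 1%:M.
  have t0 : 0 < t by rewrite powR_gt0// invr_gt0 ltr_pwDl.
  apply: (lt_le_trans _ (Dle (t *: 1%:M) _)).
    by rewrite detZ det1 mulr1 normr_gt0 expf_neq0// gt_eqF.
  have M1 : 0 < 1 + pmass 1%:M by apply: ltr_pwDl.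
  rewrite pmassZ ?(ltW t0)// /t -powRrM mulVf ?gt_eqF// powRr1 ?invr_ge0 ?(ltW M1)//.
  by rewrite mulrC ler_pdivrMr// mul1r lerDr ler01.
have D4 : 0 < sup D / 4 by rewrite divr_gt0.
have [_ [B B1 ->] hB] := sup_adherent D4 hD.
have {hB}hB : 3 / 4 * sup D < `|\det B| by move: hB; set z := sup D => hB; lra.
have dB0 : 0 < `|\det B| by apply: lt_trans hB; rewrite mulr_gt0.
have scale_le t : 1 <= t -> pmass (t *: B) <= 1 -> t ^+ n <= 4 / 3.
  move=> t1 /Dle; rewrite detZ normrM normrX (ger0_norm (_ : 0 <= t)); last lra.
  move=> h; rewrite -(ler_pM2r dB0); lra.
have mB0 : 0 < pmass B.
  rewrite lt_neqAle pmass_ge0 andbT eq_sym; apply/negP => /eqP m0.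
  have h := @scale_le 2 _ _; move: h; rewrite pmassZ// m0 mulr0 => h.
  have h2 : (2 : R) ^+ 1 <= 2 ^+ n by apply: ler_weXn2l => //; lra.
  have : (2 : R) ^+ n <= 4 / 3 by apply: h => //; lra.
  rewrite expr1 in h2; lra.
pose t := (pmass B)^-1 `^ p^-1.
have t1 : 1 <= t by apply: powR_ge1; [rewrite invf_ge1|rewrite invr_ge0 ltW].
have t0 : 0 <= t by lra.
have tB : pmass (t *: B) = 1.
  by rewrite pmassZ// -powRrM mulVf ?gt_eqF// powRr1 ?invr_ge0 ?ltW// mulVf// gt_eqF.
have dle : `|\det B| <= `|\det (t *: B)|.
  by rewrite detZ normrM normrX (ger0_norm t0) ler_peMl// exprn_ege1.
exists (t *: B); split=> //; first exact: lt_le_trans dle.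
move=> B' /Dle h; apply: (le_trans h); rewrite -ler_pdivrMl// invf_div.
exact/ltW/(lt_le_trans hB).
Qed.

(** The matrix halves the component along [y], so a unit vector [u] gets squared norm
    [1 - 3/4 <u, y>^2 <= 1], and raising this to the power [p / 2 >= 1] does not increase it. *)
Lemma l2norm_squeeze (v y : 'rV[R]_n) (u : 'rV[R]_n) : dot y y = 1 ->
  v = l2norm v *: u -> dot u u = 1 ->
  l2norm (v *m (1%:M - 2^-1 *: (y^T *m y))) `^ p
    <= l2norm v `^ p * (1 - 3 / 4 * dot u y ^+ 2).
Proof.
move=> y1 vu u1; have v0 := l2norm_ge0 v; set l := l2norm v in vu v0 *.
have -> : v *m (1%:M - 2^-1 *: (y^T *m y)) = l *: (u - (2^-1 * dot u y) *: y).
  rewrite mulmxBr mulmx1 -scalemxAr mulmxA.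
  have -> : v *m y^T = (l * dot u y)%:M.
    by rewrite [LHS]mx11_scalar vu -/(dot _ _) dotZl.
  rewrite mul_scalar_mx {1}vu scalerBr !scalerA; congr (_ - _ *: _); ring.
rewrite l2normZ ger0_norm// powRM ?l2norm_ge0//.
apply: ler_wpM2l; first exact: powR_ge0.
set z := dot u y; have z1 : z ^+ 2 <= 1.
  have := normr_dot_le u y; rewrite !l2normE u1 y1 !sqrtr1 mulr1 => h.
  by rewrite -[z ^+ 2]real_normK ?num_real// expr_le1.
have q0 : 0 <= 1 - 3 / 4 * z ^+ 2 by lra.
have -> : l2norm (u - (2^-1 * z) *: y) = (1 - 3 / 4 * z ^+ 2) `^ 2^-1.
  rewrite powR12_sqrt// l2normE; congr Num.sqrt.
  rewrite dotBl !(dotC _ (u - _)) !dotBl !dotZl !(dotC _ (_ *: _)) !dotZl u1 y1 (dotC y) -/z.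
  by field.
rewrite -powRrM.
have z2 : 0 <= z ^+ 2 by exact: sqr_ge0.
set q := 1 - _ in q0 *.
have [->|qn0] := eqVneq q 0; first by rewrite powR0 ?lexx// gt_eqF// mulr_gt0// (lt_trans _ p2).
have -> : 2^-1 * p = 1 + (p / 2 - 1) by field.
rewrite powRD ?qn0 ?implybT// powRr1//.
apply: ler_piMr => //; apply: powR_le1 => //; last by rewrite subr_ge0 ler_pdivlMr// mul1r ltW.
by rewrite /q lerBlDr lerDl mulr_ge0.
Qed.

End lewis.

Section lewis_position.
Context {R : realType}.

(* Otherwise halving [B] along [y] and dilating by [exp (2 / n)] would increase
   the determinant by a factor larger than [4 / 3]. *)
Lemma lewis_isotropy (p : R) n N (w : 'I_N -> R) (s u : 'I_N -> 'rV[R]_n)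
    (B : 'M[R]_n) y : 2 < p -> (0 < n)%N -> (forall i, 0 <= w i) ->
  pmass p w s B = 1 -> 0 < `|\det B| ->
  (forall B', pmass p w s B' <= 1 -> `|\det B'| <= 4 / 3 * `|\det B|) ->
  (forall i, dot (u i) (u i) = 1) ->
  (forall i, s i *m B = l2norm (s i *m B) *: u i) ->
  dot y y = 1 ->
  \sum_i w i * l2norm (s i *m B) `^ p * dot (u i) y ^+ 2 <= 3 * p / n%:R.
Proof.
move=> p2 n0 w0 B1 dB0 Bmax u1 su y1; rewrite leNgt; apply/negP => h.
have p0 : 0 < p by apply: lt_trans p2.
have nR0 : 0 < n%:R :> R by rewrite ltr0n.
(* After the halving the determinant still gains [e^2 / 2 >= 3/2 > 4/3]. The dilation multiplies
   [pmass] by [exp (2p / n)], and if the claim fails the halving has reduced it to at most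
   [1 - 9p / (4n) <= exp (- 9p / (4n))]. *)
pose t := expR (2 / n%:R) : R.
have tn : t ^+ n = expR 2 by rewrite -expRM_natl mulrC divfK// gt_eqF.
have tp : t `^ p = expR (2 * (p / n%:R)).
  by rewrite /powR gt_eqF ?expR_gt0// expRK; congr expR; ring.
have q0 : 0 < p / n%:R by rewrite divr_gt0.
pose B' := B *m (1%:M - 2^-1 *: (y^T *m y)).
have mB' : pmass p w s B' <= 1 - 9 / 4 * (p / n%:R).
  apply: (@le_trans _ _ (1 - 3 / 4 * \sum_i w i * l2norm (s i *m B) `^ p * dot (u i) y ^+ 2)).
    rewrite -[X in _ <= X - _]B1 /pmass mulr_sumr -sumrB; apply: ler_sum => i _.
    rewrite mulmxA; apply: (le_trans (ler_wpM2l (w0 i) (l2norm_squeeze p2 y1 (su i) (u1 i)))).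
    by rewrite le_eqVlt; apply/orP; left; apply/eqP; ring.
  move: h; set S := \sum_i _; rewrite -mulrA; set q := p / _; lra.
have : `|\det (t *: B')| <= 4 / 3 * `|\det B|.
  apply: Bmax; rewrite pmassZ ?expR_ge0// tp.
  apply: (le_trans (ler_wpM2l (expR_ge0 _) mB')).
  apply: (@le_trans _ _ (expR (2 * (p / n%:R)) * expR (- (9 / 4 * (p / n%:R))))).
    by apply: ler_wpM2l; [exact: expR_ge0|exact: expR_ge1Dx].
  by rewrite -expRD -[leRHS]expR0 ler_expR; clear -q0; lra.
rewrite detZ tn det_mulmx det_1sub_rank1 y1 !normrM (ger0_norm (expR_ge0 _)).
rewrite (_ : `|1 - 2^-1 * 1| = 2^-1 :> R); last by clear; rewrite ger0_norm; lra.
have := expR_ge1Dx (2 : R).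
set a := expR 2; set D := `|_| in dB0 *; clearbody a D => a3 h2; clear -dB0 a3 h2.
have : 3 * (D * 2^-1) <= a * (D * 2^-1) by apply: ler_wpM2r; lra.
lra.
Qed.

(** The [u i] are the directions of the [s i *m B], and the [c i] are the terms of [pmass B = 1]
    multiplied by [n / (3p)], which turns the constant [3p / n] of [lewis_isotropy] into [1]. *)
Lemma lewis_position (p : R) n N (w : 'I_N -> R) (s : 'I_N -> 'rV[R]_n) kappa :
  2 < p -> (0 < n)%N -> (forall i, 0 <= w i) -> 0 < kappa ->
  (forall a, kappa * l2norm a `^ p <= \sum_i w i * `|dot a (s i)| `^ p) ->
  exists (B : 'M[R]_n) (u : 'I_N -> 'rV[R]_n) (c : 'I_N -> R),
  [/\ forall i, 0 <= c i, \sum_i c i = n%:R / (3 * p),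
      forall i, dot (u i) (u i) = 1,
      forall y, \sum_i c i * dot (u i) y ^+ 2 <= dot y y &
      forall y, \sum_i c i * `|dot (u i) y| `^ p
        = n%:R / (3 * p) * \sum_i w i * `|dot (y *m B^T) (s i)| `^ p].
Proof.
move=> p2 n0 w0 kappa0 skappa.
have p0 : 0 < p by apply: lt_trans p2.
have nR0 : 0 < n%:R :> R by rewrite ltr0n.
have m0 : 0 < n%:R / (3 * p) by rewrite divr_gt0// mulr_gt0.
have [B [B1 dB0 Bmax]] := exists_near_max_det p2 n0 w0 kappa0 skappa.
pose l i := l2norm (s i *m B).
have l0 i : 0 <= l i by exact: l2norm_ge0.
(* Where [s i *m B = 0] any unit vector serves, since the weight [c i] is then [0]. *)
pose u i := if l i == 0 then delta_mx 0 (Ordinal n0) else (l i)^-1 *: (s i *m B) : 'rV[R]_n.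
have u1 i : dot (u i) (u i) = 1.
  rewrite /u; case: eqP => [_|/eqP li].
    rewrite dotE (bigD1 (Ordinal n0))//= big1 => [|j jn]; rewrite !mxE ?eqxx ?mulr1 ?addr0//.
    by rewrite (negbTE jn) mulr0.
  by rewrite dotZl dotZr -l2norm_sqr -/(l i); field.
have su i : s i *m B = l i *: u i.
  rewrite /u; case: eqP => [li|/eqP li]; last by rewrite scalerA mulfV// scale1r.
  by rewrite li scale0r; apply: l2norm_eq0.
exists B, u, (fun i => n%:R / (3 * p) * (w i * l i `^ p)); split => //.
- by move=> i; rewrite mulr_ge0 ?(ltW m0)// mulr_ge0 ?powR_ge0.
- by rewrite -mulr_sumr -[X in _ * X]/(pmass p w s B) B1 mulr1.
- move=> y; have [->|y0] := eqVneq y 0.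
    by rewrite dot0l big1// => i _; rewrite dotC dot0l expr0n mulr0.
  have ly : 0 < l2norm y.
    rewrite lt_neqAle l2norm_ge0 andbT eq_sym.
    by apply: contra y0 => /eqP /l2norm_eq0 ->.
  have ysq := l2norm_sqr y; have hy : dot ((l2norm y)^-1 *: y) ((l2norm y)^-1 *: y) = 1.
    by rewrite dotZl dotZr -ysq; field; rewrite gt_eqF.
  have := lewis_isotropy p2 n0 w0 B1 dB0 Bmax u1 su hy.
  under eq_bigr do rewrite dotZr exprMn mulrCA.
  rewrite -mulr_sumr => h.
  rewrite [leLHS](_ : _ = n%:R / (3 * p) * \sum_i w i * l i `^ p * dot (u i) y ^+ 2); last first.
    by rewrite mulr_sumr; apply: eq_bigr => i _; rewrite !mulrA.
  rewrite -ysq -ler_pdivlMl// invf_div.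
  by move: h; rewrite exprVn -[_^-1 * _]mulrC ler_pdivrMr ?exprn_gt0.
- move=> y; rewrite mulr_sumr; apply: eq_bigr => i _.
  rewrite /= -[LHS]mulrA; congr (_ * _); rewrite -[LHS]mulrA; congr (_ * _).
  rewrite -powRM// -{1}(ger0_norm (l0 i)) -normrM -dotZl -su.
  by rewrite [in RHS]dotC /dot trmx_mul trmxK mulmxA.
Qed.

(** The matrix of [x |-> x^T u] with values flattened to rows: a [k] by [n] Gaussian matrix can thus
    be treated as one Gaussian row vector of length [k * n]. *)
Definition outer_mx k n (u : 'rV[R]_n) : 'M[R]_(k, k * n) :=
  lin1_mx (mxvec \o (mulmxr u \o trmx)).

Lemma mul_outer_mx k n (u : 'rV[R]_n) (x : 'rV[R]_k) :
  x *m outer_mx k u = mxvec (x^T *m u).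
Proof. by rewrite mul_rV_lin1. Qed.

Lemma dot_outer_mx k n (u : 'rV[R]_n) (x : 'rV[R]_k) (H : 'M[R]_(k, n)) :
  dot (x *m outer_mx k u) (mxvec H) = dot (x *m H) u.
Proof. by rewrite mul_outer_mx /dot mxvec_dotmul. Qed.

Lemma dotxx_outer_mx k n (u : 'rV[R]_n) (x : 'rV[R]_k) :
  dot (x *m outer_mx k u) (x *m outer_mx k u) = dot x x * dot u u.
Proof.
rewrite {2}mul_outer_mx dot_outer_mx mulmxA.
have -> : x *m x^T = (dot x x)%:M by rewrite [LHS]mx11_scalar.
by rewrite mul_scalar_mx dotZl.
Qed.

Lemma l2norm_mulmx_le k n (x : 'rV[R]_k) (H : 'M[R]_(k, n)) :
  l2norm (x *m H) <= l2norm x * l2norm (mxvec H).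
Proof.
apply: l2norm_le_dot => [|b]; first by rewrite mulr_ge0 ?l2norm_ge0.
rewrite -dot_outer_mx; apply: (le_trans (dot_le _ _)).
rewrite [l2norm (_ *m _)]l2normE dotxx_outer_mx// sqrtrM ?dotxx_ge0// -!l2normE.
by rewrite mulrAC.
Qed.

Lemma almost_spherical_section (p e : R) n N k (w : 'I_N -> R)
    (s : 'I_N -> 'rV[R]_n) kappa :
  2 < p -> 0 < e < 1 -> (0 < n)%N -> (0 < k)%N -> (forall i, 0 <= w i) -> 0 < kappa ->
  (forall a, kappa * l2norm a `^ p <= \sum_i w i * `|dot a (s i)| `^ p) ->
  embed_cst p * (Num.sqrt k%:R * Num.sqrt (n%:R / (3 * p)) + Num.sqrt k%:R `^ p)
    <= e * (n%:R / (3 * p)) ->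
  exists A : 'M[R]_(k, n), forall x,
    (1 - e) * fine (gauss_moment p) * l2norm x `^ p
      <= \sum_i w i * `|dot (x *m A) (s i)| `^ p
      <= (1 + e) * fine (gauss_moment p) * l2norm x `^ p.
Proof.
move=> p2 e01 n0 k0 w0 kappa0 skappa.
have p0 : 0 < p by apply: lt_trans p2.
have m0 : 0 < n%:R / (3 * p) :> R by rewrite divr_gt0 ?ltr0n// mulr_gt0.
have [B [u [c [c0 cm u1 cu cw]]]] := lewis_position p2 n0 w0 kappa0 skappa.
rewrite -cm in m0 cw * => hk.
have [||g hg] := psum_almost_spherical p2 e01 k0 c0 m0 _ _ hk (E := fun i => outer_mx k (u i)).
- by move=> i x; rewrite !l2normE /= (dotxx_outer_mx (u i)) u1 mulr1.
- move=> x h; rewrite -(vec_mxK h); set H := vec_mx h.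
  under eq_bigr do rewrite dot_outer_mx dotC.
  apply: (le_trans (cu _)); rewrite -l2norm_sqr -exprMn.
  by rewrite ler_pXn2r// ?nnegrE ?mulr_ge0 ?l2norm_ge0// l2norm_mulmx_le.
(* The sampled matrix, brought back from the coordinates of the Lewis position. *)
exists (vec_mx g *m B^T) => x; have := hg x.
have -> : psum c (fun i => outer_mx k (u i)) p g x
    = (\sum_i c i) * \sum_i w i * `|dot (x *m (vec_mx g *m B^T)) (s i)| `^ p.
  rewrite mulmxA -cw; apply: eq_bigr => i _.
  by rewrite /lform -[in LHS](vec_mxK g) dot_outer_mx dotC.
move: m0; set m := \sum_i c i; clearbody m => m0.
rewrite ![_ * (m * _)]mulrCA -!mulrA !ler_pM2l//.
Qed.

End lewis_position.

(** * Discretisation of L_p *)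

Section simple_approximation.
Import HBNNSimple HBSimple.
Context d (T : measurableType d) {R : realType} (mu : {measure set T -> \bar R}).

Lemma funrposneg_approx_le (t a b : R) : 0 <= a <= Num.max t 0 -> 0 <= b <= Num.max (- t) 0 ->
  `|t - (a - b)| <= `|t|.
Proof.
move=> /andP[a0]; rewrite le_max => ha /andP[b0]; rewrite le_max => hb.
have [t0|t0] := leP 0 t.
  have b00 : b = 0 by move: hb => /orP[] ?; lra.
  have at' : a <= t by move: ha => /orP[] ?; lra.
  by rewrite b00 !ger0_norm; lra.
have a00 : a = 0 by move: ha => /orP[] ?; lra.
have bt : b <= - t by move: hb => /orP[] ?; lra.
rewrite a00 !ler0_norm; lra.
Qed.

(** Approximating the positive and negative parts from below keeps the error under [|f|], so
    dominated convergence applies to its [p]-th power. *)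
Lemma simple_approx_powR (p : R) (f : T -> R) (eta : R) : 0 < p ->
  measurable_fun setT f -> (\int[mu]_x (`|f x| `^ p)%:E < +oo)%E -> 0 < eta ->
  exists (g : T -> R) (s : seq R), [/\ measurable_fun setT g, forall x, g x \in s &
    (\int[mu]_x (`|f x - g x| `^ p)%:E < eta%:E)%E].
Proof.
move=> p0 mf fp eta0.
have mfp : measurable_fun setT (EFin \o f^\+) by apply/measurable_EFinP; exact: measurable_funrpos.
have mfn : measurable_fun setT (EFin \o f^\-) by apply/measurable_EFinP; exact: measurable_funrneg.
have fp0 x : setT x -> (0 <= (EFin \o f^\+%R) x)%E by move=> _; rewrite lee_fin funrpos_ge0.
have fn0 x : setT x -> (0 <= (EFin \o f^\-%R) x)%E by move=> _; rewrite lee_fin funrneg_ge0.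
pose hp k : T -> R := nnsfun_approx measurableT mfp k.
pose hn k : T -> R := nnsfun_approx measurableT mfn k.
pose g k x := hp k x - hn k x.
have mg k : measurable_fun setT (g k) by apply: measurable_funB; exact: measurable_funPT.
have gs k : exists s : seq R, forall x, g k x \in s.
  have /finite_seqP[r hr] := fimfunP (nnsfun_approx measurableT mfp k).
  have /finite_seqP[r' hr'] := fimfunP (nnsfun_approx measurableT mfn k).
  exists [seq a - b | a <- r, b <- r'] => x; apply: allpairs_f.
    by have : [set` r] (hp k x) by rewrite -hr; exists x.
  by have : [set` r'] (hn k x) by rewrite -hr'; exists x.
have mfgp k : measurable_fun setT (fun x => `|f x - g k x| `^ p).
  by apply: measurable_normr_powR; exact: measurable_funB.
have gle k x : `|f x - g k x| <= `|f x|.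
  apply: funrposneg_approx_le; apply/andP; split.
  - by rewrite /hp; exact: fun_ge0.
  - by rewrite /hp nnsfun_approxE -lee_fin; exact: (le_approx k fp0).
  - by rewrite /hn; exact: fun_ge0.
  - by rewrite /hn nnsfun_approxE -lee_fin; exact: (le_approx k fn0).
have mfpow : measurable_fun setT (fun x => `|f x| `^ p) by exact: measurable_normr_powR.
have ifp : mu.-integrable setT (fun x => (`|f x| `^ p)%:E).
  apply/integrableP; split; first exact/measurable_EFinP.
  by under eq_integral do rewrite gee0_abs ?lee_fin ?powR_ge0//.
have fgle k x : (`|(`|f x - g k x| `^ p)%:E| <= (`|f x| `^ p)%:E)%E.
  rewrite gee0_abs ?lee_fin ?powR_ge0//.
  by apply: ge0_ler_powR; rewrite ?nnegrE ?(ltW p0).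
have cv x : (`|f x - g k x| `^ p)%:E @[k --> \oo] --> 0%E.
  have cvp : hp k x @[k --> \oo] --> f^\+ x.
    rewrite /hp; under eq_fun do rewrite nnsfun_approxE.
    by apply: (cvg_approx fp0) => //; exact: ltry.
  have cvn : hn k x @[k --> \oo] --> f^\- x.
    rewrite /hn; under eq_fun do rewrite nnsfun_approxE.
    by apply: (cvg_approx fn0) => //; exact: ltry.
  apply: cvg_EFin; first by near=> k.
  have -> : fine \o (fun k => (`|f x - g k x| `^ p)%:E) = (fun k => `|f x - g k x| `^ p) by [].
  apply/cvgrPdist_lt => e e0; rewrite /=.
  have e0p : 0 < e `^ p^-1 by exact: powR_gt0.
  have cvg : g k x @[k --> \oo] --> f x.
    by rewrite -(funrposBneg f); exact: cvgB.
  move/cvgrPdist_lt : cvg => /(_ _ e0p); apply: filterS => k hk.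
  rewrite sub0r normrN ger0_norm ?powR_ge0//.
  rewrite -[ltRHS](@powRr1 R) ?ltW// -(@mulVf _ p) ?gt_eqF// powRrM.
  by apply: gt0_ltr_powR; rewrite ?nnegrE ?powR_ge0.
have [_ _] := @dominated_convergence _ _ _ mu setT measurableT
  (fun k x => (`|f x - g k x| `^ p)%:E) (cst 0%E) (fun x => (`|f x| `^ p)%:E)
  (fun k => proj2 (measurable_EFinP _ _) (mfgp k)) (measurable_cst _)
  (aeW mu (fun x _ => cv x)) ifp
  (aeW mu (fun x k _ => fgle k x)).
rewrite integral0 => /fine_cvgP[hfin /cvgrPdist_lt /(_ _ eta0) hlt].
have [k [kfin klt]] := filter_ex (filterI hfin hlt).
have [s hs] := gs k; exists (g k), s; split => //.
move: kfin klt; rewrite /= sub0r normrN => kfin klt.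
by rewrite -(fineK kfin) lte_fin; move: klt; exact/le_lt_trans/ler_norm.
Unshelve. all: by end_near.
Qed.

(** The [g i] are jointly constant on the level sets [A l], which are indexed by the possible
    vectors of values; the weights are the measures of these sets. *)
Lemma integral_finite_values (p : R) n (g : 'I_n -> T -> R) (s : seq R) : 0 < p ->
  (forall i, measurable_fun setT (g i)) -> (forall i x, g i x \in s) ->
  (forall a : 'rV[R]_n, \int[mu]_x (`|\sum_i a 0 i * g i x| `^ p)%:E < +oo)%E ->
  exists (N : nat) (w : 'I_N -> R) (v : 'I_N -> 'rV[R]_n), (forall l, 0 <= w l) /\
    forall a : 'rV[R]_n, (\int[mu]_x (`|\sum_i a 0 i * g i x| `^ p)%:E
      = (\sum_l w l * `|dot a (v l)| `^ p)%:E)%E.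
Proof.
move=> p0 mg gs fin.
pose I := {ffun 'I_n -> seq_sub s}.
pose vec (l : I) : 'rV[R]_n := \row_i ssval (l i).
pose A (l : I) : set T := \bigcap_(i in [set: 'I_n]) (g i @^-1` [set ssval (l i)]).
have mA l : measurable (A l).
  apply: fin_bigcap_measurable => // i _; rewrite -[X in measurable X]setTI.
  exact: mg.
have Aval (a : 'rV[R]_n) l x : A l x -> \sum_i a 0 i * g i x = dot a (vec l).
  by move=> Ax; rewrite dotE; apply: eq_bigr => i _; rewrite mxE (Ax i).
have sumA (a : 'rV[R]_n) x : (`|\sum_i a 0 i * g i x| `^ p)%:E
    = (\sum_(l : I) (`|dot a (vec l)| `^ p)%:E * (\1_(A l) x)%:E)%E.
  pose lx : I := [ffun i => SeqSub (gs i x)].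
  have Ax : A lx x by move=> i _; rewrite /= ffunE.
  rewrite [RHS](bigD1 lx)//= [X in (_ + X)%E]big1 ?adde0 => [|l ll].
    by rewrite indicE mem_set// mule1 (Aval _ lx).
  rewrite indicE memNset ?mule0// => Alx; case/eqP: ll.
  by apply/ffunP => i; apply: val_inj; rewrite /= ffunE /=; exact/esym/(Alx i).
(* [fine +oo = 0]: by integrability of every combination, a level set of infinite
   measure only carries a vector [vec l] that vanishes. *)
pose w (l : I) : R := fine (mu (A l)).
have mD (c : R) l : measurable_fun setT (fun x => c%:E * (\1_(A l) x)%:E)%E.
  by apply: measurable_funeM; apply/measurable_EFinP; exact: measurable_indic.
have term (a : 'rV[R]_n) l : (\int[mu]_x ((`|dot a (vec l)| `^ p)%:E * (\1_(A l) x)%:E)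
    = (w l * `|dot a (vec l)| `^ p)%:E)%E.
  have tfin : ((`|dot a (vec l)| `^ p)%:E * mu (A l) < +oo)%E.
    rewrite -(setIT (A l)) -integral_indic// -ge0_integralZl_EFin ?powR_ge0//; last first.
      by apply/measurable_EFinP; exact: measurable_indic.
    apply: le_lt_trans (fin a); apply: ge0_le_integral => //.
    - apply/measurable_EFinP; apply: measurable_normr_powR.
      by apply: measurable_sum => i; exact: measurable_funM.
    - move=> x _; rewrite indicE; have [/set_mem Ax|_] := boolP (x \in A l).
        by rewrite mule1 (Aval _ l).
      by rewrite mule0 lee_fin powR_ge0.
  rewrite ge0_integralZl_EFin ?powR_ge0//; last first.
    by apply/measurable_EFinP; exact: measurable_indic.
  rewrite integral_indic// setIT EFinM muleC.
  have [muA|muA] := boolP (mu (A l) \is a fin_num); first by rewrite /w fineK.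
  have [->|D0] := eqVneq (`|dot a (vec l)| `^ p) 0; first by rewrite !mule0.
  have muy : mu (A l) = +oo%E by apply/eqP; move: muA; rewrite ge0_fin_numE// ltey negbK.
  by move: tfin; rewrite muy mulry gtr0_sg ?mul1e// lt_neqAle eq_sym D0 powR_ge0.
exists #|I|, (fun l => w (enum_val l)), (fun l => vec (enum_val l)).
split=> [l|a]; first by rewrite fine_ge0.
rewrite [RHS](_ : _ = \sum_(l : I) (w l * `|dot a (vec l)| `^ p)%:E)%E; last first.
  by rewrite sumEFin [in RHS](reindex (@enum_val I predT))//; exact: onW_bij (enum_val_bij I).
under eq_integral do rewrite sumA.
rewrite ge0_integral_sum//; first by apply: eq_bigr => l _; exact: term.
Qed.

End simple_approximation.

Lemma ler_powR_inv {R : realType} (p x y : R) : 0 < p -> 0 <= x -> 0 <= y ->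
  x `^ p <= y `^ p -> x <= y.
Proof.
move=> p0 x0 y0; rewrite !leNgt; apply: contra => yx.
by apply: gt0_ltr_powR; rewrite ?nnegrE.
Qed.

Section Lspace_discretization.
Context d (T : measurableType d) {R : realType} (mu : {measure set T -> \bar R}).
Context (p : R) (p1 : (1 <= p%:E)%E).
Local Notation L := (LspaceType mu p1).
Local Notation F := (LfunType mu p1).

Let p0 : 0 < p.
Proof. by apply: lt_le_trans ltr01 _; rewrite -lee_fin. Qed.

Lemma Lclass_normE (f : F) :
  (`|Lclass f| `^ p)%:E = (\int[mu]_x (`|(f : T -> R) x| `^ p)%:E)%E.
Proof.
have -> : `|Lclass f| = fine (Lnorm mu p%:E (EFin \o (f : T -> R))).
  exact: Lspace_norm_class.
by rewrite -poweR_EFin finite_norm_fine powR_Lnorm ?gt_eqF.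
Qed.

Lemma Lfun_sumE (I : Type) (r : seq I) (g : I -> F) x :
  ((\sum_(i <- r) g i : F) : T -> R) x = \sum_(i <- r) (g i : T -> R) x.
Proof. exact: (big_morph (fun f : F => (f : T -> R) x)). Qed.

Lemma Lclass_sum (I : Type) (r : seq I) (g : I -> F) :
  Lclass (\sum_(i <- r) g i) = \sum_(i <- r) Lclass (g i).
Proof. by apply: (big_morph (@Lclass _ _ _ mu _ p1)) => // f h; exact: LclassDE. Qed.

Lemma Lspace_simple_approx (f : L) (eta : R) : 0 < eta ->
  exists (g : F) (s : seq R), (forall x, (g : T -> R) x \in s) /\ `|f - Lclass g| <= eta.
Proof.
move=> eta0; set h := Lspace_repr f.
have mh : measurable_fun setT (h : T -> R) by exact: measurable_funPT.
have hfin : (\int[mu]_x (`|(h : T -> R) x| `^ p)%:E < +oo)%E.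
  by rewrite -Lclass_normE ltry.
have [g [s [mg gs hg]]] := simple_approx_powR p0 mh hfin (powR_gt0 p eta0).
pose D x : R := (h : T -> R) x - g x.
have mD : measurable_fun setT D by exact: measurable_funB.
have DL : D \in Lfun mu p%:E.
  apply/andP; split; rewrite inE//.
  rewrite /= /finite_norm unlock /=; apply: poweR_lty.
  exact: lt_trans hg (ltry _).
pose dl : F := Lfun_Sub p1 DL.
(* As the difference of [h] and the error, both in L_p, the function [g] is obtained as an element
   of [F]. *)
exists (h - dl), s; split=> [x|].
  suff -> : ((h - dl : F) : T -> R) x = g x by [].
  by transitivity ((h : T -> R) x - D x) => //; rewrite /D opprB addrCA subrr addr0.
have -> : f - Lclass (h - dl) = Lclass dl.
  by rewrite LclassDE LclassNE /h Lspace_reprK opprD opprK addNKr.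
have : `|Lclass dl| `^ p <= eta `^ p.
  by rewrite -lee_fin Lclass_normE; exact: ltW.
by apply: ler_powR_inv => //; exact: ltW.
Qed.

Lemma Lspace_discretize n (b : 'I_n -> L) (eta : R) : 0 < eta ->
  exists (b' : 'I_n -> L) (N : nat) (w : 'I_N -> R) (v : 'I_N -> 'rV[R]_n),
  [/\ forall i, `|b i - b' i| <= eta, forall l, 0 <= w l &
      forall a : 'rV[R]_n,
        `|\sum_i a 0 i *: b' i| `^ p = \sum_l w l * `|dot a (v l)| `^ p].
Proof.
move=> eta0.
have /choice[gs hgs] : forall i, exists gs : F * seq R,
    (forall x, (gs.1 : T -> R) x \in gs.2) /\ `|b i - Lclass gs.1| <= eta.
  by move=> i; have [g [s h]] := Lspace_simple_approx (b i) eta0; exists (g, s).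
pose s := flatten [seq (gs i).2 | i <- enum 'I_n].
have gins i x : ((gs i).1 : T -> R) x \in s.
  apply/flattenP; exists (gs i).2; last exact: (hgs i).1.
  by apply: map_f; rewrite mem_enum.
have normE (a : 'rV[R]_n) : (`|\sum_i a 0 i *: Lclass (gs i).1| `^ p)%:E
    = (\int[mu]_x (`|\sum_i a 0 i * ((gs i).1 : T -> R) x| `^ p)%:E)%E.
  have -> : \sum_i a 0 i *: Lclass (gs i).1 = Lclass (\sum_i a 0 i *: (gs i).1).
    by rewrite Lclass_sum; apply: eq_bigr => i _; rewrite LclassZE.
  by rewrite Lclass_normE; apply: eq_integral => x _; rewrite Lfun_sumE.
have [|||N [w [v [w0 hv]]]] := @integral_finite_values _ T R mu p n (fun i => (gs i).1) s p0.
- by move=> i; exact: measurable_funPT.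
- exact: gins.
- by move=> a; rewrite -normE ltry.
exists (fun i => Lclass (gs i).1), N, w, v; split => // [i|a]; first exact: (hgs i).2.
by apply: EFin_inj; rewrite normE.
Qed.

End Lspace_discretization.

(** * Equivalence of norms on a finite-dimensional span *)

Section norm_equivalence.
Context {R : realType}.

(** The norm of the combination attains its minimum on the compact unit sphere, and independence
    makes it positive. An empty sphere leaves only [a = 0] to check. *)
Lemma lin_indep_norm_ge (V : normedModType R) n (b : 'I_n -> V) : lin_indep b ->
  exists2 kappa : R, 0 < kappa & forall a : 'rV[R]_n, kappa * l2norm a <= `|\sum_i a 0 i *: b i|.
Proof.
move=> indep; pose f (a : 'rV[R]_n) := `|\sum_i a 0 i *: b i|.
pose A : set 'rV[R]_n := [set a | l2norm a = 1].
have fZ c (a : 'rV[R]_n) : f (c *: a) = `|c| * f a.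
  rewrite -normrZ scaler_sumr; congr `|_|; apply: eq_bigr => i _.
  by rewrite mxE scalerA.
have normalize (a : 'rV[R]_n) : a != 0 -> 0 < l2norm a /\ A ((l2norm a)^-1 *: a).
  move=> a0; have la : 0 < l2norm a.
    rewrite lt_neqAle l2norm_ge0 andbT eq_sym.
    by apply: contra a0 => /eqP /l2norm_eq0 ->.
  by rewrite /A /= l2normZ gtr0_norm ?invr_gt0// mulVf// gt_eqF.
have [A0|/set0P A0] := eqVneq A set0.
  exists 1 => // a; have [->|/normalize[_]] := eqVneq a 0; last by rewrite A0.
  by rewrite l2norm0 mulr0.
have cf : continuous f.
  have cs (r : seq 'I_n) : continuous (fun a : 'rV[R]_n => \sum_(i <- r) a 0 i *: b i).
    elim: r => [|i r ih].
      rewrite (_ : (fun=> _) = fun=> 0); first exact: cst_continuous.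
      by apply/funext => a; rewrite big_nil.
    rewrite (_ : (fun=> _) = fun a : 'rV[R]_n => a 0 i *: b i + \sum_(j <- r) a 0 j *: b j); last first.
      by apply/funext => a; rewrite big_cons.
    move=> a.
    have ci : (c : 'rV[R]_n) 0 i @[c --> a] --> a 0 i by exact: coord_continuous.
    exact: (cvgD (cvgZr_tmp ci) (ih a)).
  by move=> a; exact: (cvg_norm (cs (index_enum _) a)).
have cl : continuous (@l2norm R n).
  have cs (r : seq 'I_n) : continuous (fun a : 'rV[R]_n => \sum_(i <- r) a 0 i ^+ 2).
    elim: r => [|i r ih].
      rewrite (_ : (fun=> _) = fun=> 0); first exact: cst_continuous.
      by apply/funext => a; rewrite big_nil.
    rewrite (_ : (fun=> _) = fun a : 'rV[R]_n => a 0 i ^+ 2 + \sum_(j <- r) a 0 j ^+ 2); last first.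
      by apply/funext => a; rewrite big_cons.
    move=> a.
    have ci : (c : 'rV[R]_n) 0 i @[c --> a] --> a 0 i by exact: coord_continuous.
    exact: (cvgD (cvgM ci ci) (ih a)).
  by move=> a; exact: (continuous_comp (cs (index_enum _) a) (@sqrt_continuous R _)).
have cA : compact A.
  apply: bounded_closed_compact.
    exists 1; split => // M M1 a Aa; rewrite /Num.norm /= mx_normrE.
    apply: bigmax_le => [|[i j] _ /=]; first by rewrite ltW// (lt_trans ltr01).
    by rewrite (ord1 i) (le_trans (normr_coord_le _ _))// Aa ltW.
  by apply: (preimage_closed (f := @l2norm R n) (D := [set 1])); [move=> a _; exact: cl|exact: closed_eq].
have [c /set_mem Ac cmin] := EVT_min_rV A0 cA (continuous_subspaceT (A := A) cf).
have fc0 : 0 < f c.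
  rewrite lt_neqAle normr_ge0 andbT eq_sym normr_eq0; apply/eqP => /indep c0.
  have : l2norm c = 0 by rewrite (_ : c = 0) ?l2norm0//; apply/rowP => i; rewrite c0 mxE.
  by rewrite Ac => /eqP; rewrite oner_eq0.
exists (f c) => // a.
have [->|/normalize[la Aa]] := eqVneq a 0; first by rewrite l2norm0 mulr0.
have := cmin _ (mem_set Aa); rewrite fZ gtr0_norm ?invr_gt0//.
by rewrite mulrC ler_pdivlMr.
Qed.

End norm_equivalence.

(** * The embedding *)

Section embedding.
Context {R : realType} (V : normedModType R) (n : nat) (b : 'I_n -> V).
Implicit Types (p e : R) (a : 'rV[R]_n).

Definition mx_comb k (A : 'M[R]_(k, n)) (x : 'rV[R]_k) : V :=
  \sum_i (x *m A) 0 i *: b i.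

Lemma mx_comb_is_linear k (A : 'M[R]_(k, n)) : linear (mx_comb A).
Proof.
move=> c x y; rewrite /mx_comb scaler_sumr -big_split; apply: eq_bigr => i _ /=.
by rewrite mulmxDl -scalemxAl !mxE scalerDl scalerA.
Qed.

HB.instance Definition _ k (A : 'M[R]_(k, n)) :=
  GRing.isLinear.Build R 'rV[R]_k V *:%R (mx_comb A) (mx_comb_is_linear A).

Lemma mx_comb_span k (A : 'M[R]_(k, n)) x : lin_span b (mx_comb A x).
Proof. by exists (fun i => (x *m A) 0 i). Qed.

Lemma mx_combZ k c (A : 'M[R]_(k, n)) x : mx_comb (c *: A) x = c *: mx_comb A x.
Proof.
rewrite /mx_comb scaler_sumr; apply: eq_bigr => i _.
by rewrite -scalemxAr mxE scalerA.
Qed.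

(** Settles the case where the required lower bound on [k] is at most [1]. *)
Lemma l2_embeds_rank1 e : lin_indep b -> (0 < n)%N -> 0 <= e -> l2_embeds 1 e (lin_span b).
Proof.
move=> indep n0 e0; pose i0 := Ordinal n0.
have b0 : 0 < `|b i0|.
  rewrite normr_gt0; apply/eqP => b0.
  have := indep (fun i => (i == i0)%:R).
  rewrite (bigD1 i0)//= b0 scaler0 add0r big1 => [h|i /negbTE ->]; last by rewrite scale0r.
  by have /eqP := h erefl i0; rewrite eqxx oner_eq0.
exists (mx_comb (`|b i0|^-1 *: delta_mx 0 i0)) => x.
have -> : `|mx_comb (`|b i0|^-1 *: delta_mx 0 i0) x| = l2norm x.
  rewrite mx_combZ normrZ gtr0_norm ?invr_gt0// /mx_comb (bigD1 i0)//= big1 => [|i ii0].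
    rewrite addr0 normrZ mulrCA mulVf ?gt_eqF// mulr1 mxE big_ord1 mxE !eqxx mulr1.
    by rewrite /l2norm big_ord1 sqrtr_sqr.
  by rewrite mxE big_ord1 mxE (negbTE ii0) andbF mulr0 scale0r.
split; [exact: mx_comb_span|exact: lexx|].
by rewrite ler_peMl ?l2norm_ge0// lerDl.
Qed.

(** [H] stands for the norm of the perturbed combinations. Both comparisons lose
    [(1 + e) / (1 - e)], and the square of this is at most [1 + 8 e] for [e <= 1/8]. *)
Lemma l2_embeds_section k e beta (A : 'M[R]_(k, n)) (H : 'rV[R]_n -> R) :
  0 < e <= 8^-1 -> 0 < beta ->
  (forall a, (1 - e) * `|\sum_i a 0 i *: b i| <= H a <= (1 + e) * `|\sum_i a 0 i *: b i|) ->
  (forall x, (1 - e) * beta * l2norm x <= H (x *m A) <= (1 + e) * beta * l2norm x) ->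
  l2_embeds k (8 * e) (lin_span b).
Proof.
move=> /andP[e0 e8] beta0 hH hA.
have e1 : 0 < 1 - e by lra.
(* The scaling that makes the lower bound exactly [l2norm x]. *)
pose s := (1 + e) / ((1 - e) * beta).
have s0 : 0 < s by rewrite divr_gt0 ?mulr_gt0//; lra.
exists (mx_comb (s *: A)) => x.
have /andP[h1 h2] := hH (x *m A); have /andP[h3 h4] := hA x.
have fE : `|mx_comb (s *: A) x| = s * `|mx_comb A x|.
  by rewrite mx_combZ normrZ (gtr0_norm s0).
have lo : l2norm x <= `|mx_comb (s *: A) x|.
  rewrite fE /s mulrAC ler_pdivlMr ?mulr_gt0// mulrC.
  exact: le_trans h3 h2.
have hi : `|mx_comb (s *: A) x| <= (1 + 8 * e) * l2norm x.
  rewrite fE /s mulrAC ler_pdivrMr ?mulr_gt0//.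
  have := le_trans h1 h4; rewrite -/(mx_comb A x).
  have := l2norm_ge0 x; set N := `|_|; set l := l2norm x => l0 hN.
  have hc : (1 + e) * (1 + e) <= (1 + 8 * e) * ((1 - e) * (1 - e)).
    have : 0 <= e * (4 - 16 * e + 8 * e ^+ 2).
      by rewrite mulr_ge0 ?(ltW e0)//; have := sqr_ge0 e; lra.
    nra.
  have bl : 0 <= beta * l by rewrite mulr_ge0// ltW.
  have e1p : 0 <= 1 + e by lra.
  rewrite -(ler_pM2l e1).
  have -> : (1 - e) * ((1 + e) * N) = (1 + e) * ((1 - e) * N) by ring.
  have -> : (1 - e) * ((1 + 8 * e) * l * ((1 - e) * beta))
    = (1 + 8 * e) * ((1 - e) * (1 - e)) * (beta * l) by ring.
  apply: le_trans (ler_wpM2l e1p hN) _.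
  have -> : (1 + e) * ((1 + e) * beta * l) = (1 + e) * (1 + e) * (beta * l) by ring.
  exact: ler_wpM2r.
by split; [exact: mx_comb_span|exact: lo|exact: hi].
Qed.

End embedding.

(** * Choice of the dimension *)

Section choice_of_dimension.
Context {R : realType}.
Implicit Types (p eps C q : R).

(** If [k <= q^2 M], both terms in the parenthesis are at most [q eps n], and [48 p C q <= 1] makes
    [2 C q eps n] at most [eps n / (24 p)]. The [1/2] in [q^2 / 2] pays for rounding up:
    [q^2 M / 2 > 1], so adding [1] to it does not exceed [q^2 M]. *)
Lemma exists_dimension p eps C n : 2 < p -> 0 < eps < 1 -> 0 < C -> (0 < n)%N ->
  let q := (1 + 48 * p * C)^-1 in
  let M := Num.min (eps ^+ 2 * n%:R) ((eps * n%:R) `^ (2 / p)) in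
  1 < q ^+ 2 / 2 * M ->
  exists k : nat, [/\ (0 < k)%N, q ^+ 2 / 2 * M <= k%:R &
    C * (Num.sqrt k%:R * Num.sqrt (n%:R / (3 * p)) + Num.sqrt k%:R `^ p)
      <= eps / 8 * (n%:R / (3 * p))].
Proof.
move=> p2 /andP[e0 e1] C0 n0 q M M1.
have p0 : 0 < p by apply: lt_trans p2.
have nR0 : 0 < n%:R :> R by rewrite ltr0n.
have pC0 : 0 < p * C by rewrite mulr_gt0.
have d1 : 1 < 1 + 48 * p * C by rewrite ltrDl -mulrA mulr_gt0.
have q0 : 0 < q by rewrite invr_gt0 (lt_trans ltr01).
have q1 : q <= 1 by rewrite invf_le1 ?ltW// (lt_trans ltr01).
have qC : 48 * p * C * q <= 1.
  rewrite /q ler_pdivrMr ?(lt_trans ltr01)// mul1r; lra.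
have M0 : 0 < M by rewrite lt_min !(mulr_gt0, exprn_gt0, powR_gt0).
set cM := q ^+ 2 / 2 * M in M1 *.
exists (Num.truncn cM).+1; split=> //; first by rewrite ltW// truncnS_gt.
set k := _.+1.
have kM : k%:R <= q ^+ 2 * M.
  have : (Num.truncn cM)%:R <= cM by rewrite truncn_le// ltW// (lt_trans ltr01).
  rewrite /k -natr1; have : cM + cM = q ^+ 2 * M by rewrite /cM; field.
  lra.
have sk : Num.sqrt k%:R <= q * Num.sqrt M.
  rewrite -[q in X in _ <= X](gtr0_norm q0) -sqrtr_sqr -sqrtrM ?sqr_ge0//.
  exact: ler_wsqrtr.
have sM1 : Num.sqrt M <= eps * Num.sqrt n%:R.
  rewrite -[eps in X in _ <= X](gtr0_norm e0) -sqrtr_sqr -sqrtrM ?sqr_ge0//.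
  by apply: ler_wsqrtr; rewrite ge_min lexx.
have sM2 : Num.sqrt M `^ p <= eps * n%:R.
  have en0 : 0 < eps * n%:R by rewrite mulr_gt0.
  rewrite -powR12_sqrt ?(ltW M0)// -powRrM.
  apply: (@le_trans _ _ (((eps * n%:R) `^ (2 / p)) `^ (2^-1 * p))).
    apply: ge0_ler_powR; rewrite ?nnegrE ?powR_ge0 ?(ltW M0)//.
      by rewrite mulr_ge0// ltW.
    by rewrite ge_min lexx orbT.
  rewrite -powRrM (_ : 2 / p * _ = 1) ?powRr1 ?(ltW en0)//.
  by field; rewrite gt_eqF.
have t1 : Num.sqrt k%:R * Num.sqrt (n%:R / (3 * p)) <= q * (eps * n%:R).
  have hm : Num.sqrt (n%:R / (3 * p)) <= Num.sqrt n%:R.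
    by apply: ler_wsqrtr; rewrite ler_pdivrMr ?mulr_gt0// ler_peMr ?(ltW nR0)//; lra.
  apply: (le_trans (ler_pM (sqrtr_ge0 _) (sqrtr_ge0 _) sk hm)).
  rewrite -mulrA; apply: ler_wpM2l; first exact: ltW.
  apply: (le_trans (ler_wpM2r (sqrtr_ge0 _) sM1)).
  by rewrite -mulrA -expr2 sqr_sqrtr// ltW.
have t2 : Num.sqrt k%:R `^ p <= q * (eps * n%:R).
  apply: (@le_trans _ _ ((q * Num.sqrt M) `^ p)).
    by apply: ge0_ler_powR; rewrite ?nnegrE ?(ltW p0) ?sqrtr_ge0 ?mulr_ge0 ?(ltW q0) ?sqrtr_ge0.
  rewrite powRM ?sqrtr_ge0 ?(ltW q0)//; apply: ler_pM; rewrite ?powR_ge0//.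
  have -> : p = 1 + (p - 1) by ring.
  rewrite powRD ?(gt_eqF q0) ?implybT// powRr1 ?(ltW q0)//.
  rewrite ger_pMr//; apply: powR_le1; rewrite ?(ltW q0)//; lra.
apply: (@le_trans _ _ (C * (2 * (q * (eps * n%:R))))).
  by apply: ler_wpM2l; [exact: ltW|lra].
have -> : eps / 8 * (n%:R / (3 * p)) = eps * n%:R / (24 * p).
  by field; rewrite gt_eqF.
rewrite ler_pdivlMr ?mulr_gt0//.
have -> : C * (2 * (q * (eps * n%:R))) * (24 * p) = 48 * p * C * q * (eps * n%:R) by ring.
by rewrite ler_piMl// ltW// mulr_gt0.
Qed.

End choice_of_dimension.

Lemma powR_1B_le {R : realType} (p e : R) : 1 < p -> 0 < e < 1 -> (1 - e) `^ p <= 1 - e.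
Proof.
move=> p1 /andP[e0 e1]; have d0 : 0 < 1 - e by rewrite subr_gt0.
rewrite (_ : p = 1 + (p - 1)); last by ring.
rewrite powRD ?(gt_eqF d0) ?implybT// powRr1 ?(ltW d0)//.
rewrite ger_pMr//; apply: powR_le1; rewrite ?(ltW d0) ?gerBl ?(ltW e0) ?subr_ge0 ?(ltW p1)//.
Qed.

Lemma powR_1D_ge {R : realType} (p e : R) : 1 < p -> 0 < e -> 1 + e <= (1 + e) `^ p.
Proof.
move=> p1 e0; have d0 : 0 < 1 + e by rewrite addr_gt0.
rewrite (_ : p = 1 + (p - 1)); last by ring.
rewrite powRD ?(gt_eqF d0) ?implybT// powRr1 ?(ltW d0)//.
rewrite ler_pMr//; apply: powR_ge1; rewrite ?lerDl ?(ltW e0) ?subr_ge0 ?(ltW p1)//.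
Qed.

(** As [sum_i |a_i| <= sqrt n |a|], a perturbation of each vector by [e kappa / sqrt n] moves the
    combination by at most [e kappa |a|], a fraction [e] of its norm. *)
Lemma norm_comb_perturb {R : realType} (V : normedModType R) n (b b' : 'I_n -> V)
    (kappa e : R) (a : 'rV[R]_n) : (0 < n)%N -> 0 <= kappa -> 0 <= e ->
  kappa * l2norm a <= `|\sum_i a 0 i *: b i| ->
  (forall i, `|b i - b' i| <= e * kappa / Num.sqrt n%:R) ->
  (1 - e) * `|\sum_i a 0 i *: b i| <= `|\sum_i a 0 i *: b' i|
    <= (1 + e) * `|\sum_i a 0 i *: b i|.
Proof.
move=> n0 k0 e0 hb hbb.
have sn0 : 0 < Num.sqrt n%:R :> R by rewrite sqrtr_gt0 ltr0n.
have hd : `|\sum_i a 0 i *: b i - \sum_i a 0 i *: b' i| <= e * `|\sum_i a 0 i *: b i|.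
  rewrite -sumrB; apply: (le_trans (ler_norm_sum _ _ _)).
  apply: (@le_trans _ _ (\sum_i `|a 0 i| * (e * kappa / Num.sqrt n%:R))).
    apply: ler_sum => i _; rewrite -scalerBr normrZ.
    by apply: ler_wpM2l; [exact: normr_ge0|exact: hbb].
  rewrite -mulr_suml; apply: (@le_trans _ _ (e * (kappa * l2norm a))); last exact: ler_wpM2l.
  rewrite [leLHS]mulrA ler_pdivrMr// [leLHS]mulrC.
  rewrite (_ : e * (kappa * l2norm a) * _ = e * kappa * (Num.sqrt n%:R * l2norm a)); last by ring.
  by apply: ler_wpM2l; [rewrite mulr_ge0|exact: sum_normr_coord_le].
set x := \sum_i a 0 i *: b i in hb hd *; set y := \sum_i _ in hd *.
have h1 := ler_normD (x - y) y; rewrite subrK in h1.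
have h2 := ler_normD (y - x) x; rewrite subrK in h2; rewrite distrC in h2.
by apply/andP; split; rewrite ?mulrBl ?mulrDl mul1r; [rewrite lerBlDl|rewrite addrC]; lra.
Qed.

Theorem theorem1p1 (R : realType) (p : R) (hp : 2 < p) :
  exists c : R, 0 < c /\
    forall (d : measure_display) (T : measurableType d)
           (mu : {measure set T -> \bar R})
           (n : nat) (X : set (LspaceType mu (ge1_of_gt2 hp))) (eps : R),
      (1 <= n)%N -> subspace_of_dim n X -> 0 < eps < 1 ->
      exists k : nat,
        c * Num.min (eps ^+ 2 * n%:R) ((eps * n%:R) `^ (2 / p)) <= k%:R /\
        l2_embeds k eps X.
Proof.
have C0 := embed_cst_gt0 hp.
have p0 : 0 < p by apply: lt_trans hp.
have p1 : 1 < p by apply: lt_trans hp; rewrite ltr1n.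
pose q := (1 + 48 * p * embed_cst p)^-1.
have q0 : 0 < q by rewrite invr_gt0 addr_gt0// mulr_gt0// mulr_gt0.
exists (q ^+ 2 / 2); split; first by rewrite divr_gt0// exprn_gt0.
move=> d T mu n X eps n0 [b [indep ->]] e01; have /andP[e0 e1] := e01.
have [le1|gt1] := leP (q ^+ 2 / 2 * Num.min (eps ^+ 2 * n%:R) ((eps * n%:R) `^ (2 / p))) 1.
  by exists 1%N; split=> //; apply: l2_embeds_rank1 => //; exact: ltW.
have [k [k0 hk kC]] := exists_dimension hp e01 C0 n0 gt1.
exists k; split=> //.
(* [l2_embeds_section] turns the tolerance [e] into [8 * e]. *)
pose e := eps / 8.
have ep0 : 0 < e by rewrite divr_gt0.
have e8 : 0 < e <= 8^-1 by rewrite ep0 /e ler_pdivrMr// mulVf// ltW.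
have el1 : 0 < e < 1 by move: e8 => /andP[-> /=] /le_lt_trans; apply; rewrite invf_lt1// ltr1n.
have d0 : 0 < 1 - e by rewrite subr_gt0; case/andP: el1.
have [kappa kappa0 hkappa] := lin_indep_norm_ge indep.
have sn0 : 0 < Num.sqrt n%:R :> R by rewrite sqrtr_gt0 ltr0n.
have eta0 : 0 < e * kappa / Num.sqrt n%:R by rewrite divr_gt0// mulr_gt0.
have [b' [N [w [v [hbb w0 hw]]]]] := Lspace_discretize b eta0.
have hH a := norm_comb_perturb n0 (ltW kappa0) (ltW ep0) (hkappa a) hbb.
(* The coercivity that keeps the determinant problem bounded: it survives the perturbation of the
   basis up to [1 - e]. *)
have wkappa (a : 'rV[R]_n) : ((1 - e) * kappa) `^ p * l2norm a `^ p
    <= \sum_l w l * `|dot a (v l)| `^ p.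
  rewrite -hw -powRM ?l2norm_ge0 ?mulr_ge0 ?(ltW d0) ?(ltW kappa0)//.
  apply: ge0_ler_powR; rewrite ?nnegrE ?(ltW p0)//.
    by rewrite !mulr_ge0 ?l2norm_ge0 ?(ltW d0) ?(ltW kappa0).
  have /andP[h _] := hH a; apply: le_trans h; rewrite -mulrA.
  by apply: ler_wpM2l; [exact: ltW|exact: hkappa].
have kap0 : 0 < ((1 - e) * kappa) `^ p by rewrite powR_gt0// mulr_gt0.
have [A hA] := almost_spherical_section hp el1 n0 k0 w0 kap0 wkappa kC.
pose gam : R := fine (gauss_moment p).
have gam0 : 0 < gam by exact: gauss_moment_fine_gt0.
(* The common value, up to [1 - e] and [1 + e], of the norm on the sphere after [p]-th roots are
   taken. *)
pose beta := gam `^ p^-1.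
have beta0 : 0 < beta by rewrite powR_gt0.
have betap : beta `^ p = gam by rewrite /beta -powRrM mulVf ?gt_eqF// powRr1// ltW.
have -> : eps = 8 * e by rewrite /e mulrC divfK.
apply: (l2_embeds_section (b := b) (A := A) (H := fun a => `|\sum_i a 0 i *: b' i|) e8 beta0 hH).
move=> x; have /andP[h1 h2] := hA x; rewrite -hw in h1 h2.
have l0 := l2norm_ge0 x.
have lp0 : 0 <= gam * l2norm x `^ p by rewrite mulr_ge0 ?powR_ge0 ?(ltW gam0).
have de0 : 0 <= 1 + e by rewrite addr_ge0// ltW.
(* Taking roots only improves the factors: [(1 - e)^p <= 1 - e] and [1 + e <= (1 + e)^p]. *)
apply/andP; split; apply: (ler_powR_inv p0); rewrite ?normr_ge0 ?mulr_ge0 ?(ltW d0) ?(ltW beta0)//.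
  rewrite !powRM ?mulr_ge0 ?(ltW d0) ?(ltW beta0)// betap; apply: le_trans h1.
  by rewrite -!mulrA; apply: ler_wpM2r => //; exact: powR_1B_le.
rewrite !powRM ?mulr_ge0 ?(ltW beta0)// betap; apply: (le_trans h2).
by rewrite -!mulrA; apply: ler_wpM2r => //; exact: powR_1D_ge.
Qed.
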